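(* Let $n\ge1$, $a>0$, $0<\lambda<1/2$, and let $\kappa=\log 2/\log(1/\lambda)$. Assume $s>a\kappa/2$ and $f\in H_s(\mathbb{R}^n)$. Then for almost every $x\in\mathbb{R}^n$ one can modify the function $t\mapsto S_tf(x)$, $t\in C(\lambda)$, on an $m_\kappa$-nullset (depending on $x$) so that, after modification, $$\lim_{\substack{t\to0\\ t\in C(\lambda)}}S_tf(x)=f(x).$$
   Context: Cantor set $C(\lambda)$: set $I_{0,1}=[0,1]$, $I_{1,1}=[0,\lambda]$, $I_{1,2}=[1-\lambda,1]$. Having defined $I_{k-1,1},\dots,I_{k-1,2^{k-1}}$ (each of length $\lambda^{k-1}$), define $I_{k,1},\dots,I_{k,2^k}$ by removing from the middle of each $I_{k-1,j}$ an interval of length $(1-2\lambda)\lambda^{k-1}$. Then $C(\lambda)=\bigcap_{k=0}^\infty\bigcup_{j=1}^{2^k}I_{k,j}$. It is known that $C(\lambda)$ has Hausdorff dimension $\kappa=\log2/\log(1/\lambda)$ and $m_\kappa(C(\lambda))=1$, where $m_\kappa$ is $\kappa$-dimensional Hausdorff measure on $\mathbb{R}$. The Fourier transform is $\hat f(\xi)=\int_{\mathbb{R}^n}e^{-i\xi\cdot x}f(x)\,dx$, and $H_s=\{f\in\mathscr{S}' : \|f\|_{H_s}<\infty\}$ with $\|f\|_{H_s}=\left(\int_{\mathbb{R}^n}(1+|\xi|^2)^s|\hat f(\xi)|^2\,d\xi\right)^{1/2}$. Precise definition of $S_tf(x)$ for $f\in L^2(\mathbb{R}^n)$ and $(x,t)\in\mathbb{R}^n\times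 E$, with $E=C(\lambda)$: let $m$ be Lebesgue measure on $\mathbb{R}^n$, $Q=[-\frac12,\frac12]^n$ and $$f_N(x,t)=(2\pi)^{-n}\int_{NQ}e^{i\xi\cdot x}e^{it|\xi|^a}\hat f(\xi)\,d\xi,\qquad (x,t)\in\mathbb{R}^n\times E,\ N=1,2,3,\dots.$$ By well-known estimates (Carleson-type theorem for cubes) there is a set $F\subset\mathbb{R}^n\times E$ with $(m\times m_\kappa)((\mathbb{R}^n\times E)\setminus F)=0$ such that $\lim_{N\to\infty}f_N(x,t)$ exists for every $(x,t)\in F$. One sets $S_tf(x)$ equal to this limit for $(x,t)\in F$; this is a function defined $m\times m_\kappa$-almost everywhere on $\mathbb{R}^n\times E$ and measurable with respect to $m\times m_\kappa$. *)

(* Defs.v *)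
From HB Require Import structures.
From mathcomp Require Import all_boot all_order all_algebra.
From mathcomp Require Import complex.
From mathcomp Require Import all_classical all_reals all_analysis.

Set Implicit Arguments.
Unset Strict Implicit.
Unset Printing Implicit Defensive.

Import Order.TTheory GRing.Theory Num.Theory.
Import numFieldTopology.Exports numFieldNormedType.Exports.

Local Open Scope classical_set_scope.
Local Open Scope ring_scope.
Local Open Scope complex_scope.

Section leb_step.
Context {R : realType} (n : nat).
Variable mu : {sigma_finite_measure set (n.-tuple R) -> \bar R}.

Definition cons_pair (p : measurableTypeR R * n.-tuple R) : n.+1.-tuple R :=
  [tuple of p.1 :: p.2].

Lemma measurable_cons_pair : measurable_fun [set: measurableTypeR R * n.-tuple R] cons_pair.
Proof. by apply: (@measurable_cons _ _ _ R). Qed.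

Definition leb_step : set (n.+1.-tuple R) -> \bar R :=
  pushforward (@lebesgue_measure R \x mu)%E cons_pair.

Let mu_cons := measure_function_pushforward__canonical__measure_function_Measure
  (@lebesgue_measure R \x mu)%E measurable_cons_pair.

Let leb_step0 : leb_step set0 = 0%E.
Proof. exact: (measure0 mu_cons). Qed.

Let leb_step_ge0 A : (0 <= leb_step A)%E.
Proof. exact: (measure_ge0 mu_cons). Qed.

Let leb_step_sigma_additive : semi_sigma_additive leb_step.
Proof. exact: (@measure_semi_sigma_additive _ _ _ mu_cons). Qed.

HB.instance Definition _ := isMeasure.Build _ _ _
  leb_step leb_step0 leb_step_ge0 leb_step_sigma_additive.

Lemma leb_step_sigma_finite : sigma_finite setT leb_step.
Proof.
have [F FT Fb] : sigma_finite setT (@lebesgue_measure R \x mu)%E.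
  have /sigma_finiteP[F [TF ndF Foo]] := sigma_finiteT (@lebesgue_measure R).
  have /sigma_finiteP[G [TG ndG Goo]] := sigma_finiteT mu.
  exists (fun k => F k `*` G k).
    rewrite -setXTT TF TG predeqE => -[x y]; split.
      move=> [/= [k _ Fnx] [l _ Gky]]; exists (maxn k l) => //; split.
      - by move: x Fnx; exact/subsetPset/ndF/leq_maxl.
      - by move: y Gky; exact/subsetPset/ndG/leq_maxr.
    by move=> [k _ []/= ? ?]; split; exists k.
  move=> k; have [? ?] := Foo k; have [? ?] := Goo k.
  split; first exact: measurableX.
  by rewrite product_measure1E// lte_mul_pinfty// ge0_fin_numE.
pose unc (x : n.+1.-tuple R) : measurableTypeR R * n.-tuple R :=
  (tnth x ord0, [tuple of behead x]).
have mth : measurable_fun [set: n.+1.-tuple R] unc.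
  apply/measurable_fun_pairP; split.
    exact: (@measurable_tnth _ R).
  exact: measurable_behead.
have consK p : unc (cons_pair p) = p.
  by case: p => x t; congr (_, _); apply: val_inj.
exists (fun k => unc @^-1` F k).
  by rewrite -preimage_bigcup -FT preimage_setT.
move=> k; have [mF Flt] := Fb k; split.
  by rewrite -[X in measurable X]setTI; exact: mth.
rewrite /leb_step /pushforward (_ : _ @^-1` _ = F k)//.
by apply/seteqP; split => p /=; rewrite consK.
Qed.

HB.instance Definition _ :=
  Measure_isSigmaFinite.Build _ _ _ leb_step leb_step_sigma_finite.
End leb_step.

Fixpoint leb (R : realType) (n : nat) :
    {sigma_finite_measure set (n.-tuple R) -> \bar R} :=
  match n with
  | 0 => dirac [tuple]
  | n'.+1 => leb_step (leb R n')
  end.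

Section euclidean.
Context {R : realType} {n : nat}.
Implicit Types x y : n.-tuple R.

Definition dot x y : R := \sum_(i < n) tnth x i * tnth y i.
Definition enorm x : R := Num.sqrt (dot x x).

(* [n.-tuple R] carries the product sigma-algebra but no topology in the
   library, and ['rV[R]_n] the topology but no sigma-algebra: points are
   tuples, and derivatives are computed through this identification. *)
Definition of_rV (v : 'rV[R]_n) : n.-tuple R := [tuple v ord0 i | i < n].
Definition to_rV x : 'rV[R]_n := \row_(i < n) tnth x i.

Definition partial (i : 'I_n) (phi : n.-tuple R -> R) : n.-tuple R -> R :=
  fun x => 'D_(delta_mx ord0 i) (phi \o of_rV) (to_rV x).

Definition ipartial (s : seq 'I_n) (phi : n.-tuple R -> R) :
    n.-tuple R -> R :=
  foldr partial phi s.

Definition smooth (phi : n.-tuple R -> R) : Prop :=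
  forall s : seq 'I_n,
    continuous (ipartial s phi \o of_rV) /\
    forall (i : 'I_n) (v : 'rV[R]_n),
      derivable (ipartial s phi \o of_rV) v (delta_mx ord0 i).

Definition rdecreasing (phi : n.-tuple R -> R) : Prop :=
  forall (k : nat) (s : seq 'I_n), exists M : R,
    forall x, (1 + enorm x) ^+ k * `|ipartial s phi x| <= M.

Definition re_part (F : n.-tuple R -> R[i]) : n.-tuple R -> R :=
  fun x => complex.Re (F x).
Definition im_part (F : n.-tuple R -> R[i]) : n.-tuple R -> R :=
  fun x => complex.Im (F x).

Definition schwartz (phi : n.-tuple R -> R[i]) : Prop :=
  [/\ smooth (re_part phi), rdecreasing (re_part phi),
      smooth (im_part phi) & rdecreasing (im_part phi)].

(* [B] bounds the seminorms of order at most [m] of [phi]; these bounds define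
   the topology of the Schwartz space. *)
Definition schwartz_bound (m : nat) (phi : n.-tuple R -> R[i]) (B : R) : Prop :=
  forall (k : nat) (s : seq 'I_n) x, (k <= m)%N -> (size s <= m)%N ->
    (1 + enorm x) ^+ k * `|ipartial s (re_part phi) x| <= B /\
    (1 + enorm x) ^+ k * `|ipartial s (im_part phi) x| <= B.

Definition cint (D : set (n.-tuple R)) (F : n.-tuple R -> R[i]) : R[i] :=
  (\int[leb R n]_(x in D) re_part F x) +i*
  (\int[leb R n]_(x in D) im_part F x).

Definition cintegrable (F : n.-tuple R -> R[i]) : Prop :=
  (leb R n).-integrable setT (EFin \o re_part F) /\
  (leb R n).-integrable setT (EFin \o im_part F).

Definition cmeasurable (F : n.-tuple R -> R[i]) : Prop :=
  measurable_fun setT (re_part F) /\ measurable_fun setT (im_part F).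

Definition expi (theta : R) : R[i] := cos theta +i* sin theta.

Definition schwartz_fourier (phi : n.-tuple R -> R[i]) : n.-tuple R -> R[i] :=
  fun xi => cint setT (fun x => expi (- dot xi x) * phi x).

Definition pairing (f phi : n.-tuple R -> R[i]) : R[i] :=
  cint setT (fun x => f x * phi x).

(* [f] is a function in S': it defines the tempered distribution
   [pairing f]. *)
Definition tempered (f : n.-tuple R -> R[i]) : Prop :=
  [/\ cmeasurable f,
      (forall phi, schwartz phi -> cintegrable (fun x => f x * phi x)) &
      exists (m : nat) (M : R), forall phi B, schwartz phi ->
        schwartz_bound m phi B -> Normc.normc (pairing f phi) <= M * B].

Definition is_fourier (f g : n.-tuple R -> R[i]) : Prop :=
  tempered g /\
  forall phi, schwartz phi -> pairing g phi = pairing f (schwartz_fourier phi).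

(* A chosen representative of the Fourier transform in S' of [f], when the
   latter is a function (it is then unique up to a null set). *)
Definition fourier (f : n.-tuple R -> R[i]) : n.-tuple R -> R[i] :=
  xget (fun=> 0) [set g | is_fourier f g].

Definition sobolev_norm (s : R) (f : n.-tuple R -> R[i]) : \bar R :=
  poweR (\int[leb R n]_xi
    ((1 + enorm xi ^+ 2) `^ s * Normc.normc (fourier f xi) ^+ 2)%:E)%E (2^-1).

(* The members of H_s that are functions; for s >= 0, which is the case of
   interest, every member of H_s is one. *)
Definition sobolev (s : R) (f : n.-tuple R -> R[i]) : Prop :=
  [/\ tempered f, is_fourier f (fourier f) & (sobolev_norm s f < +oo)%E].

Definition cube (N : nat) : set (n.-tuple R) :=
  [set xi | forall i, `|tnth xi i| <= N%:R / 2].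

Definition fN (a : R) (f : n.-tuple R -> R[i]) (N : nat)
    (x : n.-tuple R) (t : R) : R[i] :=
  ((2 * pi) ^- n)%:C *
  cint (cube N) (fun xi =>
    expi (dot xi x) * expi (t * enorm xi `^ a) * fourier f xi).

Definition St_dom (a : R) (f : n.-tuple R -> R[i]) : set (n.-tuple R * R) :=
  [set p | cvgn (fun N => fN a f N p.1 p.2 : R[i]^o)].

(* Meaningful on [St_dom a f] only. *)
Definition St (a : R) (f : n.-tuple R -> R[i]) (t : R) (x : n.-tuple R) :
    R[i] :=
  limn (fun N => fN a f N x t : R[i]^o).

End euclidean.

Section cantor_hausdorff.
Context {R : realType}.

(* The list of the endpoints of the intervals I_{k,j}, j = 1, ..., 2^k. *)
Fixpoint cantor_intervals (lambda : R) (k : nat) : seq (R * R) :=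
  match k with
  | 0 => [:: (0, 1)]
  | k'.+1 => flatten [seq [:: (J.1, J.1 + lambda ^+ k);
                              (J.2 - lambda ^+ k, J.2)]
                     | J <- cantor_intervals lambda k']
  end.

Definition cantor (lambda : R) : set R :=
  \bigcap_(k in [set: nat])
    \bigcup_(J in [set` cantor_intervals lambda k]) `[J.1, J.2]%classic.

Definition diam (U : set R) : \bar R :=
  maxe 0%E (ereal_sup [set `|p.1 - p.2|%:E | p in U `*` U]).

Definition hausdorff_content (kappa delta : R) (A : set R) : \bar R :=
  ereal_inf [set (\sum_(0 <= k <oo) poweR (diam (U k)) kappa)%E | U in
    [set U : nat -> set R | A `<=` \bigcup_k U k /\
                            forall k, (diam (U k) <= delta%:E)%E]].

Definition hausdorff_measure (kappa : R) (A : set R) : \bar R :=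
  ereal_sup [set hausdorff_content kappa delta A
            | delta in [set delta : R | 0 < delta]].

End cantor_hausdorff.

(* Main.v *)
From HB Require Import structures.
Require Import Defs.
From mathcomp Require Import all_boot all_order all_algebra.
From mathcomp Require Import complex.
From mathcomp Require Import all_classical all_reals all_analysis.
From mathcomp Require Import measurable_realfun.
From mathcomp Require Import ring lra.

(* For almost every [x] the partial integrals [fN a f N x t] converge for every
   [t] in the Cantor set and the limit is continuous at [0] along it, so that the
   exceptional set is empty and [h t] can be taken to be [St a f t x].

   Two chainings are combined. In the frequency variable, the theorem of
   Rademacher and Menshov: every [N] between [2^m] and [2^(m+1)] is reached from
   [2^m] by dyadic blocks of cubes, and the logarithmic loss of the sum of the
   squares of these blocks is paid by a factor [(1 + |xi|^2)^eps]. In the time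
   variable, every point of the Cantor set is reached from [0] by steps of length
   [lambda^l (1 - lambda)] between left endpoints of intervals of level [l]. Such
   a step [d] costs [(d |xi|^a)^th] in the Fourier transform, and the [2^l] steps of
   level [l] have a summable total mass as soon as [2 lambda^(2 th) < 1], that is
   [th > kappa / 2]; both losses are allowed when [a th + eps <= s]. Bounding a
   single maximal function in L^2 thus controls all [N] and all [t] at once.

   The limit at [t = 0] is identified with [f] by testing both against Gaussians:
   these are Schwartz functions with an explicit Fourier transform, and an
   integrable function whose Fourier transform vanishes is zero. *)

Set Implicit Arguments.
Unset Strict Implicit.
Unset Printing Implicit Defensive.

Import Order.TTheory GRing.Theory Num.Theory.
Import numFieldTopology.Exports numFieldNormedType.Exports.
Local Open Scope classical_set_scope.
Local Open Scope ring_scope.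

(** * Fourier transform of the normal density *)

(** The null set of [x] has to serve uncountably many [t], and [St] is a limit over all integers
    [N], not over a subsequence. As [fourier f] need not be integrable, absolute bounds on the
    partial integrals are out of reach; the analytic input is [bessel], one half of Plancherel's
    theorem, which controls one square norm at a time. A supremum must therefore be dominated by a
    countable sum of squares, and chaining is what keeps that sum small.

    The threshold for [th] is [kappa / 2] because [lambda ^ kappa = 1 / 2]. Each geometric decay is
    split by a weight: one part makes the series of weighted squares converge, the other part
    survives in every single term. Only left endpoints are chained; a general point of the Cantor
    set is reached because, for a fixed cube, the partial integral is Lipschitz in [t], with a
    constant that disappears in the limit.

    Complex exponentials are replaced throughout by [cos (dot xi x + c)] with a free phase [c],
    which covers real and imaginary parts at once. Gaussian factors stand in wherever an absolutely
    convergent integral is needed. *)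

Section gauss1.
Context {R : realType}.
Local Notation mu := (@lebesgue_measure R).
Implicit Types (m s u c x : R).

Lemma is_derive_normal_pdf m s x : s != 0 ->
  is_derive x 1 (normal_pdf m s) (- ((x - m) / s ^+ 2) * normal_pdf m s x).
Proof.
move=> s0; rewrite normal_pdfE// /normal_fun.
have d1 : is_derive x (1 : R) (fun y : R => - (y - m) ^+ 2 / (s ^+ 2 *+ 2))
    (- ((x - m) / s ^+ 2)).
  have -> : (fun y : R => - (y - m) ^+ 2 / (s ^+ 2 *+ 2)) =
    (- (s ^+ 2 *+ 2)^-1) \*: ((id - cst m) ^+ 2 : R -> R).
    by apply/funext => y /=; rewrite !fctE mulNr mulrC -mulNr.
  apply: is_derive_eq; rewrite !fctE /= subr0 expr1 /GRing.scale/= mulr1.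
  by field.
have d2 := @is_derive1_comp _ expR _ x _ _ (is_derive_expR _) d1.
have := is_deriveZ (normal_peak s) d2.
rewrite /GRing.scale /= => h.
have E : GRing.mul (normal_peak s) \o (expR \o (fun y : R => - (y - m) ^+ 2 / (s ^+ 2 *+ 2))) =
  (fun x => normal_peak s * expR (- (x - m) ^+ 2 / (s ^+ 2 *+ 2))) by [].
rewrite -E; apply: (is_derive_eq h).
by ring.
Qed.

(** With [z = (x - m) / s], the factor [exp (- z^2 / 2)] splits into two copies of
    [exp (- z^2 / 4)]. One of them absorbs [|z|], since [|z| <= 1 + z^2 / 4]; the other is the
    density of width [sqrt 2 * s]. *)
Lemma normr_mul_normal_pdf m s x : s != 0 ->
  `|x - m| * normal_pdf m s x <=
  (`|s| * (normal_peak s / normal_peak (Num.sqrt 2 * s))) *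
  normal_pdf m (Num.sqrt 2 * s) x.
Proof.
move=> s0.
have s20 : Num.sqrt 2 * s != 0 by rewrite mulf_neq0// sqrtr_eq0 -ltNge ltr0n.
rewrite !normal_pdfE//.
have p2 := normal_peak_gt0 s20.
rewrite [X in _ <= X](_ : _ = normal_peak s * (`|s| * normal_fun m (Num.sqrt 2 * s) x));
  last by field; rewrite gt_eqF.
rewrite mulrCA ler_pM2l ?normal_peak_gt0//.
rewrite /normal_fun exprMn sqr_sqrtr//.
set z := (x - m) / s.
have -> : - (x - m) ^+ 2 / (s ^+ 2 *+ 2) = - (z ^+ 2 / 4) - (z ^+ 2 / 4).
  by rewrite /z; field.
have -> : - (x - m) ^+ 2 / (2 * s ^+ 2 *+ 2) = - (z ^+ 2 / 4).
  by rewrite /z; field.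
rewrite expRD.
have -> : `|x - m| = `|s| * `|z| by rewrite -normrM /z mulrC divfK.
rewrite -mulrA ler_pM2l ?normr_gt0// mulrA ler_piMl ?expR_ge0//.
rewrite expRN ler_pdivrMr ?expR_gt0// mul1r.
apply: le_trans (expR_ge1Dx _).
have := sqr_ge0 (`|z| - 2); rewrite -(real_normK (num_real z)); nra.
Qed.

(** The fundamental theorem of calculus on the intervals of radius [n.+1] around [m], followed by
    dominated convergence. *)
Lemma integral_deriv_eq0 (m : R) (F f : R -> R) :
  (forall x, is_derive x 1 F (f x)) -> continuous f ->
  mu.-integrable setT (EFin \o f) ->
  F (m + n.+1%:R) @[n --> \oo] --> 0 -> F (m - n.+1%:R) @[n --> \oo] --> 0 ->
  \int[mu]_x f x = 0.
Proof.
move=> dF cf fi F1 F2.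
have dF' x : derivable F x 1 by case: (dF x).
have cF x : {for x, continuous F} by exact/differentiable_continuous/derivable1_diffP.
have fF n : \int[mu]_x (f \_ `[m - n.+1%:R, m + n.+1%:R]) x =
    F (m + n.+1%:R) - F (m - n.+1%:R).
  rewrite -Rintegral_mkcond /Rintegral.
  rewrite (@continuous_FTC2 _ f F)//.
  - by rewrite ltrD2l gtrN// ltr0n.
  - exact: continuous_subspaceT.
  - split.
    + by move=> x _; exact: dF'.
    + by apply: cvg_at_right_filter; exact: cF.
    + by apply: cvg_at_left_filter; exact: cF.
  - by move=> x _; rewrite derive1E; case: (dF x).
have lim1 : (F (m + n.+1%:R) - F (m - n.+1%:R)) @[n --> \oo] --> (0 : R).
  by rewrite -(subr0 0); apply: cvgB.
have mf : measurable_fun setT f by exact: continuous_measurable_fun.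
have lim2 : (\int[mu]_x (f \_ `[m - n.+1%:R, m + n.+1%:R]) x) @[n --> \oo] -->
    \int[mu]_x f x.
  apply: fine_cvg; rewrite /Rintegral fineK; last exact: integrable_fin_num.
  apply: (@dominated_cvg _ _ _ mu setT measurableT _ _ (fun x => `|f x|%:E)) => //.
  - by move=> n; apply/measurable_EFinP/(measurable_restrict _ _ _).1 => //;
      rewrite setTI; apply: measurable_funTS.
  - move=> x _; apply: cvg_EFin; first exact: nearW.
    apply: (@cvg_near_cst _ _ (f x)).
    have [N xN] : exists N : nat, `|x - m| <= N%:R.
      by exists (Num.bound `|x - m|); apply/ltW; exact: archi_boundP.
    exists N => // n /= Nn; rewrite patchE mem_set//= in_itv/=.
    have : `|x - m| <= n.+1%:R.
      by rewrite (le_trans xN)// ler_nat (leq_trans Nn).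
    by rewrite ler_norml lerBlDl lerBrDl => /andP[h1 h2]; rewrite h1 h2.
  - exact: (integrable_norm fi).
  - by move=> n x _; rewrite lee_fin patchE; case: ifP => //; rewrite normr0.
have e := cvg_unique _ lim2 _.
apply: e => //.
by rewrite (_ : (fun n => _) = (fun n => F (m + n.+1%:R) - F (m - n.+1%:R)))//; apply/funext.
Qed.

End gauss1.

Section gauss2.
Context {R : realType}.
Local Notation mu := (@lebesgue_measure R).
Implicit Types (m s u c x : R).

Lemma normr_cos_le1 (x : R) : `|cos x| <= 1.
Proof. by rewrite ler_norml cos_geN1 cos_le1. Qed.
Lemma normr_sin_le1 (x : R) : `|sin x| <= 1.
Proof. by rewrite ler_norml sin_geN1 sin_le1. Qed.

Lemma integrable_bounded_mul d (T : measurableType d) (nu : {measure set T -> \bar R})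
    (D : set T) (B : R) (h g : T -> R) : measurable D -> measurable_fun D h ->
  (forall y, `|h y| <= B) -> nu.-integrable D (EFin \o g) ->
  nu.-integrable D (EFin \o (fun y => h y * g y)).
Proof.
move=> mD mh hB gi.
have := integrableMr mD mh _ gi.
rewrite (_ : ((EFin \o h) \* (EFin \o g))%E = EFin \o (fun y => h y * g y)); last first.
  by apply/funext => x /=; rewrite EFinM.
apply; exists B; split; first exact: num_real.
by move=> M BM x _ /=; rewrite (le_trans (hB x))// ltW.
Qed.

Lemma integrable_le d (T : measurableType d) (nu : {measure set T -> \bar R})
    (h g : T -> R) : measurable_fun setT h -> (forall y, `|h y| <= g y) ->
  nu.-integrable setT (EFin \o g) -> nu.-integrable setT (EFin \o h).
Proof.
move=> mh hg; apply: le_integrable => //; first exact/measurable_EFinP.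
by move=> y _ /=; rewrite lee_fin (le_trans (hg y))// ler_norm.
Qed.

Lemma integrable_normal_pdfR m s : mu.-integrable setT (EFin \o normal_pdf m s).
Proof. exact: integrable_normal_pdf. Qed.

Lemma integrable_mul_normal_pdf m s : s != 0 ->
  mu.-integrable setT (EFin \o (fun x => (x - m) * normal_pdf m s x)).
Proof.
move=> s0.
pose K := `|s| * (normal_peak s / normal_peak (Num.sqrt 2 * s)).
apply: (@integrable_le _ _ mu _ (fun x => K * normal_pdf m (Num.sqrt 2 * s) x)).
- apply: measurable_funM; last exact: measurable_normal_pdf.
  exact: measurable_funB.
- move=> x; rewrite normrM [X in _ * X]ger0_norm ?normal_pdf_ge0//.
  exact: normr_mul_normal_pdf.
- have := integrableZl measurableT K (integrable_normal_pdfR m (Num.sqrt 2 * s)).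
  by [].
Qed.

Lemma measurable_cos_affine (u m c : R) :
  measurable_fun setT (fun x : R => cos (u * (x - m) + c)).
Proof.
apply: continuous_measurable_fun => x.
apply: (@continuous_comp _ _ _ (fun x : R => u * (x - m) + c) cos); last exact: continuous_cos.
by apply: cvgD; [apply: cvgMl_tmp; apply: cvgB; [exact: cvg_id|exact: cvg_cst]|exact: cvg_cst].
Qed.

Lemma measurable_sin_affine (u m c : R) :
  measurable_fun setT (fun x : R => sin (u * (x - m) + c)).
Proof.
apply: continuous_measurable_fun => x.
apply: (@continuous_comp _ _ _ (fun x : R => u * (x - m) + c) sin); last exact: continuous_sin.
by apply: cvgD; [apply: cvgMl_tmp; apply: cvgB; [exact: cvg_id|exact: cvg_cst]|exact: cvg_cst].
Qed.

Lemma integrable_cos_normal m s u c :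
  mu.-integrable setT (EFin \o (fun x => cos (u * (x - m) + c) * normal_pdf m s x)).
Proof.
apply: (@integrable_bounded_mul _ _ mu _ 1) => //.
- exact: measurable_cos_affine.
- by move=> x; exact: normr_cos_le1.
- exact: integrable_normal_pdfR.
Qed.

Lemma integrable_sin_mul_normal m s u c : s != 0 ->
  mu.-integrable setT (EFin \o (fun x => sin (u * (x - m) + c) * ((x - m) * normal_pdf m s x))).
Proof.
move=> s0; apply: (@integrable_bounded_mul _ _ mu _ 1) => //.
- exact: measurable_sin_affine.
- by move=> x; exact: normr_sin_le1.
- exact: integrable_mul_normal_pdf.
Qed.

Lemma is_derive_sin_affine (u m c x : R) :
  is_derive x (1 : R) (fun x => sin (u * (x - m) + c)) (u * cos (u * (x - m) + c)).
Proof.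
have d1 : is_derive x (1 : R) (fun y : R => u * (y - m) + c) u.
  have -> : (fun y : R => u * (y - m) + c) = (u \*: (id - cst m : R -> R)) + cst c.
    by apply/funext => y /=; rewrite !fctE.
  by apply: is_derive_eq; rewrite subr0 addr0 /GRing.scale/= mulr1.
have := @is_derive1_comp _ sin _ x _ _ (is_derive_sin _) d1.
by move=> h; apply: (is_derive_eq h); rewrite mulrC.
Qed.

Lemma is_derive_cos_affine (u m c x : R) :
  is_derive u (1 : R) (fun u => cos (u * (x - m) + c)) (- (sin (u * (x - m) + c) * (x - m))).
Proof.
have d1 : is_derive u (1 : R) (fun y : R => y * (x - m) + c) (x - m).
  have -> : (fun y : R => y * (x - m) + c) = ((x - m) \*: (id : R -> R)) + cst c.
    by apply/funext => y /=; rewrite !fctE /GRing.scale /= mulrC.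
  by apply: is_derive_eq; rewrite addr0 /GRing.scale/= mulr1.
have := @is_derive1_comp _ cos _ u _ _ (is_derive_cos _) d1.
by move=> h; apply: (is_derive_eq h); rewrite mulNr.
Qed.

(** [normr_mul_normal_pdf] bounds [n.+1] times the density by a constant. *)
Lemma cvg_normal_pdf_far m s (z : nat -> R) : s != 0 ->
  (forall n, `|z n - m| = n.+1%:R) ->
  normal_pdf m s (z n) @[n --> \oo] --> 0.
Proof.
move=> s0 zE.
have s20 : Num.sqrt 2 * s != 0 by rewrite mulf_neq0// sqrtr_eq0 -ltNge ltr0n.
pose K := (`|s| * (normal_peak s / normal_peak (Num.sqrt 2 * s))) * normal_peak (Num.sqrt 2 * s).
apply: (@squeeze_cvgr _ _ _ _ (cst 0) (fun n => K * (n.+1%:R)^-1)).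
- apply: nearW => n; rewrite normal_pdf_ge0 /=.
  rewrite ler_pdivlMr// -zE mulrC.
  rewrite (le_trans (normr_mul_normal_pdf _ _ s0))// ler_wpM2l//.
    by rewrite mulr_ge0// divr_ge0// normal_peak_ge0.
  exact: normal_pdf_ub.
- exact: cvg_cst.
- rewrite -(mulr0 K); apply: cvgMl_tmp; exact: cvg_harmonic.
Qed.

(* Integrating the derivative of [sin (u (x - m) + c)] times the density gives
   the differential equation [Phi' = - s^2 u Phi]. *)
Lemma integral_sin_mul_normal m s u c : s != 0 ->
  \int[mu]_x (sin (u * (x - m) + c) * ((x - m) * normal_pdf m s x)) =
  s ^+ 2 * u * \int[mu]_x (cos (u * (x - m) + c) * normal_pdf m s x).
Proof.
move=> s0.
pose F (x : R) := sin (u * (x - m) + c) * normal_pdf m s x.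
pose f (x : R) := u * (cos (u * (x - m) + c) * normal_pdf m s x) -
  (s ^+ 2)^-1 * (sin (u * (x - m) + c) * ((x - m) * normal_pdf m s x)).
have i1 := integrableZl measurableT u (integrable_cos_normal m s u c).
have i2 := integrableZl measurableT (s ^+ 2)^-1 (integrable_sin_mul_normal m u c s0).
have : \int[mu]_x f x = 0.
  apply: (@integral_deriv_eq0 _ m F f).
  - move=> x.
    have := is_deriveM (is_derive_sin_affine u m c x) (is_derive_normal_pdf m x s0).
    move=> h; apply: (is_derive_eq h); rewrite /f /GRing.scale /=.
    by field.
  - move=> x.
    have cpdf := @continuous_normal_pdf R m s s0 x.
    have caff : {for x, continuous (fun x : R => u * (x - m) + c)}.
      by apply: cvgD; [apply: cvgMl_tmp; apply: cvgB; [exact: cvg_id|exact: cvg_cst]|exact: cvg_cst].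
    apply: cvgB; apply: cvgMl_tmp; apply: cvgM.
    + by apply: (continuous_comp caff); exact: continuous_cos.
    + exact: cpdf.
    + by apply: (continuous_comp caff); exact: continuous_sin.
    + apply: cvgM; last exact: cpdf.
      by apply: cvgB; [exact: cvg_id|exact: cvg_cst].
  - have := integrableB measurableT i1 i2.
    by [].
  - apply/cvgr0Pnorm_le => e e0.
    have /cvgr0Pnorm_le/(_ e e0) := @cvg_normal_pdf_far m s (fun n => m + n.+1%:R) s0
      (fun n => ltac:(by rewrite addrC addKr ger0_norm)).
    apply: filterS => n; apply: le_trans.
    by rewrite /F normrM ler_piMl// normr_sin_le1.
  - apply/cvgr0Pnorm_le => e e0.
    have /cvgr0Pnorm_le/(_ e e0) := @cvg_normal_pdf_far m s (fun n => m - n.+1%:R) s0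
      (fun n => ltac:(by rewrite addrC addKr normrN ger0_norm)).
    apply: filterS => n; apply: le_trans.
    by rewrite /F normrM ler_piMl// normr_sin_le1.
rewrite /f RintegralB// RintegralZl//; last exact: integrable_cos_normal.
rewrite RintegralZl//; last exact: integrable_sin_mul_normal.
set A := Rintegral _ _ _; set B := Rintegral _ _ _.
move=> /eqP; rewrite subr_eq0 => /eqP h.
have -> : s ^+ 2 * u * A = s ^+ 2 * (u * A) by rewrite mulrA.
by rewrite h mulVKf// expf_neq0.
Qed.

(** The integral [Phi] solves [Phi' = - s^2 u Phi], so its product [Psi] with the integrating factor
    [exp ((s u)^2 / 2)] is constant, equal to its value [cos c] at [u = 0]. *)
Lemma integral_cos_normal m s u c : s != 0 ->
  \int[mu]_x (cos (u * (x - m) + c) * normal_pdf m s x) =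
  cos c * expR (- (s * u) ^+ 2 / 2).
Proof.
move=> s0.
pose Phi (u : R) := \int[mu]_x (cos (u * (x - m) + c) * normal_pdf m s x).
pose f (u x : R) := cos (u * (x - m) + c) * normal_pdf m s x.
have df (v x : R) : is_derive v 1 (f ^~ x) (- (sin (v * (x - m) + c) * ((x - m) * normal_pdf m s x))).
  have := is_deriveM (is_derive_cos_affine v m c x) (is_derive_cst (normal_pdf m s x) v 1).
  move=> h; apply: (is_derive_eq h); rewrite /GRing.scale /=.
  by rewrite mulr0 add0r; ring.
have df1 (v x : R) : partial1of2 f v x = - (sin (v * (x - m) + c) * ((x - m) * normal_pdf m s x)).
  by rewrite partial1of2E; case: (df v x).
have Iu (v : R) : `]v - 1, v + 1[%classic v by rewrite /= in_itv/= gtrBl ltrDl ltr01.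
have dPhi (v : R) : is_derive v 1 Phi (- (s ^+ 2 * v * Phi v)).
  have H1 (x : R) : `]v - 1, v + 1[%classic x -> mu.-integrable setT (EFin \o f x).
    by move=> _; exact: integrable_cos_normal.
  have H2 (x y : R) : `]v - 1, v + 1[%classic x -> [set: R] y -> derivable (f^~ y) x 1.
    by move=> _ _; case: (df x y).
  have H3 : mu.-integrable setT (EFin \o (fun x => `|(x - m) * normal_pdf m s x|)).
    exact: (integrable_norm (integrable_mul_normal_pdf m s0)).
  have H4 (x y : R) : `]v - 1, v + 1[%classic x -> [set: R] y ->
      `|partial1of2 f x y| <= `|(y - m) * normal_pdf m s y|.
    by move=> _ _; rewrite df1 normrN normrM ler_piMl// normr_sin_le1.
  have dd := @derivable_under_integral _ _ _ mu f setT measurableT v _ _ (Iu v) H1 H2 _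
     (fun y => normr_ge0 _) H3 H4.
  have de := @differentiation_under_integral _ _ _ mu f setT measurableT v _ _ (Iu v) H1 H2 _
     (fun y => normr_ge0 _) H3 H4.
  apply: DeriveDef; first exact: dd.
  rewrite -derive1E de.
  under eq_Rintegral do rewrite df1 -mulN1r.
  rewrite RintegralZl//; last exact: integrable_sin_mul_normal.
  by rewrite integral_sin_mul_normal// mulN1r.
pose Psi (v : R) := Phi v * expR ((s * v) ^+ 2 / 2).
have dPsi (v : R) : is_derive v 1 Psi 0.
  have d1 : is_derive v (1 : R) (fun y : R => (s * y) ^+ 2 / 2) (s ^+ 2 * v).
    have -> : (fun y : R => (s * y) ^+ 2 / 2) = (s ^+ 2 / 2) \*: ((id : R -> R) ^+ 2).
      by apply/funext => y /=; rewrite !fctE /GRing.scale /=; field.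
    by apply: is_derive_eq; rewrite expr1 /GRing.scale/=; field.
  have d2 := @is_derive1_comp _ expR _ v _ _ (is_derive_expR _) d1.
  have := is_deriveM (dPhi v) d2.
  move=> h; apply: (is_derive_eq h); rewrite /GRing.scale /=.
  by ring.
have e := is_derive_0_is_cst u 0 dPsi.
move: e; rewrite /Psi mulr0 expr0n /= mul0r expR0 mulr1.
have -> : Phi 0 = cos c.
  rewrite /Phi; under eq_Rintegral do rewrite mul0r add0r.
  rewrite RintegralZl//; last exact: integrable_normal_pdfR.
  by rewrite /Rintegral integral_normal_pdf /= mulr1.
rewrite -/(Phi u) mulNr expRN => <-.
by rewrite mulfK// gt_eqF// expR_gt0.
Qed.

End gauss2.

(** * Gaussians on tuples *)

Section leb_fubini.
Context {R : realType}.
Local Notation mu := (@lebesgue_measure R).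

Lemma ge0_integral_leb_cons n (f : n.+1.-tuple R -> \bar R) :
  measurable_fun setT f -> (forall x, 0 <= f x)%E ->
  (\int[leb R n.+1]_z f z = \int[mu]_x \int[leb R n]_t f (cons_pair (x, t)))%E.
Proof.
move=> mf f0; rewrite [LHS](@ge0_integral_pushforward _ _ _ _ R _ (@measurable_cons_pair R n))//.
rewrite preimage_setT fubini_tonelli1//.
- exact: (measurableT_comp mf (@measurable_cons_pair R n)).
- by move=> x; exact: f0.
Qed.

Lemma integral_leb_cons n (f : n.+1.-tuple R -> \bar R) :
  (leb R n.+1).-integrable setT f ->
  (\int[leb R n.+1]_z f z = \int[mu]_x \int[leb R n]_t f (cons_pair (x, t)))%E.
Proof.
move=> fi; have mf := measurable_int _ fi.
have mfc : measurable_fun setT (f \o @cons_pair R n).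
  exact: (measurableT_comp mf (@measurable_cons_pair R n)).
have fi' : (mu \x leb R n)%E.-integrable setT (f \o @cons_pair R n).
  apply/integrableP; split=> //.
  move/integrableP : fi => [_].
  rewrite [X in (X < _)%E](@ge0_integral_pushforward _ _ _ _ R _ (@measurable_cons_pair R n))//.
  by apply: measurableT_comp.
rewrite [LHS](@integral_pushforward _ _ _ _ R _ (@measurable_cons_pair R n))//.
by rewrite preimage_setT -integral12_prod_meas1.
Qed.

Lemma integral_leb0 (f : 0.-tuple R -> \bar R) : measurable_fun setT f ->
  (\int[leb R 0]_z f z = f [tuple])%E.
Proof. by move=> mf; rewrite integral_dirac// diracT mul1e. Qed.

Lemma tnth_cons_pair0 n (p : R * n.-tuple R) : tnth (cons_pair p) ord0 = p.1.
Proof. by []. Qed.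

Lemma tnth_cons_pairS n (p : R * n.-tuple R) i :
  tnth (cons_pair p) (lift ord0 i) = tnth p.2 i.
Proof. exact: tnthS. Qed.

Lemma tnth_lift0 n (v : n.+1.-tuple R) i :
  tnth v (lift ord0 i) = tnth [tuple of behead v] i.
Proof. by rewrite {1}(tuple_eta v) tnthS; congr tnth; apply: val_inj. Qed.

Lemma measurable_tnthR n (i : 'I_n) :
  measurable_fun setT (fun x : n.-tuple R => tnth x i).
Proof. exact: (@measurable_tnth _ (measurableTypeR R)). Qed.

Lemma measurable_dot2 n : measurable_fun setT
  (fun z : n.-tuple R * n.-tuple R => dot z.1 z.2).
Proof.
apply: measurable_sum => i; apply: measurable_funM.
  exact: (measurableT_comp (@measurable_tnthR n i) measurable_fst).
exact: (measurableT_comp (@measurable_tnthR n i) measurable_snd).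
Qed.

Lemma measurable_dotl n (x : n.-tuple R) : measurable_fun setT (dot x).
Proof. by apply: measurable_sum => i; apply: measurable_funM => //; exact: measurable_tnthR. Qed.

Lemma dotC n (x y : n.-tuple R) : dot x y = dot y x.
Proof. by apply: eq_bigr => i _; rewrite mulrC. Qed.

Lemma measurable_dotr n (x : n.-tuple R) : measurable_fun setT (fun y => dot y x).
Proof. by under eq_fun do rewrite dotC; exact: measurable_dotl. Qed.

Lemma dot_ge0 n (x : n.-tuple R) : 0 <= dot x x.
Proof. by apply: sumr_ge0 => i _; rewrite -expr2 sqr_ge0. Qed.

Lemma measurable_dotxx n : measurable_fun setT (fun x : n.-tuple R => dot x x).
Proof. by apply: measurable_sum => i; apply: measurable_funM; exact: measurable_tnthR. Qed.

Lemma sqr_enorm n (x : n.-tuple R) : enorm x ^+ 2 = dot x x.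
Proof. by rewrite /enorm sqr_sqrtr// dot_ge0. Qed.

Lemma measurable_cos : measurable_fun setT (@cos R).
Proof. exact: continuous_measurable_fun (@continuous_cos R). Qed.

Lemma measurable_sin : measurable_fun setT (@sin R).
Proof. exact: continuous_measurable_fun (@continuous_sin R). Qed.

Definition gaussn n (m : n.-tuple R) (s : R) (x : n.-tuple R) : R :=
  \prod_(i < n) normal_pdf (tnth m i) s (tnth x i).

Lemma gaussn_ge0 n (m : n.-tuple R) s x : 0 <= gaussn m s x.
Proof. by apply: prodr_ge0 => i _; exact: normal_pdf_ge0. Qed.

Lemma measurable_gaussn n (m : n.-tuple R) s : measurable_fun setT (gaussn m s).
Proof.
apply: measurable_prod => i _.
exact: (measurableT_comp (measurable_normal_pdf _ _) (@measurable_tnthR n i)).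
Qed.

Lemma normal_pdfC (m s x : R) : s != 0 -> normal_pdf m s x = normal_pdf x s m.
Proof. by move=> s0; rewrite !normal_pdfE// /normal_fun -sqrrN opprB. Qed.

Lemma gaussnC n (m : n.-tuple R) s x : s != 0 -> gaussn m s x = gaussn x s m.
Proof. by move=> s0; apply: eq_bigr => i _; exact: normal_pdfC. Qed.

(** As a centred density of the differences of coordinates, the Gaussian is visibly measurable in
    centre and variable jointly. *)
Lemma measurable_gaussn2 n (s : R) : s != 0 -> measurable_fun setT
  (fun z : n.-tuple R * n.-tuple R => gaussn z.1 s z.2).
Proof.
move=> s0.
have -> : (fun z : n.-tuple R * n.-tuple R => gaussn z.1 s z.2) =
  (fun z => \prod_(i < n) normal_pdf 0 s (tnth z.2 i - tnth z.1 i)).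
  apply/funext => z; apply: eq_bigr => i _.
  by rewrite !normal_pdfE// [in LHS]normal_fun_center.
apply: measurable_prod => i _.
apply: (measurableT_comp (measurable_normal_pdf _ _)).
apply: measurable_funB.
  exact: (measurableT_comp (@measurable_tnthR n i) measurable_snd).
exact: (measurableT_comp (@measurable_tnthR n i) measurable_fst).
Qed.

Lemma gaussn_cons n (m : n.+1.-tuple R) s x t :
  gaussn m s (cons_pair (x, t)) =
  normal_pdf (tnth m ord0) s x * gaussn [tuple of behead m] s t.
Proof.
rewrite /gaussn big_ord_recl tnth_cons_pair0/=; congr (_ * _).
by apply: eq_bigr => i _; rewrite tnth_cons_pairS tnth_lift0.
Qed.

Lemma integral_gaussn n (m : n.-tuple R) s : (\int[leb R n]_x (gaussn m s x)%:E = 1)%E.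
Proof.
elim: n m => [|n IH] m.
  rewrite integral_leb0; first by rewrite /gaussn big_ord0.
  by apply/measurable_EFinP; exact: measurable_gaussn.
rewrite ge0_integral_leb_cons; last 2 first.
- by apply/measurable_EFinP; exact: measurable_gaussn.
- by move=> x; rewrite lee_fin gaussn_ge0.
under eq_integral => x _.
  under eq_integral do rewrite gaussn_cons EFinM.
  rewrite ge0_integralZl//; last 3 first.
  - by apply/measurable_EFinP; exact: measurable_gaussn.
  - by move=> t _; rewrite lee_fin gaussn_ge0.
  - by rewrite lee_fin normal_pdf_ge0.
  rewrite IH mule1.
  over.
exact: integral_normal_pdf.
Qed.

Lemma integrable_gaussn n (m : n.-tuple R) s :
  (leb R n).-integrable setT (EFin \o gaussn m s).
Proof.
apply/integrableP; split; first by apply/measurable_EFinP; exact: measurable_gaussn.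
under eq_integral do rewrite /= ger0_norm ?gaussn_ge0//.
by rewrite /= integral_gaussn ltry.
Qed.

Lemma measurable_wave n (u m : n.-tuple R) c : measurable_fun setT
  (fun x : n.-tuple R => cos (\sum_(i < n) tnth u i * (tnth x i - tnth m i) + c)).
Proof.
apply: (measurableT_comp measurable_cos); apply: measurable_funD => //.
apply: measurable_sum => i; apply: measurable_funM => //.
by apply: measurable_funB => //; exact: measurable_tnthR.
Qed.

Lemma integrable_wave_gaussn n (u m : n.-tuple R) s c : (leb R n).-integrable setT
  (EFin \o (fun x => cos (\sum_(i < n) tnth u i * (tnth x i - tnth m i) + c) * gaussn m s x)).
Proof.
apply: (@integrable_bounded_mul _ _ _ _ _ 1) => //.
- exact: measurable_wave.
- by move=> x; exact: normr_cos_le1.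
- exact: integrable_gaussn.
Qed.

(** Induction on the dimension. The phase [c] makes it work: for a fixed first coordinate, the
    contribution of that coordinate is absorbed into the phase of the remaining integral. *)
Lemma integral_wave_gaussn n (u m : n.-tuple R) s c : s != 0 ->
  \int[leb R n]_x (cos (\sum_(i < n) tnth u i * (tnth x i - tnth m i) + c) * gaussn m s x) =
  cos c * expR (- (s ^+ 2 * dot u u) / 2).
Proof.
move=> s0; elim: n u m c => [|n IH] u m c.
  rewrite /Rintegral integral_leb0/=; last first.
    by have /measurable_int := integrable_wave_gaussn u m s c.
  by rewrite big_ord0 add0r /gaussn /dot !big_ord0 !mulr0 oppr0 mul0r expR0 !mulr1.
pose u' : n.-tuple R := [tuple of behead u].
pose m' : n.-tuple R := [tuple of behead m].
rewrite /Rintegral integral_leb_cons; last exact: integrable_wave_gaussn.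
have E x : (\int[leb R n]_t (cos (\sum_(i < n.+1) tnth u i *
      (tnth (cons_pair (x, t)) i - tnth m i) + c) * gaussn m s (cons_pair (x, t)))%:E =
   ((cos (tnth u ord0 * (x - tnth m ord0) + c) * normal_pdf (tnth m ord0) s x) *
    expR (- (s ^+ 2 * dot u' u') / 2))%:E)%E.
  transitivity (\int[leb R n]_t ((normal_pdf (tnth m ord0) s x)%:E *
     (cos (\sum_(i < n) tnth u' i * (tnth t i - tnth m' i) +
     (tnth u ord0 * (x - tnth m ord0) + c)) * gaussn m' s t)%:E))%E.
    apply: eq_integral => t _; rewrite -EFinM gaussn_cons big_ord_recl tnth_cons_pair0/=.
    congr EFin; rewrite mulrCA; congr (_ * (cos _ * _)).
    rewrite [LHS]addrAC [RHS]addrC; congr (_ + _).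
    by apply: eq_bigr => i _; rewrite tnth_cons_pairS !tnth_lift0.
  rewrite integralZl//; last exact: integrable_wave_gaussn.
  rewrite -[X in (_ * X)%E]fineK; last first.
    by apply: integrable_fin_num => //; exact: integrable_wave_gaussn.
  rewrite -EFinM; have := IH u' m' (tnth u ord0 * (x - tnth m ord0) + c).
  rewrite /Rintegral => ->; congr EFin; ring.
under eq_integral do rewrite E EFinM.
rewrite -[LHS]/(Rintegral _ _ _).
have := @RintegralZr _ _ _ mu setT _ (expR (- (s ^+ 2 * dot u' u') / 2)) measurableT
   (integrable_cos_normal (tnth m ord0) s (tnth u ord0) c).
rewrite /Rintegral => ->.
have := integral_cos_normal (tnth m ord0) (tnth u ord0) c s0; rewrite /Rintegral => ->.
rewrite -mulrA -expRD; congr (_ * expR _).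
rewrite [in RHS]/dot big_ord_recl.
rewrite [X in _ = - (_ * (_ + X)) / _](_ : _ = dot u' u'); last first.
  by apply: eq_bigr => i _; rewrite tnth_lift0.
ring.
Qed.

End leb_fubini.

(** * Bessel inequality *)

Section product_integrals.
Context d1 d2 (T1 : measurableType d1) (T2 : measurableType d2) (R : realType)
  (m1 : {sigma_finite_measure set T1 -> \bar R})
  (m2 : {sigma_finite_measure set T2 -> \bar R}).

Lemma integrable_tensor (h : T1 -> R) (g : T2 -> R) :
  m1.-integrable setT (EFin \o h) -> m2.-integrable setT (EFin \o g) ->
  (m1 \x m2)%E.-integrable setT (EFin \o (fun z => h z.1 * g z.2)).
Proof.
move=> ih ig.
have mh : measurable_fun setT h by apply/measurable_EFinP; exact: measurable_int ih.
have mg : measurable_fun setT g by apply/measurable_EFinP; exact: measurable_int ig.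
apply/integrable12ltyP.
  apply/measurable_EFinP; apply: measurable_funM.
    exact: (measurableT_comp mh measurable_fst).
  exact: (measurableT_comp mg measurable_snd).
move/integrableP: ig => [_ ig]; move/integrableP: ih => [_ ih].
have gfin : (\int[m2]_y `|(g y)%:E|)%E \is a fin_num.
  by rewrite ge0_fin_numE// integral_ge0.
under eq_integral => x _.
  under eq_integral do rewrite /= normrM EFinM.
  rewrite ge0_integralZl//; last first.
    by apply/measurable_EFinP; exact: measurableT_comp.
  over.
rewrite -(fineK gfin) ge0_integralZr//.
- rewrite fineK//; apply: lte_mul_pinfty => //; first exact: integral_ge0.
  by rewrite ge0_fin_numE// integral_ge0.
- by apply/measurable_EFinP; exact: measurableT_comp.
- by rewrite lee_fin fine_ge0// integral_ge0.
Qed.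

(** [Rintegral] sends infinite values to [0] through [fine]; integrability of every slice makes the
    inner real integrals agree with the extended ones at every point. *)
Lemma Fubini_R (f : T1 * T2 -> R) :
  (m1 \x m2)%E.-integrable setT (EFin \o f) ->
  (forall x, m2.-integrable setT (EFin \o (fun y => f (x, y)))) ->
  (forall y, m1.-integrable setT (EFin \o (fun x => f (x, y)))) ->
  \int[m1]_x \int[m2]_y f (x, y) = \int[m2]_y \int[m1]_x f (x, y).
Proof.
move=> fi f2 f1.
have E := Fubini fi; rewrite /Rintegral; congr fine.
transitivity (\int[m1]_x \int[m2]_y (f (x, y))%:E)%E.
  apply: eq_integral => x _; rewrite fineK//.
  by apply: integrable_fin_num => //; exact: f2.
rewrite [LHS]E; apply: eq_integral => y _; rewrite fineK//.
by apply: integrable_fin_num => //; exact: f1.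
Qed.

End product_integrals.

(** * Schur's test for a symmetric kernel *)

Section schur.
Context d (T : measurableType d) (R : realType)
  (m : {sigma_finite_measure set T -> \bar R}).

(** The product [|p x| * |p y|] is at most half of [p x ^+ 2 + p y ^+ 2]. By the symmetry of [K]
    both halves have the same integral, and the inner one is the constant [A]. *)
Lemma schur_test (K : T * T -> R) (A : R) (p : T -> R) :
  measurable_fun setT K -> (forall z, 0 <= K z) -> (forall x y, K (x, y) = K (y, x)) ->
  0 <= A -> (forall x, (\int[m]_y (K (x, y))%:E = A%:E)%E) ->
  measurable_fun setT p ->
  (\int[m]_x \int[m]_y (`|p x| * `|p y| * K (x, y))%:E <= A%:E * \int[m]_x (p x ^+ 2)%:E)%E.
Proof.
move=> mK K0 KC A0 KA mp.
have mp1 : measurable_fun setT (fun z : T * T => p z.1) by exact: (measurableT_comp mp measurable_fst).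
have mp2 : measurable_fun setT (fun z : T * T => p z.2) by exact: (measurableT_comp mp measurable_snd).
pose F (z : T * T) : \bar R := (2^-1 * p z.1 ^+ 2 * K z)%:E.
pose G (z : T * T) : \bar R := (2^-1 * p z.2 ^+ 2 * K z)%:E.
have mF : measurable_fun setT F.
  apply/measurable_EFinP; apply: measurable_funM => //; apply: measurable_funM => //.
  exact: measurable_funX.
have mG : measurable_fun setT G.
  apply/measurable_EFinP; apply: measurable_funM => //; apply: measurable_funM => //.
  exact: measurable_funX.
have F0 z : (0 <= F z)%E by rewrite lee_fin mulr_ge0// mulr_ge0// ?invr_ge0// sqr_ge0.
have G0 z : (0 <= G z)%E by rewrite lee_fin mulr_ge0// mulr_ge0// ?invr_ge0// sqr_ge0.
have mH : measurable_fun setT (fun z : T * T => (`|p z.1| * `|p z.2| * K z)%:E).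
  apply/measurable_EFinP; apply: measurable_funM => //; apply: measurable_funM;
    exact: measurableT_comp.
have IF : (\int[m]_x \int[m]_y F (x, y) = (2^-1 * A)%:E * \int[m]_x (p x ^+ 2)%:E)%E.
  under eq_integral => x _.
    under eq_integral do rewrite /F /= EFinM.
    rewrite ge0_integralZl//; last 3 first.
    - by apply/measurable_EFinP; exact: (measurableT_comp mK (pair1_measurable x)).
    - by move=> y _; rewrite lee_fin.
    - by rewrite lee_fin mulr_ge0// ?invr_ge0// sqr_ge0.
    rewrite KA -EFinM mulrAC EFinM.
    over.
  rewrite ge0_integralZl//.
  - by apply/measurable_EFinP; exact: measurable_funX.
  - by move=> x _; rewrite lee_fin sqr_ge0.
  - by rewrite lee_fin mulr_ge0// invr_ge0.
have IG : (\int[m]_x \int[m]_y G (x, y) = (2^-1 * A)%:E * \int[m]_x (p x ^+ 2)%:E)%E.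
  rewrite fubini_tonelli// -IF; apply: eq_integral => y _; apply: eq_integral => x _.
  by rewrite /F /G /= KC.
rewrite [leLHS](_ : _ = \int[(m \x m)%E]_z (`|p z.1| * `|p z.2| * K z)%:E)%E; last first.
  by rewrite fubini_tonelli1// => z; rewrite lee_fin !mulr_ge0.
apply: (@le_trans _ _ (\int[(m \x m)%E]_z (F z + G z))%E).
  apply: ge0_le_integral => //.
  - by move=> z _; rewrite lee_fin !mulr_ge0.
  - exact: emeasurable_funD.
  - move=> z _; rewrite /F /G -EFinD lee_fin -mulrDl ler_wpM2r// -mulrDr.
    have := sqr_ge0 (`|p z.1| - `|p z.2|).
    rewrite -(real_normK (num_real (p z.1))) -(real_normK (num_real (p z.2))).
    nra.
rewrite ge0_integralD// fubini_tonelli1// fubini_tonelli1//.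
rewrite [X in (X + _)%E]IF [X in (_ + X)%E]IG -ge0_muleDl ?lee_fin ?mulr_ge0 ?invr_ge0//.
by rewrite -EFinD -mulrDl -[2^-1]mul1r -mulrDl divff// mul1r.
Qed.

End schur.

Section bessel.
Context {R : realType} {n : nat}.
Local Notation N := (leb R n).
Implicit Types (p : n.-tuple R -> R) (x y xi eta : n.-tuple R) (c s : R).

(** The cosine and sine transforms of a real function, merged into a single family by the phase. *)
Definition trig p c x : R := \int[N]_xi (cos (dot xi x + c) * p xi).

Lemma measurable_cos_dot2 c : measurable_fun setT
  (fun z : n.-tuple R * n.-tuple R => cos (dot z.1 z.2 + c)).
Proof.
apply: (measurableT_comp measurable_cos); apply: measurable_funD => //.
exact: measurable_dot2.
Qed.

Lemma measurable_cos_dotl x c : measurable_fun setT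
  (fun xi : n.-tuple R => cos (dot xi x + c)).
Proof.
apply: (measurableT_comp measurable_cos); apply: measurable_funD => //.
exact: measurable_dotr.
Qed.

Lemma measurable_cos_dotr x c : measurable_fun setT
  (fun xi : n.-tuple R => cos (dot x xi + c)).
Proof. by under eq_fun do rewrite dotC; exact: measurable_cos_dotl. Qed.

Lemma integrable_trig p c x : N.-integrable setT (EFin \o p) ->
  N.-integrable setT (EFin \o (fun xi => cos (dot xi x + c) * p xi)).
Proof.
move=> ip; apply: (@integrable_bounded_mul _ _ _ _ _ 1) => //.
- exact: measurable_cos_dotl.
- by move=> y; exact: normr_cos_le1.
Qed.

Lemma normr_trig_le p c x : N.-integrable setT (EFin \o p) ->
  `|trig p c x| <= \int[N]_xi `|p xi|.
Proof.
move=> ip; rewrite /trig (le_trans (le_normr_Rintegral _ (integrable_trig c x ip)))//.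
apply: le_Rintegral => //.
- exact: (integrable_norm (integrable_trig c x ip)).
- exact: (integrable_norm ip).
- by move=> xi _; rewrite normrM ler_piMl// normr_cos_le1.
Qed.

Definition zerot : n.-tuple R := [tuple 0 | i < n].

Lemma tnth_zerot i : tnth zerot i = 0. Proof. by rewrite tnth_mktuple. Qed.

Lemma gaussn_zerot_gt0 s x : s != 0 -> 0 < gaussn zerot s x.
Proof.
move=> s0; rewrite /gaussn prodr_gt0// => i _.
by rewrite normal_pdfE// mulr_gt0// ?normal_peak_gt0// expR_gt0.
Qed.

Lemma gaussnE (m : n.-tuple R) s x : s != 0 -> gaussn m s x =
  normal_peak s ^+ n * expR (- (\sum_(i < n) (tnth x i - tnth m i) ^+ 2) / (s ^+ 2 *+ 2)).
Proof.
move=> s0; rewrite /gaussn.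
under eq_bigr do rewrite normal_pdfE//.
rewrite big_split /= prodr_const card_ord; congr (_ * _).
rewrite /normal_fun -expR_sum; congr expR.
by rewrite -mulr_suml sumrN.
Qed.

Lemma gaussn_le (m : n.-tuple R) s x : s != 0 -> gaussn m s x <= normal_peak s ^+ n.
Proof.
move=> s0; rewrite gaussnE// ler_piMr ?exprn_ge0 ?normal_peak_ge0//.
rewrite -expR0 ler_expR mulNr oppr_le0 mulr_ge0 ?invr_ge0 ?mulrn_wge0 ?sqr_ge0//.
by apply: sumr_ge0 => i _; exact: sqr_ge0.
Qed.

(* The weight makes the integrals converge absolutely, so that Fubini applies. *)
Lemma integrable_gauss_trig p c s (h : n.-tuple R -> R) B : measurable_fun setT h ->
  (forall x, `|h x| <= B) -> N.-integrable setT (EFin \o p) ->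
  (N \x N)%E.-integrable setT
    (EFin \o (fun z => gaussn zerot s z.1 * h z.1 * cos (dot z.2 z.1 + c) * p z.2)).
Proof.
move=> mh hB ip.
have mp : measurable_fun setT p by apply/measurable_EFinP; exact: measurable_int ip.
have iB : N.-integrable setT (EFin \o (fun xi => B * `|p xi|)).
  by have := integrableZl measurableT B (integrable_norm ip).
have := integrable_tensor (integrable_gaussn zerot s) iB.
apply: integrable_le.
  apply: measurable_funM; last exact: (measurableT_comp mp measurable_snd).
  apply: measurable_funM; last first.
    under eq_fun do rewrite dotC; exact: measurable_cos_dot2.
  apply: measurable_funM; last exact: (measurableT_comp mh measurable_fst).
  exact: (measurableT_comp (measurable_gaussn _ _) measurable_fst).
move=> z /=; rewrite !normrM mulrA ler_wpM2r// [X in X * _ * _]ger0_norm ?gaussn_ge0//.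
rewrite -mulrA ler_wpM2l ?gaussn_ge0// (le_trans _ (hB z.1))//.
by rewrite ler_piMr// normr_cos_le1.
Qed.

(** Fubini gives the measurability of the Gaussian times [trig p c]; the Gaussian is positive and
    can be divided out. *)
Lemma measurable_trig p c : N.-integrable setT (EFin \o p) ->
  measurable_fun setT (trig p c).
Proof.
move=> ip.
have i := @integrable_gauss_trig p c 1 (cst 1) 1 (measurable_cst _)
  (fun x => ltac:(by rewrite /= normr1)) ip.
have := measurable_fubini_F i.
have s0 : (1 : R) != 0 by [].
have -> : fubini_F N (EFin \o (fun z => gaussn zerot 1 z.1 * (cst 1 z.1) * cos (dot z.2 z.1 + c) * p z.2))
   = EFin \o (fun x => gaussn zerot 1 x * trig p c x).
  apply/funext => x; rewrite /fubini_F /=.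
  transitivity (\int[N]_y ((gaussn zerot 1 x)%:E * (cos (dot y x + c) * p y)%:E))%E.
    by apply: eq_integral => y _; rewrite mulr1 -mulrA EFinM.
  rewrite integralZl//; last exact: integrable_trig.
  rewrite EFinM; congr (_ * _)%E; rewrite /trig /Rintegral fineK//.
  by apply: integrable_fin_num => //; exact: integrable_trig.
move=> /measurable_EFinP m.
have -> : trig p c = (fun x => (gaussn zerot 1 x)^-1 * (gaussn zerot 1 x * trig p c x)).
  by apply/funext => x; rewrite mulKf// gt_eqF// gaussn_zerot_gt0.
apply: measurable_funM => //.
have -> : (fun x => (gaussn zerot 1 x)^-1) =
   (fun x => normal_peak 1 ^- n * expR ((\sum_(i < n) (tnth x i - tnth zerot i) ^+ 2) / (1 ^+ 2 *+ 2))).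
  apply/funext => x; rewrite gaussnE// invfM -expRN; congr (_ * expR _).
  by rewrite mulNr opprK.
apply: measurable_funM => //; apply: measurableT_comp => //; apply: measurable_funM => //.
apply: measurable_sum => k; apply: measurable_funX; apply: measurable_funB => //.
exact: measurable_tnthR.
Qed.

(** A product of two cosines contains the frequencies [xi - eta] and [xi + eta]; they produce the
    Gaussians centred at [eta] and at [- eta]. *)
Definition gkernel s xi eta : R :=
  2^-1 * (gaussn eta s xi + gaussn [tuple - tnth eta i | i < n] s xi).

(** The product-to-sum formula leaves two integrals of [integral_wave_gaussn], at [xi - eta] and at
    [xi + eta]. Each is a Gaussian of the inverse width [s^-1], up to its normalization. *)
Lemma gauss_cos_cosE s d c xi eta : s != 0 ->
  \int[N]_x (gaussn zerot s x * cos (dot xi x + d) * cos (dot eta x + c)) =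
  normal_peak s^-1 ^- n * (2^-1 * (cos (d - c) * gaussn eta s^-1 xi +
    cos (d + c) * gaussn [tuple - tnth eta i | i < n] s^-1 xi)).
Proof.
move=> s0.
pose u1 : n.-tuple R := [tuple tnth xi i - tnth eta i | i < n].
pose u2 : n.-tuple R := [tuple tnth xi i + tnth eta i | i < n].
have si0 : s^-1 != 0 by rewrite invr_eq0.
have -> : \int[N]_x (gaussn zerot s x * cos (dot xi x + d) * cos (dot eta x + c)) =
   2^-1 * (cos (d - c) * expR (- (s ^+ 2 * dot u1 u1) / 2) + cos (d + c) * expR (- (s ^+ 2 * dot u2 u2) / 2)).
  have <- := integral_wave_gaussn u1 zerot (d - c) s0.
  have <- := integral_wave_gaussn u2 zerot (d + c) s0.
  rewrite -RintegralD//; [|exact: integrable_wave_gaussn..].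
  rewrite -RintegralZl//; last first.
    have := integrableD measurableT (integrable_wave_gaussn u1 zerot s (d - c))
       (integrable_wave_gaussn u2 zerot s (d + c)).
    by [].
  apply: eq_Rintegral => x _.
  have -> : \sum_(i < n) tnth u1 i * (tnth x i - tnth zerot i) + (d - c) = (dot xi x + d) - (dot eta x + c).
    rewrite opprD addrACA; congr (_ + _); rewrite /dot -sumrB; apply: eq_bigr => i _.
    by rewrite tnth_zerot subr0 tnth_mktuple mulrBl.
  have -> : \sum_(i < n) tnth u2 i * (tnth x i - tnth zerot i) + (d + c) = (dot xi x + d) + (dot eta x + c).
    rewrite addrACA; congr (_ + _).
    rewrite /dot -big_split; apply: eq_bigr => i _.
    by rewrite tnth_zerot subr0 tnth_mktuple mulrDl.
  set b := dot eta x + c; set e := dot xi x + d.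
  by rewrite cosB cosD; field.
have pk : normal_peak s^-1 ^+ n != 0 by rewrite expf_neq0// gt_eqF// normal_peak_gt0.
have e1 : expR (- (s ^+ 2 * dot u1 u1) / 2) = normal_peak s^-1 ^- n * gaussn eta s^-1 xi.
  rewrite gaussnE// mulKf//; congr expR.
  rewrite (_ : \sum_(i < n) _ = dot u1 u1); first by field.
  by apply: eq_bigr => i _; rewrite tnth_mktuple expr2.
have e2 : expR (- (s ^+ 2 * dot u2 u2) / 2) =
    normal_peak s^-1 ^- n * gaussn [tuple - tnth eta i | i < n] s^-1 xi.
  rewrite gaussnE// mulKf//; congr expR.
  rewrite (_ : \sum_(i < n) _ = dot u2 u2); first by field.
  by apply: eq_bigr => i _; rewrite !tnth_mktuple opprK expr2.
by rewrite e1 e2; ring.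
Qed.

Lemma gauss_cos_cos s c xi eta : s != 0 ->
  `|\int[N]_x (gaussn zerot s x * cos (dot xi x + c) * cos (dot eta x + c))|
  <= normal_peak s^-1 ^- n * gkernel s^-1 xi eta.
Proof.
move=> s0; rewrite gauss_cos_cosE// subrr cos0 mul1r /gkernel.
have g0 (m : n.-tuple R) y : 0 <= gaussn m s^-1 y by exact: gaussn_ge0.
have pk : 0 <= normal_peak s^-1 ^- n by rewrite invr_ge0 exprn_ge0// normal_peak_ge0.
rewrite normrM [X in X * _]ger0_norm// ler_wpM2l// normrM ger0_norm ?invr_ge0//.
rewrite ler_wpM2l ?invr_ge0// (le_trans (ler_normD _ _))// ger0_norm// lerD2l.
by rewrite normrM [X in _ * X]ger0_norm// ler_piMl// normr_cos_le1.
Qed.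

Lemma gkernel_ge0 s xi eta : 0 <= gkernel s xi eta.
Proof. by rewrite /gkernel mulr_ge0// ?invr_ge0// addr_ge0// gaussn_ge0. Qed.

Lemma gkernelC s xi eta : s != 0 -> gkernel s xi eta = gkernel s eta xi.
Proof.
move=> s0; rewrite /gkernel gaussnC//; congr (_ * (_ + _)).
rewrite !gaussnE//.
rewrite (eq_bigr (fun i => (tnth eta i - tnth [tuple - tnth xi i | i < n] i) ^+ 2))//.
by move=> i _; rewrite !tnth_mktuple !opprK addrC.
Qed.

Lemma integral_gkernel s xi : s != 0 -> (\int[N]_eta (gkernel s xi eta)%:E = 1)%E.
Proof.
move=> s0; under eq_integral do rewrite gkernelC// /gkernel EFinM.
rewrite ge0_integralZl//; last 2 first.
- apply/measurable_EFinP; apply: measurable_funD; exact: measurable_gaussn.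
- by move=> x _; rewrite lee_fin addr_ge0// gaussn_ge0.
under eq_integral do rewrite EFinD.
rewrite ge0_integralD//.
- by rewrite !integral_gaussn -EFinD -EFinM -[1 in RHS](@divff _ 2)// mulrC.
- by move=> x _; rewrite lee_fin gaussn_ge0.
- by apply/measurable_EFinP; exact: measurable_gaussn.
- by move=> x _; rewrite lee_fin gaussn_ge0.
- by apply/measurable_EFinP; exact: measurable_gaussn.
Qed.

Lemma measurable_gkernel s : s != 0 ->
  measurable_fun setT (fun z : n.-tuple R * n.-tuple R => gkernel s z.1 z.2).
Proof.
move=> s0; apply: measurable_funM => //; apply: measurable_funD.
  under eq_fun do rewrite gaussnC//.
  exact: measurable_gaussn2.
have -> : (fun z : n.-tuple R * n.-tuple R => gaussn [tuple - tnth z.2 i | i < n] s z.1) =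
  (fun z => \prod_(i < n) normal_pdf 0 s (tnth z.1 i + tnth z.2 i)).
  apply/funext => z; apply: eq_bigr => i _.
  by rewrite !normal_pdfE// [in LHS]normal_fun_center tnth_mktuple /= opprK.
apply: measurable_prod => i _.
apply: (measurableT_comp (measurable_normal_pdf _ _)).
apply: measurable_funD.
  exact: (measurableT_comp (@measurable_tnthR _ n i) measurable_fst).
exact: (measurableT_comp (@measurable_tnthR _ n i) measurable_snd).
Qed.

Lemma integrable_gauss_weight s (h : n.-tuple R -> R) B : measurable_fun setT h ->
  (forall x, `|h x| <= B * gaussn zerot s x) -> N.-integrable setT (EFin \o h).
Proof.
move=> mh hB; apply: (integrable_le mh hB).
by have := integrableZl measurableT B (integrable_gaussn zerot s).
Qed.

Lemma measurable_weight s (h : n.-tuple R -> R) xi c : measurable_fun setT h ->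
  measurable_fun setT (fun x => gaussn zerot s x * h x * cos (dot xi x + c)).
Proof.
move=> mh; apply: measurable_funM; last exact: measurable_cos_dotr.
by apply: measurable_funM => //; exact: measurable_gaussn.
Qed.

Lemma normr_weight s (h : n.-tuple R -> R) B xi c x : (forall x, `|h x| <= B) ->
  `|gaussn zerot s x * h x * cos (dot xi x + c)| <= B * gaussn zerot s x.
Proof.
move=> hB; rewrite !normrM [X in X * _ * _]ger0_norm ?gaussn_ge0//.
rewrite -mulrA mulrC ler_wpM2r ?gaussn_ge0// (le_trans _ (hB x))//.
by rewrite ler_piMr// normr_cos_le1.
Qed.

Section swap.
Variables (p : n.-tuple R -> R) (c s : R) (h : n.-tuple R -> R) (B : R).
Hypotheses (mh : measurable_fun setT h) (hB : forall x, `|h x| <= B)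
  (ip : N.-integrable setT (EFin \o p)).

Let f (z : n.-tuple R * n.-tuple R) : R :=
  gaussn zerot s z.1 * h z.1 * cos (dot z.2 z.1 + c) * p z.2.

Let f2 eta : \int[N]_x f (x, eta) =
  p eta * \int[N]_x (gaussn zerot s x * h x * cos (dot eta x + c)).
Proof.
rewrite /f mulrC -RintegralZr//.
apply: (@integrable_gauss_weight s _ B); first exact: measurable_weight.
by move=> x; exact: normr_weight.
Qed.

Let if2 eta : N.-integrable setT (EFin \o (fun x => f (x, eta))).
Proof.
apply: (@integrable_gauss_weight s _ (B * `|p eta|)).
  have -> : (fun x => f (x, eta)) = (fun x =>
      gaussn zerot s x * h x * cos (dot eta x + c) * p eta) by [].
  apply: measurable_funM; last exact: measurable_cst.
  exact: measurable_weight.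
by move=> x; rewrite /f normrM [leRHS]mulrAC ler_wpM2r//; exact: normr_weight.
Qed.

(** Applied with [h = trig p c] it expands the weighted square, with [h] a cosine it produces the
    kernel of [gauss_cos_cosE]. *)
Lemma trig_swap : \int[N]_x (gaussn zerot s x * h x * trig p c x) =
  \int[N]_eta (p eta * \int[N]_x (gaussn zerot s x * h x * cos (dot eta x + c))).
Proof.
under [RHS]eq_Rintegral do rewrite -f2.
rewrite -(@Fubini_R _ _ _ _ _ N N f)//.
- apply: eq_Rintegral => x _; rewrite -RintegralZl//; last exact: integrable_trig.
  by apply: eq_Rintegral => eta _; rewrite /f !mulrA.
- exact: (integrable_gauss_trig c s mh hB ip).
- move=> x.
  have := integrableZl measurableT (gaussn zerot s x * h x) (integrable_trig c x ip).
  by congr (_.-integrable _ _); apply/funext => eta /=; rewrite -EFinM /f !mulrA.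
Qed.

Lemma measurable_trig_swap : measurable_fun setT (fun eta =>
  p eta * \int[N]_x (gaussn zerot s x * h x * cos (dot eta x + c))).
Proof.
have := measurable_fubini_G (integrable_gauss_trig c s mh hB ip).
rewrite (_ : fubini_G _ _ = EFin \o (fun eta =>
  p eta * \int[N]_x (gaussn zerot s x * h x * cos (dot eta x + c)))).
  by move/measurable_EFinP.
apply/funext => eta; rewrite /= -f2 /Rintegral fineK//.
by apply: integrable_fin_num => //; exact: if2.
Qed.

End swap.

(* With a Gaussian weight, the square expands by Fubini into a quadratic form in [p]
   whose kernel is again Gaussian, and Schur's test applies. *)
Lemma bessel_weighted p c s : s != 0 ->
  N.-integrable setT (EFin \o p) ->
  (\int[N]_x (gaussn zerot s x * trig p c x ^+ 2)%:E <=
   (normal_peak s^-1 ^- n)%:E * \int[N]_xi (p xi ^+ 2)%:E)%E.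
Proof.
move=> s0 ip.
have si0 : s^-1 != 0 by rewrite invr_eq0.
have mp : measurable_fun setT p by apply/measurable_EFinP; exact: measurable_int ip.
have mT := measurable_trig c ip.
set P1 := \int[N]_xi `|p xi|.
have TB x : `|trig p c x| <= P1 by exact: normr_trig_le.
pose S xi : R := \int[N]_x (gaussn zerot s x * trig p c x * cos (dot xi x + c)).
pose k xi eta : R := \int[N]_x (gaussn zerot s x * cos (dot xi x + c) * cos (dot eta x + c)).
have mc xi : measurable_fun setT (fun x => cos (dot xi x + c)) by exact: measurable_cos_dotr.
have c1 xi x : `|cos (dot xi x + c)| <= 1 by exact: normr_cos_le1.
have SE xi : S xi = \int[N]_eta (p eta * k xi eta).
  rewrite -(trig_swap c s (mc xi) (c1 xi) ip).
  by apply: eq_Rintegral => x _; rewrite mulrAC.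
have mSp : measurable_fun setT (fun xi => p xi * S xi) by exact: (measurable_trig_swap c s mT TB ip).
have mkp xi : measurable_fun setT (fun eta => p eta * k xi eta).
  exact: (measurable_trig_swap c s (mc xi) (c1 xi) ip).
have kB xi eta : `|k xi eta| <= normal_peak s^-1 ^- n * gkernel s^-1 xi eta.
  exact: gauss_cos_cos.
have E2 : \int[N]_x (gaussn zerot s x * trig p c x ^+ 2) = \int[N]_xi (p xi * S xi).
  rewrite -(trig_swap c s mT TB ip).
  by apply: eq_Rintegral => x _; rewrite expr2 mulrA.
have i2 : N.-integrable setT (EFin \o (fun x => gaussn zerot s x * trig p c x ^+ 2)).
  apply: (@integrable_gauss_weight s _ (P1 ^+ 2)).
    by apply: measurable_funM; [exact: measurable_gaussn|exact: measurable_funX].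
  move=> x; rewrite normrM normrX [X in X * _]ger0_norm ?gaussn_ge0//.
  by rewrite mulrC ler_wpM2r ?gaussn_ge0// lerXn2r ?nnegrE// (le_trans _ (TB x)).
have -> : (\int[N]_x (gaussn zerot s x * trig p c x ^+ 2)%:E =
    (\int[N]_xi (p xi * S xi))%:E)%E.
  by rewrite -E2 /Rintegral fineK//; exact: integrable_fin_num.
set A := normal_peak s^-1 ^- n.
have A0 : 0 <= A by rewrite /A invr_ge0 exprn_ge0// normal_peak_ge0.
(* An infinite integral is turned into [0] by [fine], so the inequality persists in that case. *)
have absint (q : n.-tuple R -> R) : measurable_fun setT q ->
    (`|\int[N]_x q x|%:E <= \int[N]_x `|q x|%:E)%E.
  move=> mq; apply: (@le_trans _ _ `|\int[N]_xi (q xi)%:E|%E).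
    rewrite /Rintegral.
    by set I := integral _ _ _; case: I => [r| |]/=; rewrite ?normr0 ?lee_fin ?leey//.
  by apply: (le_abse_integral _ _ _) => //; exact/measurable_EFinP.
have mK := @measurable_gkernel s^-1 si0.
apply: (@le_trans _ _ (\int[N]_xi (`|p xi * S xi|)%:E)%E).
  apply: le_trans (absint _ mSp).
  by rewrite lee_fin ler_norm.
have mH : measurable_fun setT (fun z : n.-tuple R * n.-tuple R =>
    (`|p z.1| * `|p z.2| * gkernel s^-1 z.1 z.2)%:E).
  apply/measurable_EFinP; apply: measurable_funM => //; apply: measurable_funM.
    by apply: measurableT_comp => //; exact: (measurableT_comp mp measurable_fst).
  by apply: measurableT_comp => //; exact: (measurableT_comp mp measurable_snd).
have H0 z : (0 <= (`|p z.1| * `|p z.2| * gkernel s^-1 z.1 z.2)%:E)%E.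
  by rewrite lee_fin; apply: mulr_ge0; [exact: mulr_ge0|exact: gkernel_ge0].
apply: (@le_trans _ _ (A%:E * \int[N]_xi \int[N]_eta
    (`|p xi| * `|p eta| * gkernel s^-1 xi eta)%:E)%E).
  rewrite -ge0_integralZl//; last 2 first.
  - exact: (@measurable_fun_fubini_tonelli_F _ _ _ _ R N _ mH H0).
  - by move=> xi _; apply: integral_ge0 => eta _; exact: (H0 (xi, eta)).
  apply: ge0_le_integral => //.
  - by apply/measurable_EFinP; exact: measurableT_comp.
  - apply: emeasurable_funM => //.
    exact: (@measurable_fun_fubini_tonelli_F _ _ _ _ R N _ mH H0).
  move=> xi _; rewrite normrM EFinM.
  apply: (@le_trans _ _ (`|p xi|%:E * \int[N]_eta `|p eta * k xi eta|%:E)%E).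
    by rewrite lee_wpmul2l// ?lee_fin// SE; exact: absint.
  rewrite -!ge0_integralZl//.
  - apply: ge0_le_integral => //.
    + by apply/measurable_EFinP; apply: measurable_funM => //; exact: measurableT_comp.
    + apply: emeasurable_funM => //.
      exact: (measurableT_comp mH (pair1_measurable xi)).
    + move=> eta _; rewrite -!EFinM lee_fin normrM mulrCA mulrA.
      rewrite [leRHS](_ : _ = `|p eta| * `|p xi| * (A * gkernel s^-1 xi eta)); last by ring.
      by rewrite ler_wpM2l ?mulr_ge0.
  - exact: (measurableT_comp mH (pair1_measurable xi)).
  - by move=> eta _; exact: (H0 (xi, eta)).
  - by apply/measurable_EFinP; exact: measurableT_comp.
rewrite lee_wpmul2l ?lee_fin// -[leRHS]mul1e.
apply: (@schur_test _ _ _ N (fun z => gkernel s^-1 z.1 z.2)) => //.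
- by move=> z; exact: gkernel_ge0.
- by move=> x y /=; rewrite gkernelC.
- by move=> x; exact: integral_gkernel.
Qed.

(** Origin of the constant [(2 * pi) ^+ n] in [bessel]: the width [s] of the weight and the width
    [s^-1] of its transform cancel. *)
Lemma normal_peakM s : 0 < s -> normal_peak s * normal_peak s^-1 = (2 * pi)^-1 :> R.
Proof.
move=> s0; rewrite /normal_peak -invfM -sqrtrM; last first.
  by rewrite mulrn_wge0// mulr_ge0 ?pi_ge0// sqr_ge0.
congr (_^-1).
have -> : s ^+ 2 * pi *+ 2 * (s^-1 ^+ 2 * pi *+ 2) = (2 * pi) ^+ 2.
  by field; rewrite gt_eqF.
by rewrite sqrtr_sqr ger0_norm// mulr_ge0// pi_ge0.
Qed.

(** The weights [w k] are Gaussians of width [k.+1] normalized to the value [1] at the origin. They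
    tend to [1] pointwise while the bound of [bessel_weighted] stays the same for all [k], so
    Fatou's lemma removes the weight. *)
Lemma bessel p c : N.-integrable setT (EFin \o p) ->
  (\int[N]_x (trig p c x ^+ 2)%:E <=
   ((2 * pi) ^+ n)%:E * \int[N]_xi (p xi ^+ 2)%:E)%E.
Proof.
move=> ip; have mT := measurable_trig c ip.
pose w (k : nat) x : R := normal_peak k.+1%:R ^- n * gaussn zerot k.+1%:R x.
have w0 k x : 0 <= w k x.
  by rewrite mulr_ge0 ?gaussn_ge0// invr_ge0 exprn_ge0// normal_peak_ge0.
have wE x : w ^~ x @ \oo --> (1 : R).
  have wk k : w k x = expR (- (dot x x / 2 * (k.+1%:R^-1 * k.+1%:R^-1))).
    rewrite /w gaussnE ?pnatr_eq0// mulKf ?expf_neq0 ?gt_eqF ?normal_peak_gt0 ?pnatr_eq0//.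
    congr expR; rewrite (_ : \sum_(i < n) _ = dot x x); last first.
      by apply: eq_bigr => i _; rewrite tnth_zerot subr0 expr2.
    set a : R := k.+1%:R; have a0 : a != 0 by rewrite pnatr_eq0.
    by field.
  rewrite (_ : w ^~ x = expR \o (fun k => - (dot x x / 2 * (k.+1%:R^-1 * k.+1%:R^-1)))); last exact/funext.
  rewrite -[X in _ --> X]expR0; apply: cvg_comp; last exact: continuous_expR.
  suff : - (dot x x / 2 * (k.+1%:R^-1 / k.+1%:R)) @[k --> \oo] --> (0 : R) by [].
  rewrite (_ : 0 = - (dot x x / 2 * (0 * 0))); last by rewrite !mulr0 oppr0.
  by apply: cvgN; apply: cvgMl_tmp; apply: cvgM; exact: cvg_harmonic.
have wT x : ((w k x * trig p c x ^+ 2)%:E @[k --> \oo] --> (trig p c x ^+ 2)%:E)%E.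
  apply: cvg_EFin; first exact: nearW.
  rewrite /comp /= -[X in _ --> X]mul1r; exact: cvgMr_tmp.
have mw k : measurable_fun setT (fun x => (w k x * trig p c x ^+ 2)%:E).
  apply/measurable_EFinP; apply: measurable_funM; last exact: measurable_funX.
  by apply: measurable_funM => //; exact: measurable_gaussn.
have := @fatou _ _ _ N setT measurableT (fun k x => (w k x * trig p c x ^+ 2)%:E) mw
  (fun k x _ => ltac:(by rewrite lee_fin mulr_ge0// sqr_ge0)).
rewrite [X in (X <= _)%E -> _](_ : _ = (\int[N]_x (trig p c x ^+ 2)%:E)%E); last first.
  apply: eq_integral => x _.
  rewrite is_cvg_limn_einfE; last by apply: cvgP; exact: wT.
  exact/cvg_lim/wT.
move/le_trans; apply.
rewrite limn_einf_lim; apply: lime_le; first exact: is_cvg_einfs.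
apply: nearW => k; apply: (@le_trans _ _ (\int[N]_x (w k x * trig p c x ^+ 2)%:E)%E).
  by apply: ereal_inf_lbound; exists k => //=.
under eq_integral do rewrite /w -mulrA EFinM.
have k0 : 0 < k.+1%:R :> R by rewrite ltr0n.
have pk0 := normal_peak_gt0 (lt0r_neq0 k0).
have pk0' : 0 < normal_peak (k.+1%:R : R)^-1 by rewrite normal_peak_gt0// invr_eq0 gt_eqF.
rewrite ge0_integralZl//; last 3 first.
- apply/measurable_EFinP; apply: measurable_funM; first exact: measurable_gaussn.
  exact: measurable_funX.
- by move=> x _; rewrite lee_fin mulr_ge0 ?gaussn_ge0// sqr_ge0.
- by rewrite lee_fin invr_ge0 exprn_ge0// ltW.
have -> : (2 * pi) ^+ n = normal_peak k.+1%:R ^- n * normal_peak (k.+1%:R : R)^-1 ^- n :> R.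
  by rewrite -invfM -exprMn normal_peakM// exprVn invrK.
rewrite EFinM -muleA lee_wpmul2l ?lee_fin//; first by rewrite invr_ge0 exprn_ge0// ltW.
by apply: bessel_weighted => //; rewrite gt_eqF.
Qed.

End bessel.

(** * Rademacher-Menshov maximal function *)

Section dyadic.
Context {R : realType}.

(* [N - 2 ^ m] is written in base two, one block per digit. *)
Lemma dyadic_increment (u : nat -> R) (m : nat) (e : R) : 0 <= e ->
  (forall k b, (k <= m)%N -> (b.+1 * 2 ^ k <= 2 ^ m)%N ->
    `|u (2 ^ m + b.+1 * 2 ^ k)%N - u (2 ^ m + b * 2 ^ k)%N| <= e) ->
  forall N, (2 ^ m <= N <= 2 ^ m.+1)%N -> `|u N - u (2 ^ m)%N| <= m.+1%:R * e.
Proof.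
move=> e0 H.
(* Induction on the number [j] of binary digits of the remainder [r]: its leading digit either
   vanishes or costs one block. *)
have P j : (j <= m)%N -> forall b r, (r < 2 ^ j)%N -> (b * 2 ^ j + r < 2 ^ m)%N ->
    `|u (2 ^ m + (b * 2 ^ j + r))%N - u (2 ^ m + b * 2 ^ j)%N| <= j%:R * e.
  elim: j => [_ b r|j IH jm b r rj brm].
    by rewrite expn0 ltnS leqn0 => /eqP -> _; rewrite addn0 subrr normr0 mul0r.
  have E : (b * 2 ^ j.+1 = b.*2 * 2 ^ j)%N by rewrite expnS mulnA muln2.
  rewrite E in brm *.
  have [rlt|rge] := ltnP r (2 ^ j).
    rewrite (le_trans (IH (ltnW jm) _ _ rlt brm))// ler_wpM2r// ler_nat//.
  have -> : (b.*2 * 2 ^ j + r = b.*2.+1 * 2 ^ j + (r - 2 ^ j))%N.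
    by rewrite mulSn -addnA [RHS]addnCA subnKC.
  have r2 : (r - 2 ^ j < 2 ^ j)%N by rewrite ltn_subLR// addnn -mul2n -expnS.
  have brm2 : (b.*2.+1 * 2 ^ j + (r - 2 ^ j) < 2 ^ m)%N.
    by rewrite mulSn -addnA addnCA subnKC.
  have h1 := IH (ltnW jm) _ _ r2 brm2.
  have h2 : `|u (2 ^ m + b.*2.+1 * 2 ^ j)%N - u (2 ^ m + b.*2 * 2 ^ j)%N| <= e.
    by apply: H; [exact: ltnW|rewrite (leq_trans _ (ltnW brm2))// leq_addr].
  rewrite -natr1 mulrDl mul1r; apply: le_trans (lerD h1 h2).
  apply: le_trans (ler_normD _ _).
  by rewrite addrA subrK.
(* The endpoint [2 ^ m.+1], excluded from [P] by the strict inequalities, is reached by the single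
   block of length [2 ^ m]. *)
move=> N /andP[N1 N2]; move: N2; rewrite leq_eqVlt => /predU1P[->|N2].
  have := H m 0%N (leqnn m); rewrite mul1n mul0n addn0 addnn -mul2n -expnS leqnn.
  move=> /(_ isT) h; apply: (le_trans h).
  by rewrite ler_peMl// ler1n.
have lt : (N - 2 ^ m < 2 ^ m)%N by rewrite ltn_subLR// addnn -mul2n -expnS.
have := P m (leqnn m) 0%N _ lt; rewrite mul0n addn0 add0n subnKC// => /(_ lt) h.
by apply: (le_trans h); rewrite ler_wpM2r// ler_nat.
Qed.

(** Bernoulli's inequality for [t^-1 = 1 + d]: the power [(1 + d) ^+ m] is at least [1 + d *+ m],
    hence at least [m.+1] times the minimum of [1] and [d]. *)
Lemma natr_mul_geometric (t : R) : 0 < t < 1 ->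
  exists2 D : R, 0 < D & forall m, m.+1%:R * t ^+ m <= D.
Proof.
move=> /andP[t0 t1]; pose d := t^-1 - 1.
have d0 : 0 < d by rewrite subr_gt0 invf_gt1.
exists (Num.min 1 d)^-1; first by rewrite invr_gt0 lt_min ltr01.
move=> m; rewrite -ler_pdivlMr ?exprn_gt0//.
have mn0 : 0 < Num.min 1 d by rewrite lt_min ltr01.
rewrite -exprVn mulrC -ler_pdivrMr ?invr_gt0// invrK.
have -> : t^-1 = 1 + d by rewrite /d addrC subrK.
have B : 1 + d *+ m <= (1 + d) ^+ m.
  elim: m => [|m IH]; first by rewrite mulr0n addr0 expr0.
  rewrite exprS (le_trans _ (ler_wpM2l _ IH))//; last by rewrite addr_ge0// ltW.
  rewrite mulrSr mulrDr mulr1 mulrDl mul1r.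
  have : 0 <= d * (d *+ m) by rewrite mulr_ge0// ?mulrn_wge0// ltW.
  lra.
apply: le_trans B; rewrite mulrC -natr1 mulrDr mulr1 addrC lerD// ?ge_min ?lexx//.
by rewrite mulr_natr lerMn2r ge_min lexx orbT orbT.
Qed.

Lemma geometric_sum_le (t : R) N : 0 < t < 1 -> \sum_(i < N) t ^+ i <= (1 - t)^-1.
Proof.
move=> /andP[t0 t1]; have h : 0 < 1 - t by rewrite subr_gt0.
rewrite -[leRHS]mul1r ler_pdivlMr//.
by rewrite mulrC -opprB mulNr -subrX1 opprB lerBlDr lerDl exprn_ge0// ltW.
Qed.

Lemma nneseries_geometric_le (t B : R) (a : nat -> \bar R) : 0 < t < 1 -> 0 <= B ->
  (forall i, 0 <= a i)%E -> (forall i, (a i <= (B * t ^+ i)%:E)%E) ->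
  (\sum_(0 <= i <oo) a i <= (B * (1 - t)^-1)%:E)%E.
Proof.
move=> t01 B0 a0 aB; apply: lime_le; first exact: is_cvg_nneseries.
apply: nearW => N.
rewrite big_mkord; apply: (@le_trans _ _ (\sum_(i < N) (B * t ^+ i)%:E)%E).
  by apply: lee_sum => i _; exact: aB.
by rewrite sumEFin lee_fin -mulr_sumr ler_wpM2l// geometric_sum_le.
Qed.

End dyadic.

Section rademacher_menshov.
Context {R : realType} {n : nat}.
Local Notation N := (leb R n).
Implicit Types (p : n.-tuple R -> R) (c eps : R) (x xi : n.-tuple R).

(* The phases [c = 0] and [c = pi / 2] give the cosine and (up to sign) the sine
   parts of the partial integral. *)
Definition psum p c (M : nat) x : R :=
  \int[N]_(xi in cube M) (cos (dot xi x + c) * p xi).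

(** The weight in the square of the norm of [H_eps]. *)
Definition bessel_weight eps xi : R := (1 + enorm xi ^+ 2) `^ eps.

Lemma measurable_enorm : measurable_fun setT (@enorm R n).
Proof.
apply: (measurableT_comp (f := @Num.sqrt R)); last exact: measurable_dotxx.
exact: (continuous_measurable_fun (@sqrt_continuous R)).
Qed.

Lemma measurable_bessel_weight eps : measurable_fun setT (bessel_weight eps).
Proof.
apply: (measurableT_comp (measurable_powR eps)); apply: measurable_funD => //.
by apply: measurable_funX; exact: measurable_enorm.
Qed.

Lemma bessel_weight_ge1 eps xi : 0 <= eps -> 1 <= bessel_weight eps xi.
Proof.
move=> e0; have one : 1 `^ eps = 1 :> R by rewrite powR1.
rewrite /bessel_weight -[leLHS]one ge0_ler_powR ?nnegrE//.
  by rewrite addr_ge0// sqr_ge0.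
by rewrite lerDl sqr_ge0.
Qed.

Lemma measurable_cube M : measurable (@cube R n M).
Proof.
have -> : @cube R n M = \bigcap_(i in [set: 'I_n]) [set xi | `|tnth xi i| <= M%:R / 2].
  by apply/seteqP; split => [x h i _|x h i]; [exact: h|exact: (h i)].
apply: fin_bigcap_measurable => // i _.
have -> : [set xi : n.-tuple R | `|tnth xi i| <= M%:R / 2] =
    setT `&` (fun xi => `|tnth xi i|) @^-1` `]-oo, M%:R / 2].
  by rewrite setTI; apply/seteqP; split => x /=; rewrite in_itv.
have : measurable_fun setT (fun xi : n.-tuple R => `|tnth xi i|).
  by apply: measurableT_comp => //; exact: measurable_tnthR.
by apply => //; exact: measurable_itv.
Qed.

Lemma sub_cube (M M' : nat) : (M <= M')%N -> @cube R n M `<=` cube M'.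
Proof. by move=> MM x h i; rewrite (le_trans (h i))// ler_pM2r// ler_nat. Qed.

(* Provides integrability over the cube without computing its measure. *)
Lemma indic_cube_le M xi : \1_(cube M) xi <=
  (gaussn zerot 1 ([tuple M%:R / 2 | i < n]))^-1 * gaussn zerot 1 xi :> R.
Proof.
have s0 : (1 : R) != 0 by [].
have g0 := @gaussn_zerot_gt0 R n 1 [tuple M%:R / 2 | i < n] s0.
rewrite indicE; have [|_] := boolP (xi \in cube M); last first.
  by rewrite mulr_ge0 ?gaussn_ge0// invr_ge0 ltW.
rewrite inE => h; rewrite mulrC ler_pdivlMr// mul1r.
rewrite !gaussnE// ler_wpM2l ?exprn_ge0 ?normal_peak_ge0// ler_expR.
rewrite ler_wpM2r ?invr_ge0 ?mulrn_wge0// lerN2; apply: ler_sum => i _.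
rewrite !tnth_zerot tnth_mktuple !subr0 -[leLHS]real_normK ?num_real//.
by rewrite lerXn2r ?nnegrE ?divr_ge0// h.
Qed.

Section fixed_function.
Variables (p : n.-tuple R -> R) (c : R).
Hypotheses (mp : measurable_fun setT p)
  (p2 : (\int[N]_xi (p xi ^+ 2)%:E < +oo)%E).

Lemma integrable_sqr : N.-integrable setT (EFin \o (fun xi => p xi ^+ 2)).
Proof.
apply/integrableP; split; first by apply/measurable_EFinP; exact: measurable_funX.
by under eq_integral do rewrite /= ger0_norm ?sqr_ge0//.
Qed.

(** On the cube [|p| <= 1 + p ^+ 2], where [1] is dominated by an integrable Gaussian through
    [indic_cube_le]. *)
Lemma integrable_cube M : N.-integrable setT (EFin \o (p \_ (cube M))).
Proof.
pose A := (gaussn (@zerot R n) 1 ([tuple M%:R / 2 | i < n]))^-1.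
have i1 := integrableZl measurableT A (integrable_gaussn (@zerot R n) 1).
apply: (integrable_le _ _ (integrableD measurableT i1 integrable_sqr)).
  apply/(measurable_restrict _ _ _).1 => //; first exact: measurable_cube.
  by rewrite setTI; exact: measurable_funTS.
move=> xi; have := indic_cube_le M xi; rewrite -/A patchE indicE.
case: ifPn => _ /= h; last first.
  by rewrite normr0 (le_trans h)// lerDl sqr_ge0.
have := sqr_ge0 (`|p xi| - 2^-1); rewrite -(real_normK (num_real (p xi))) => h2.
apply: le_trans (lerD h (lexx _)).
move: h2; set y := `|p xi|; rewrite sqrrB; nra.
Qed.

Lemma psumE M x : psum p c M x = trig (p \_ (cube M)) c x.
Proof.
rewrite /psum Rintegral_mkcond /trig; apply: eq_Rintegral => xi _.
by rewrite !patchE; case: ifP => // _; rewrite mulr0.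
Qed.

Lemma measurable_psum M : measurable_fun setT (psum p c M).
Proof.
rewrite (_ : psum p c M = trig (p \_ (cube M)) c).
  by apply: measurable_trig; exact: integrable_cube.
by apply/funext => x; rewrite psumE.
Qed.

(** The difference is the trigonometric integral of [p] restricted to the shell between the two
    cubes, to which [bessel] applies. *)
Lemma integral_sqr_psumB (M M' : nat) : (M <= M')%N ->
  (\int[N]_x ((psum p c M' x - psum p c M x) ^+ 2)%:E <=
   ((2 * pi) ^+ n)%:E * \int[N]_(xi in cube M' `\` cube M) (p xi ^+ 2)%:E)%E.
Proof.
move=> MM.
have iB : N.-integrable setT (EFin \o (fun xi => (p \_ (cube M')) xi - (p \_ (cube M)) xi)).
  by have := integrableB measurableT (integrable_cube M') (integrable_cube M).
have E x : psum p c M' x - psum p c M x =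
    trig (fun xi => (p \_ (cube M')) xi - (p \_ (cube M)) xi) c x.
  rewrite !psumE /trig -RintegralB//; [|exact/integrable_trig/integrable_cube..].
  by apply: eq_Rintegral => xi _; rewrite mulrBr.
under eq_integral do rewrite E.
apply: (le_trans (bessel c iB)).
rewrite lee_wpmul2l ?lee_fin ?exprn_ge0 ?mulr_ge0 ?pi_ge0//.
rewrite [leRHS]integral_mkcond le_eqVlt; apply/orP; left; apply/eqP.
apply: eq_integral => xi _; rewrite !patchE in_setD.
have [xM|xM] := boolP (xi \in cube M).
  have -> : xi \in cube M' by move: xM; rewrite !inE; exact: sub_cube.
  by rewrite subrr expr0n andbF.
by case: (xi \in cube M') => /=; rewrite ?subr0// expr0n.
Qed.

Definition blocks (m : nat) x : R :=
  \sum_(k < m.+1) \sum_(b < 2 ^ (m - k))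
    (psum p c (2 ^ m + b.+1 * 2 ^ k) x - psum p c (2 ^ m + b * 2 ^ k) x) ^+ 2.

Lemma blocks_ge0 m x : 0 <= blocks m x.
Proof. by apply: sumr_ge0 => k _; apply: sumr_ge0 => b _; exact: sqr_ge0. Qed.

Lemma measurable_blocks m : measurable_fun setT (blocks m).
Proof.
apply: measurable_sum => k; apply: measurable_sum => b.
by apply: measurable_funX; apply: measurable_funB; exact: measurable_psum.
Qed.

Lemma sum_integral_shells (s : nat -> nat) B : {homo s : i j / (i <= j)%N} ->
  (\sum_(b < B) \int[N]_(xi in cube (s b.+1) `\` cube (s b)) (p xi ^+ 2)%:E =
   \int[N]_(xi in cube (s B) `\` cube (s 0%N)) (p xi ^+ 2)%:E)%E.
Proof.
move=> sh; elim: B => [|B IH]; first by rewrite big_ord0 setDv integral_set0.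
have mD a b : measurable (@cube R n a `\` cube b) by apply: measurableD; exact: measurable_cube.
rewrite big_ord_recr /= IH -ge0_integral_setU//.
- congr integral; apply/seteqP; split => x /=.
    move=> [[h1 h2]|[h1 h2]]; split=> //; first by apply: sub_cube h1; exact: sh.
    by move=> h; apply: h2; apply: sub_cube h; exact: sh.
  move=> [h1 h2]; have [h|h] := pselect (cube (s B) x); first by left.
  by right.
- by apply/measurable_EFinP; apply: measurable_funTS; exact: measurable_funX.
- by move=> x _; rewrite lee_fin sqr_ge0.
- by apply/disj_setPS => x /= [[h1 _] [_ h2]].
Qed.

(** At each scale [k] the shells of the blocks are disjoint and fill the shell between [2 ^ m] and
    [2 ^ m.+1]. The factor [m.+1], the logarithmic loss, counts the scales. *)
Lemma integral_blocks m :
  (\int[N]_x (blocks m x)%:E <= (m.+1%:R * (2 * pi) ^+ n)%:E *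
    \int[N]_(xi in cube (2 ^ m.+1) `\` cube (2 ^ m)) (p xi ^+ 2)%:E)%E.
Proof.
have mpB a b : measurable_fun setT (fun x => ((psum p c a x - psum p c b x) ^+ 2)%:E).
  by apply/measurable_EFinP; apply: measurable_funX; apply: measurable_funB; exact: measurable_psum.
rewrite /blocks; under eq_integral do rewrite -sumEFin.
rewrite ge0_integral_sum//; last 2 first.
- move=> k; under eq_fun do rewrite -sumEFin.
  by apply: emeasurable_sum => b.
- by move=> k x _; rewrite lee_fin; apply: sumr_ge0 => b _; exact: sqr_ge0.
rewrite EFinM -muleA.
set I := (\int[N]_(xi in _) _)%E.
have I0 : (0 <= I)%E by apply: integral_ge0 => x _; rewrite lee_fin sqr_ge0.
have -> : (m.+1%:R%:E * (((2 * pi) ^+ n)%:E * I) = \sum_(k < m.+1) (((2 * pi) ^+ n)%:E * I))%E.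
  by rewrite sumr_const card_ord mule_natl.
apply: lee_sum => k _.
under eq_integral do rewrite -sumEFin.
rewrite ge0_integral_sum//; last by move=> b x _; rewrite lee_fin sqr_ge0.
have km : (k <= m)%N by rewrite -ltnS.
have kE : (2 ^ (m - k) * 2 ^ k = 2 ^ m)%N by rewrite -expnD subnK.
pose s b := (2 ^ m + b * 2 ^ k)%N.
have sh : {homo s : i j / (i <= j)%N} by move=> i j ij; rewrite leq_add2l leq_mul2r ij orbT.
have -> : I = (\sum_(b < 2 ^ (m - k)) \int[N]_(xi in cube (s b.+1) `\` cube (s b)) (p xi ^+ 2)%:E)%E.
  by rewrite sum_integral_shells// /s mul0n addn0 kE addnn -mul2n -expnS.
rewrite ge0_sume_distrr; last first.
  by move=> b _; apply: integral_ge0 => x _; rewrite lee_fin sqr_ge0.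
by apply: lee_sum => b _; apply: integral_sqr_psumB; exact: sh.
Qed.

Lemma psum_increment m x M : (2 ^ m <= M <= 2 ^ m.+1)%N ->
  `|psum p c M x - psum p c (2 ^ m) x| <= m.+1%:R * Num.sqrt (blocks m x).
Proof.
apply: (@dyadic_increment _ (fun M => psum p c M x)); first exact: sqrtr_ge0.
move=> k b km bk.
rewrite -sqrtr_sqr ler_sqrt ?blocks_ge0//.
have kE : (2 ^ (m - k) * 2 ^ k = 2 ^ m)%N by rewrite -expnD subnK.
have km' : (k < m.+1)%N by [].
have bk' : (b < 2 ^ (m - Ordinal km'))%N.
  by move: bk; rewrite -kE leq_pmul2r// expn_gt0.
rewrite /blocks (bigD1 (Ordinal km'))//= (bigD1 (Ordinal bk'))//= -addrA lerDl.
rewrite addr_ge0//; first by apply: sumr_ge0 => *; exact: sqr_ge0.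
by apply: sumr_ge0 => *; apply: sumr_ge0 => *; exact: sqr_ge0.
Qed.

(** Some coordinate exceeds the half-side [2 ^ m / 2], so that [enorm xi ^+ 2] is at least
    [4 ^ m / 4]; the constant [4 ^ eps] comes from this half. *)
Lemma shell_weight eps m xi : 0 <= eps -> ~ cube (2 ^ m) xi ->
  1 <= 4 `^ eps * (4 `^ - eps) ^+ m * bessel_weight eps xi.
Proof.
move=> e0 /existsNP[i /negP]; rewrite -ltNge => hi.
have -> : (4 `^ - eps) ^+ m = (4^-1 ^+ m) `^ eps :> R.
  have -> : 4 `^ (- eps) = (4^-1) `^ eps :> R by rewrite -powR_inv1// -powRrM mulN1r.
  by rewrite -[LHS]powR_mulrn ?powR_ge0// powRAC powR_mulrn// invr_ge0.
have q0 : 0 <= 4^-1 ^+ m :> R by rewrite exprn_ge0// invr_ge0.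
have z0 : 0 <= 1 + enorm xi ^+ 2 by rewrite addr_ge0// sqr_ge0.
rewrite /bessel_weight -!powRM ?mulr_ge0//.
have one : 1 `^ eps = 1 :> R by rewrite powR1.
rewrite -[leLHS]one ge0_ler_powR ?nnegrE ?mulr_ge0//.
have h1 : (2 ^ m)%:R ^+ 2 / 4 <= enorm xi ^+ 2 :> R.
  rewrite sqr_enorm; apply: (@le_trans _ _ (tnth xi i * tnth xi i)).
    rewrite -expr2 -[leRHS]real_normK ?num_real//.
    have -> : (2 ^ m)%:R ^+ 2 / 4 = ((2 ^ m)%:R / 2) ^+ 2 :> R by field.
    by rewrite lerXn2r ?nnegrE ?divr_ge0// ltW.
  rewrite /dot (bigD1 i)//= lerDl; apply: sumr_ge0 => j _.
  by rewrite -expr2 sqr_ge0.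
have h2 : 4^-1 ^+ m * ((2 ^ m)%:R ^+ 2) = 1 :> R.
  rewrite natrX -exprM mulnC exprM -natrX exprVn mulVf// expf_neq0//.
have : 4^-1 ^+ m * ((2 ^ m)%:R ^+ 2 / 4) <= 4^-1 ^+ m * enorm xi ^+ 2 :> R.
  by rewrite ler_wpM2l.
rewrite mulrA h2 mul1r; set a : R := 4^-1 ^+ m; move: q0; rewrite -/a.
set b := enorm xi ^+ 2; nra.
Qed.

End fixed_function.

Section maximal.
Variables (eps : R).
Hypothesis eps_gt0 : 0 < eps.

Let r : R := 2 `^ - eps.

Lemma powR2N_lt1 : 0 < r < 1.
Proof.
rewrite /r powR_gt0//= powRN invf_lt1 ?powR_gt0//.
have one : 1 `^ eps = 1 :> R by rewrite powR1.
by rewrite -[ltLHS]one gt0_ltr_powR ?nnegrE// ltr1n.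
Qed.

(** By [shell_weight] the blocks of index [m] have mass [O(m.+1 * r ^ (2 m))]. After the weight
    [r ^- m] the series of integrals still converges, and finiteness of the sum leaves each
    [blocks p c m x] the decay [r ^+ m]. *)
Definition maxfun p c x : \bar R :=
  (((psum p c 1 x) ^+ 2)%:E + \sum_(0 <= m <oo) ((r ^+ m)^-1 * blocks p c m x)%:E)%E.

Lemma maxfun_term_ge0 p c m x : (0 <= ((r ^+ m)^-1 * blocks p c m x)%:E)%E.
Proof.
have /andP[r0 _] := powR2N_lt1.
by rewrite lee_fin mulr_ge0 ?blocks_ge0// invr_ge0 exprn_ge0// ltW.
Qed.

Lemma maxfun_ge0 p c x : (0 <= maxfun p c x)%E.
Proof.
rewrite adde_ge0 ?lee_fin ?sqr_ge0//.
by apply: nneseries_ge0 => m _ _; exact: maxfun_term_ge0.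
Qed.

Lemma bessel_sqr_fin p : measurable_fun setT p ->
  (\int[N]_xi (bessel_weight eps xi * p xi ^+ 2)%:E < +oo)%E ->
  (\int[N]_xi (p xi ^+ 2)%:E <= \int[N]_xi (bessel_weight eps xi * p xi ^+ 2)%:E)%E.
Proof.
move=> mp _; apply: ge0_le_integral => //.
- by move=> x _; rewrite lee_fin sqr_ge0.
- by apply/measurable_EFinP; exact: measurable_funX.
- apply/measurable_EFinP; apply: measurable_funM; first exact: measurable_bessel_weight.
  exact: measurable_funX.
- move=> x _; rewrite lee_fin ler_peMl ?sqr_ge0//.
  by apply: bessel_weight_ge1; exact: ltW.
Qed.

Lemma measurable_maxfun p c : measurable_fun setT p ->
  (\int[N]_xi (p xi ^+ 2)%:E < +oo)%E -> measurable_fun setT (maxfun p c).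
Proof.
move=> mp p2; apply: emeasurable_funD.
  by apply/measurable_EFinP; apply: measurable_funX; exact: measurable_psum.
apply: ge0_emeasurable_sum => m.
  by move=> x _ _; exact: maxfun_term_ge0.
by move=> _; apply/measurable_EFinP; apply: measurable_funM => //; exact: measurable_blocks.
Qed.

(** The constant is uniform in [p] and [c], because the bound will be summed over infinitely many
    time increments. *)
Lemma integral_maxfun : exists2 C : R, 0 <= C & forall p c, measurable_fun setT p ->
  (\int[N]_xi (bessel_weight eps xi * p xi ^+ 2)%:E < +oo)%E ->
  (\int[N]_x maxfun p c x <=
   C%:E * \int[N]_xi (bessel_weight eps xi * p xi ^+ 2)%:E)%E.
Proof.
have /andP[r0 r1] := powR2N_lt1.
(* The remaining [r ^+ m] is [t ^+ m * t ^+ m]: one factor absorbs [m.+1], the other makes the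
   series geometric. *)
pose t := Num.sqrt r.
have t0 : 0 < t by rewrite sqrtr_gt0.
have tt : t * t = r by rewrite -expr2 sqr_sqrtr// ltW.
have t1 : t < 1 by rewrite -sqrtr1 ltr_sqrt.
have t01 : 0 < t < 1 by rewrite t0.
have [D D0 HD] := natr_mul_geometric t01.
pose P : R := (2 * pi) ^+ n.
have P0 : 0 <= P by rewrite exprn_ge0// mulr_ge0// pi_ge0.
pose B := P * 4 `^ eps * D.
have B0 : 0 <= B by rewrite !mulr_ge0// ?powR_ge0// ltW.
exists (P + B * (1 - t)^-1).
  by rewrite addr_ge0// mulr_ge0// invr_ge0 subr_ge0 ltW.
move=> p c mp Wfin.
set W := (\int[N]_xi (bessel_weight eps xi * p xi ^+ 2)%:E)%E in Wfin *.
have W0 : (0 <= W)%E.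
  by apply: integral_ge0 => x _; rewrite lee_fin mulr_ge0 ?sqr_ge0// powR_ge0.
have pW := bessel_sqr_fin mp Wfin.
have p2 := le_lt_trans pW Wfin.
have Wnum : W = (fine W)%:E by rewrite fineK// ge0_fin_numE.
have fW0 : 0 <= fine W by exact: fine_ge0.
have mterm m : measurable_fun setT (fun x => ((r ^+ m)^-1 * blocks p c m x)%:E).
  by apply/measurable_EFinP; apply: measurable_funM => //; exact: measurable_blocks.
rewrite ge0_integralD//; last 4 first.
- by move=> x _; rewrite lee_fin sqr_ge0.
- by apply/measurable_EFinP; apply: measurable_funX; exact: measurable_psum.
- by move=> x _; apply: nneseries_ge0 => m _ _; exact: maxfun_term_ge0.
- by apply: ge0_emeasurable_sum => m // x _ _; exact: maxfun_term_ge0.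
rewrite integral_nneseries//; last by move=> m x _; exact: maxfun_term_ge0.
rewrite EFinD ge0_muleDl ?lee_fin//; last by rewrite mulr_ge0// invr_ge0 subr_ge0 ltW.
apply: leeD.
  under eq_integral do rewrite psumE.
  apply: (le_trans (bessel c (integrable_cube mp p2 1))).
  rewrite lee_wpmul2l ?lee_fin// (le_trans _ pW)//.
  apply: ge0_le_integral => //.
  - by move=> x _; rewrite lee_fin sqr_ge0.
  - have /measurable_EFinP := measurable_int _ (integrable_cube mp p2 1).
    by move=> m1; apply/measurable_EFinP; exact: measurable_funX.
  - by apply/measurable_EFinP; exact: measurable_funX.
  - by move=> x _; rewrite lee_fin patchE; case: ifP => // _; rewrite expr0n /= sqr_ge0.
have shell m : (\int[N]_(xi in cube (2 ^ m.+1) `\` cube (2 ^ m)) (p xi ^+ 2)%:E <=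
    (4 `^ eps * (4 `^ - eps) ^+ m * fine W)%:E)%E.
  have mD : measurable (@cube R n (2 ^ m.+1) `\` cube (2 ^ m)).
    by apply: measurableD; exact: measurable_cube.
  apply: (@le_trans _ _ (\int[N]_(xi in cube (2 ^ m.+1) `\` cube (2 ^ m))
     ((4 `^ eps * (4 `^ - eps) ^+ m) * (bessel_weight eps xi * p xi ^+ 2))%:E)%E).
    apply: ge0_le_integral => //.
    - by move=> x _; rewrite lee_fin sqr_ge0.
    - by apply/measurable_EFinP; apply: measurable_funTS; exact: measurable_funX.
    - apply/measurable_EFinP; apply: measurable_funTS; apply: measurable_funM => //.
      apply: measurable_funM; first exact: measurable_bessel_weight.
      exact: measurable_funX.
    - move=> x [_ h]; rewrite lee_fin mulrA ler_peMl ?sqr_ge0//.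
      by apply: shell_weight => //; exact: ltW.
  under eq_integral do rewrite EFinM.
  rewrite ge0_integralZl//; last 2 first.
  - apply/measurable_EFinP; apply: measurable_funTS; apply: measurable_funM.
      exact: measurable_bessel_weight.
    exact: measurable_funX.
  - by move=> x _; rewrite lee_fin mulr_ge0 ?powR_ge0 ?sqr_ge0.
  rewrite [leRHS]EFinM lee_wpmul2l ?lee_fin ?mulr_ge0 ?exprn_ge0 ?powR_ge0// -Wnum.
  apply: ge0_subset_integral => //.
  - apply/measurable_EFinP; apply: measurable_funM; first exact: measurable_bessel_weight.
    exact: measurable_funX.
  - by move=> x _; rewrite lee_fin mulr_ge0 ?powR_ge0 ?sqr_ge0.
have r4 : 4 `^ (- eps) = r ^+ 2.
  have -> : 4 = 2 `^ 2 :> R by rewrite powR_mulrn//; ring.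
  rewrite powRAC -/r -powR_mulrn ?ltW//.
have -> : ((B / (1 - t))%:E * W = (B * fine W * (1 - t)^-1)%:E)%E.
  by rewrite Wnum -EFinM /= mulrAC.
apply: nneseries_geometric_le => //.
- by rewrite mulr_ge0.
- by move=> m; apply: integral_ge0 => x _; exact: maxfun_term_ge0.
move=> m; under eq_integral do rewrite EFinM.
rewrite ge0_integralZl//; last 3 first.
- by apply/measurable_EFinP; exact: measurable_blocks.
- by move=> x _; rewrite lee_fin blocks_ge0.
- by rewrite lee_fin invr_ge0 exprn_ge0// ltW.
apply: (@le_trans _ _ ((r ^+ m)^-1%:E *
    ((m.+1%:R * P)%:E * (4 `^ eps * (4 `^ - eps) ^+ m * fine W)%:E))%E).
  rewrite lee_wpmul2l ?lee_fin ?invr_ge0 ?exprn_ge0 ?(ltW r0)//.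
  apply: (le_trans (integral_blocks c mp p2 m)).
  by rewrite lee_wpmul2l ?lee_fin ?mulr_ge0.
rewrite -!EFinM lee_fin r4.
have rm : r ^+ m != 0 by rewrite expf_neq0// gt_eqF.
have E : r ^+ 2 ^+ m = r ^+ m * (t ^+ m * t ^+ m).
  by rewrite -exprMn tt -exprM mulnC exprM expr2.
rewrite E.
have -> : (r ^+ m)^-1 * (m.+1%:R * P * (4 `^ eps * (r ^+ m * (t ^+ m * t ^+ m)) * fine W)) =
  P * 4 `^ eps * fine W * t ^+ m * (m.+1%:R * t ^+ m).
  by field.
have -> : B * fine W * t ^+ m = P * 4 `^ eps * fine W * t ^+ m * D by rewrite /B; ring.
have tm : 0 <= t ^+ m by rewrite exprn_ge0// ltW.
have p4 : 0 <= 4 `^ eps :> R by exact: powR_ge0.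
apply: ler_wpM2l; last exact: HD.
by apply: mulr_ge0 => //; apply: mulr_ge0 => //; exact: mulr_ge0.
Qed.

Lemma psum_maxfun p c m x M : (maxfun p c x < +oo)%E -> (2 ^ m <= M <= 2 ^ m.+1)%N ->
  `|psum p c M x - psum p c (2 ^ m) x| <=
  m.+1%:R * Num.sqrt r ^+ m * Num.sqrt (fine (maxfun p c x)).
Proof.
have /andP[r0 r1] := powR2N_lt1.
move=> fin hM; apply: (le_trans (psum_increment p c x hM)).
rewrite -mulrA ler_wpM2l//.
have h : blocks p c m x <= r ^+ m * fine (maxfun p c x).
  rewrite mulrC -ler_pdivrMr ?exprn_gt0// mulrC.
  rewrite -lee_fin fineK ?ge0_fin_numE ?maxfun_ge0//.
  rewrite /maxfun -[leLHS]add0e leeD ?lee_fin ?sqr_ge0//.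
  rewrite (@nneseriesD1 _ _ m)//; last by move=> k _; exact: maxfun_term_ge0.
  rewrite leeDl//; apply: nneseries_ge0 => k _ _; exact: maxfun_term_ge0.
apply: (@le_trans _ _ (Num.sqrt (r ^+ m * fine (maxfun p c x)))).
  by rewrite ler_wsqrtr.
have rm0 : 0 <= r ^+ m by rewrite exprn_ge0// ltW.
rewrite sqrtrM// ler_wpM2r ?sqrtr_ge0//.
have -> : r ^+ m = (Num.sqrt r ^+ m) ^+ 2.
  by rewrite -exprM mulnC exprM sqr_sqrtr// ltW.
by rewrite sqrtr_sqr ger0_norm// exprn_ge0// sqrtr_ge0.
Qed.

Lemma psum1_maxfun p c x : (maxfun p c x < +oo)%E ->
  `|psum p c 1 x| <= Num.sqrt (fine (maxfun p c x)).
Proof.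
move=> fin; rewrite -sqrtr_sqr ler_wsqrtr//.
rewrite -lee_fin fineK ?ge0_fin_numE ?maxfun_ge0//.
rewrite /maxfun leeDl//; apply: nneseries_ge0 => k _ _; exact: maxfun_term_ge0.
Qed.

End maximal.

End rademacher_menshov.

(** * Chaining along the Cantor set *)

Section chaining.
Context {R : realType}.
Variable lambda : R.
Hypotheses (lambda_gt0 : 0 < lambda) (lambda_lt : lambda < 1 / 2).
Local Notation ci := (cantor_intervals lambda).

(* The intervals of level [l.+1] inside [J] start at [J.1] and [J.1 + gap l]. *)
Definition gap (l : nat) : R := lambda ^+ l * (1 - lambda).

Let lambda_lt1 : lambda < 1. Proof. by rewrite (lt_trans lambda_lt)// ltr_pdivrMr// mul1r ltr1n. Qed.

Lemma gap_homo l j : (l <= j)%N -> gap j <= gap l.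
Proof.
move=> lj; rewrite /gap ler_wpM2r ?subr_ge0 ?(ltW lambda_lt1)//.
by rewrite ler_wiXn2l// ltW.
Qed.

Lemma gap_gt0 l : 0 < gap l.
Proof. by rewrite mulr_gt0 ?exprn_gt0// subr_gt0. Qed.

Lemma cantor_intervals_length k J : J \in ci k -> J.2 = J.1 + lambda ^+ k.
Proof.
elim: k J => [|k IH] J /=; first by rewrite inE => /eqP -> /=; rewrite add0r expr0.
move=> /flattenP[_ /mapP[J' J'k ->]]; rewrite !inE => /orP[/eqP->//|/eqP->/=].
by rewrite subrK.
Qed.

Lemma cantor_intervals_child k J : J \in ci k.+1 ->
  exists2 J', J' \in ci k & J.1 = J'.1 \/ J.1 = J'.1 + gap k.
Proof.
move=> /flattenP[_ /mapP[J' J'k ->]] h; exists J' => //.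
move: h; rewrite !inE => /orP[/eqP->/=|/eqP->/=]; [by left|right].
rewrite (cantor_intervals_length J'k) /gap exprS; ring.
Qed.

Lemma cantor_intervals0 k : (0, lambda ^+ k) \in ci k.
Proof.
elim: k => [|k IH]; first by rewrite /= expr0 inE.
apply/flattenP; exists [:: (0, 0 + lambda ^+ k.+1); (lambda ^+ k - lambda ^+ k.+1, lambda ^+ k)].
  by apply/mapP; exists (0, lambda ^+ k).
by rewrite add0r !inE eqxx.
Qed.

Lemma cantor0 : cantor lambda 0.
Proof.
move=> k _; exists (0, lambda ^+ k) => /=; first exact: cantor_intervals0.
by rewrite in_itv /= lexx exprn_ge0// ltW.
Qed.

(** Passing to the parent interval keeps the left endpoint or moves it by [gap k]. The endpoint is a
    sum of the steps taken, so a step of level [l] is at most [J.1] and the assumption on [j] gives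
    [j <= l]. The bound is the geometric sum over the levels from [j] to [k - 1], empty when
    [k < j]. *)
Lemma chain_bound (G : R -> R) (B alpha : R) : 0 <= B -> 0 < alpha < 1 ->
  (forall l J, J \in ci l -> `|G (J.1 + gap l) - G J.1| <= B * alpha ^+ l) ->
  forall j k J, J \in ci k -> (forall l, gap l <= J.1 -> (j <= l)%N) ->
  `|G J.1 - G 0| <= if (j <= k)%N then B * (alpha ^+ j - alpha ^+ k) / (1 - alpha) else 0.
Proof.
move=> B0 /andP[a0 a1] H j k; elim: k => [|k IH] J Jk jl.
  by move: Jk; rewrite inE => /eqP -> /=; rewrite subrr normr0; case: ifP => //;
    rewrite leqn0 => /eqP ->; rewrite subrr mulr0 mul0r.
have h1a : 0 < 1 - alpha by rewrite subr_gt0.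
have step : B * (alpha ^+ j - alpha ^+ k.+1) / (1 - alpha) =
    B * (alpha ^+ j - alpha ^+ k) / (1 - alpha) + B * alpha ^+ k.
  by rewrite exprS; field; rewrite gt_eqF.
have [J' J'k [E|E]] := cantor_intervals_child Jk; rewrite E in jl *.
  apply: (le_trans (IH _ J'k jl)).
  have [jk|kj] := leqP j k.
    by rewrite (leqW jk) step lerDl mulr_ge0// exprn_ge0// ltW.
  case: ifP => // jk.
  have -> : j = k.+1 by apply/eqP; rewrite eqn_leq jk kj.
  by rewrite subrr mulr0 mul0r.
have J'0 : 0 <= J'.1.
  elim: (k) (J') J'k => [|i IHi] I; first by rewrite inE => /eqP ->.
  move=> Ii; have [I' I'i [->|->]] := cantor_intervals_child Ii; first exact: IHi I'i.
  by rewrite addr_ge0 ?(IHi _ I'i)// ltW// gap_gt0.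
have jk : (j <= k)%N by apply: jl; rewrite lerDr.
have jl' l : gap l <= J'.1 -> (j <= l)%N.
  by move=> h; apply: jl; rewrite (le_trans h)// lerDl ltW// gap_gt0.
rewrite (leqW jk) step.
have := IH _ J'k jl'; rewrite jk => h1.
rewrite -(subrK (G J'.1) (G (J'.1 + _))) -addrA (le_trans (ler_normD _ _))//.
by rewrite [leRHS]addrC lerD// H.
Qed.

Lemma le_geometric_rem (x L b : R) : (forall k, x <= L * lambda ^+ k + b) -> x <= b.
Proof.
move=> H; have : (L * lambda ^+ k + b) @[k --> \oo] --> L * 0 + b.
  apply: cvgD; last exact: cvg_cst.
  by apply: cvgMl_tmp; apply: cvg_expr; rewrite ger0_norm// ltW.
rewrite mulr0 add0r => c.
by apply: (cvgr_to_ge c); exact: nearW.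
Qed.

(* [j] is a lower bound for the levels of the steps leading from [0] to [t]. *)
Lemma cantor_chain (G : R -> R) (L B alpha : R) : 0 <= B -> 0 < alpha < 1 ->
  (forall t u, `|G t - G u| <= L * `|t - u|) ->
  (forall l J, J \in ci l -> `|G (J.1 + gap l) - G J.1| <= B * alpha ^+ l) ->
  forall t j, cantor lambda t -> (forall l, gap l <= t -> (j <= l)%N) ->
  `|G t - G 0| <= B * alpha ^+ j / (1 - alpha).
Proof.
move=> B0 a01 GL H t j Ct jl; have /andP[a0 a1] := a01.
have h1a : 0 < 1 - alpha by rewrite subr_gt0.
have L0 : 0 <= L by have := GL 1 0; rewrite subr0 normr1 mulr1; exact: le_trans.
(* The point [t] is within [lambda ^+ k] of the left endpoint of its interval of level [k]. The
   constant [L] multiplies only this distance and vanishes as [k] grows. *)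
apply: (@le_geometric_rem _ L) => k.
have [J /= Jk] := Ct k I; rewrite in_itv /= => /andP[J1 J2].
have jl' l : gap l <= J.1 -> (j <= l)%N by move=> h; apply: jl; exact: le_trans J1.
have h1 := chain_bound B0 a01 H Jk jl'.
rewrite -(subrK (G J.1) (G t)) -addrA (le_trans (ler_normD _ _))// lerD//.
  rewrite (le_trans (GL _ _))// ler_wpM2l// ger0_norm ?subr_ge0//.
  by rewrite lerBlDl -(cantor_intervals_length Jk).
apply: (le_trans h1); case: ifP => _; last first.
  by rewrite divr_ge0// ?mulr_ge0// ?exprn_ge0// ltW.
rewrite ler_wpM2r ?invr_ge0 ?(ltW h1a)// ler_wpM2l// gerBl exprn_ge0// ltW//.
Qed.

(** Go from [2 ^ m] by doublings to the largest power of two below [M], then in one step to [M]. *)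
Lemma dyadic_tail (u : nat -> R) (K q : R) : 0 <= K -> 0 < q < 1 ->
  (forall m M, (2 ^ m <= M <= 2 ^ m.+1)%N -> `|u M - u (2 ^ m)%N| <= K * q ^+ m) ->
  forall m M, (2 ^ m <= M)%N -> `|u M - u (2 ^ m)%N| <= K / (1 - q) * q ^+ m.
Proof.
move=> K0 /andP[q0 q1] H m M mM.
have h1q : 0 < 1 - q by rewrite subr_gt0.
(* The factor [1 - q ^+ j] keeps the exact partial geometric sum; the room it leaves pays for the
   last step to [M]. *)
have P j : `|u (2 ^ (m + j))%N - u (2 ^ m)%N| <= K / (1 - q) * q ^+ m * (1 - q ^+ j).
  elim: j => [|j IH]; first by rewrite addn0 !subrr normr0 mulr0.
  have h := H (m + j)%N (2 ^ (m + j).+1)%N.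
  rewrite leqnn andbT leq_exp2l// leqnSn in h; have {}h := h isT.
  rewrite addnS -(subrK (u (2 ^ (m + j))%N) (u (2 ^ (m + j).+1)%N)) -addrA.
  rewrite (le_trans (ler_normD _ _))// (le_trans (lerD h IH))//.
  rewrite le_eqVlt; apply/orP; left; apply/eqP.
  by rewrite exprD exprS; field; rewrite gt_eqF.
have M0 : (0 < M)%N by rewrite (leq_trans _ mM)// expn_gt0.
have /andP[l1 l2] := trunc_log_bounds (isT : (1 < 2)%N) M0.
set l := trunc_log 2 M in l1 l2.
have ml : (m <= l)%N by rewrite -ltnS -(ltn_exp2l _ _ (isT : (1 < 2)%N)) (leq_ltn_trans mM).
have h := H l M; rewrite l1 (ltnW l2) in h; have {}h := h isT.
have := P (l - m)%N; rewrite subnKC// => h2.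
rewrite -(subrK (u (2 ^ l)%N) (u M)) -addrA (le_trans (ler_normD _ _))//.
apply: (le_trans (lerD h h2)).
have -> : q ^+ l = q ^+ m * q ^+ (l - m) by rewrite -exprD subnKC.
have : 0 <= q ^+ (l - m).+1 by rewrite exprn_ge0// ltW.
have : 0 <= q ^+ m by rewrite exprn_ge0// ltW.
rewrite exprS; set a := q ^+ m; set b := q ^+ (l - m) => a0 b0.
have -> : K * (a * b) + K / (1 - q) * a * (1 - b) =
  K / (1 - q) * a - K / (1 - q) * a * (q * b).
  by field; rewrite gt_eqF.
by rewrite gerBl mulr_ge0// mulr_ge0// divr_ge0// ltW.
Qed.

Lemma geometric_small (K q e : R) : 0 < q < 1 -> 0 < e -> exists m, K * q ^+ m <= e.
Proof.
move=> /andP[q0 q1] e0.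
have c : (K * q ^+ k) @[k --> \oo] --> 0.
  rewrite -(mulr0 K); apply: cvgMl_tmp; apply: cvg_expr; rewrite ger0_norm// ltW//.
have [m _ /(_ m (leqnn m)) h] := (cvgr0Pnorm_le _).1 c e e0.
by exists m; apply: le_trans h; exact: ler_norm.
Qed.

Lemma dyadic_cvg (u : nat -> R) (K q : R) : 0 < q < 1 ->
  (forall m M, (2 ^ m <= M)%N -> `|u M - u (2 ^ m)%N| <= K * q ^+ m) -> cvgn u.
Proof.
move=> q01 H; apply: cauchy_cvg; apply: cauchy_exP => e e0.
have [m hm] := geometric_small K q01 (divr_gt0 e0 (ltr0n R 2)).
exists (u (2 ^ m)%N); exists (2 ^ m)%N => // M /= hM.
rewrite -ball_normE /= distrC (le_lt_trans (H _ _ hM))// (le_lt_trans hm)//.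
by rewrite ltr_pdivrMr// ltr_pMr// ltr1n.
Qed.

(* [V M t] plays the role of the partial integral over the cube of side [M] at
   time [t]: its mixed increments are controlled along the dyadic tree in [M] and
   along the tree of the Cantor set in [t]. *)
Lemma cantor_maximal_cvg (V : nat -> R -> R) (K alpha q : R) :
  0 <= K -> 0 < alpha < 1 -> 0 < q < 1 ->
  (forall m M, (2 ^ m <= M <= 2 ^ m.+1)%N -> `|V M 0 - V (2 ^ m)%N 0| <= K * q ^+ m) ->
  (forall l J m M, J \in ci l -> (2 ^ m <= M <= 2 ^ m.+1)%N ->
    `|(V M (J.1 + gap l) - V M J.1) -
      (V (2 ^ m)%N (J.1 + gap l) - V (2 ^ m)%N J.1)| <= K * alpha ^+ l * q ^+ m) ->
  (forall l J, J \in ci l -> `|V 1%N (J.1 + gap l) - V 1%N J.1| <= K * alpha ^+ l) ->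
  (forall M, exists L, forall t u, `|V M t - V M u| <= L * `|t - u|) ->
  exists W : R -> R,
    (forall t, cantor lambda t -> V M t @[M --> \oo] --> W t) /\
    W t @[t --> within (cantor lambda) 0^'] --> W 0.
Proof.
move=> K0 a01 q01 H0 H1 H2 HL; have /andP[a0 a1] := a01; have /andP[q0 q1] := q01.
have h1a : 0 < 1 - alpha by rewrite subr_gt0.
have h1q : 0 < 1 - q by rewrite subr_gt0.
have T0 := dyadic_tail K0 q01 H0.
have T1 l J m M : J \in ci l -> (2 ^ m <= M)%N ->
    `|(V M (J.1 + gap l) - V M J.1) -
      (V (2 ^ m)%N (J.1 + gap l) - V (2 ^ m)%N J.1)| <= K / (1 - q) * q ^+ m * alpha ^+ l.
  move=> Jl mM.
  have K0' : 0 <= K * alpha ^+ l by rewrite mulr_ge0// exprn_ge0// ltW.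
  have := @dyadic_tail (fun M => V M (J.1 + gap l) - V M J.1) _ _ K0' q01
    (fun m M h => H1 l J m M Jl h) m M mM.
  by move/le_trans; apply; rewrite le_eqVlt; apply/orP; left; apply/eqP; ring.
have B1 m : 0 <= K / (1 - q) * q ^+ m.
  by rewrite mulr_ge0// ?exprn_ge0 ?(ltW q0)// divr_ge0// ltW.
pose C := K / (1 - q) + K / (1 - q) / (1 - alpha).
(* Chaining in time of the tail [V M t - V (2 ^ m) t]. The Lipschitz constants depend on [M] and
   [m], but the bound does not contain them, so the convergence is uniform in [t]. *)
have S t m M : cantor lambda t -> (2 ^ m <= M)%N ->
    `|V M t - V (2 ^ m)%N t| <= C * q ^+ m.
  move=> Ct mM; have [L1 HL1] := HL M; have [L2 HL2] := HL (2 ^ m)%N.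
  have Glip t' u' : `|(V M t' - V (2 ^ m)%N t') - (V M u' - V (2 ^ m)%N u')| <= (L1 + L2) * `|t' - u'|.
    have -> : (V M t' - V (2 ^ m)%N t') - (V M u' - V (2 ^ m)%N u') =
      (V M t' - V M u') - (V (2 ^ m)%N t' - V (2 ^ m)%N u') by ring.
    by rewrite mulrDl (le_trans (ler_normB _ _))// lerD.
  have Gch l J : J \in ci l -> `|(V M (J.1 + gap l) - V (2 ^ m)%N (J.1 + gap l)) -
       (V M J.1 - V (2 ^ m)%N J.1)| <= K / (1 - q) * q ^+ m * alpha ^+ l.
    move=> Jl; apply: le_trans (T1 l J m M Jl mM).
    by rewrite le_eqVlt; apply/orP; left; apply/eqP; congr (`|_|); ring.
  have h := @cantor_chain (fun t => V M t - V (2 ^ m)%N t) _ _ _ (B1 m) a01 Glip Gch t 0%N Ct (fun l _ => leq0n l).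
  have := T0 m M mM.
  rewrite -(subrK (V M 0 - V (2 ^ m)%N 0) (V M t - _)) => h'.
  apply: (le_trans (ler_normD _ _)); apply: (le_trans (lerD h h')).
  by rewrite /C expr0 mulr1 le_eqVlt; apply/orP; left; apply/eqP; ring.
have cv t : cantor lambda t -> cvgn (V ^~ t).
  by move=> Ct; apply: (dyadic_cvg q01) => m M; exact: S.
exists (fun t => limn (V ^~ t)); split; first by move=> t Ct; exact: cv.
pose K2 := K + K / (1 - q).
have K20 : 0 <= K2 by rewrite addr_ge0// divr_ge0// ltW.
(* Each time increment of [V M] is that of [V 1] plus a tail in [M], hence at most [K2 * alpha ^+ l]
   for all [M]; chaining is done at fixed [M] and the limit is taken afterwards. *)
have U t j : cantor lambda t -> (forall l, gap l <= t -> (j <= l)%N) ->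
    `|limn (V ^~ t) - limn (V ^~ 0)| <= K2 * alpha ^+ j / (1 - alpha).
  move=> Ct jl.
  have c : `|V M t - V M 0| @[M --> \oo] --> `|limn (V ^~ t) - limn (V ^~ 0)|.
    by apply: cvg_norm; apply: cvgB; [exact: cv|exact: (cv _ cantor0)].
  apply: (cvgr_to_le c); exists 1%N => // M /= M1.
  have [L HL1] := HL M.
  apply: (cantor_chain K20 a01 HL1 _ Ct jl) => l J Jl.
  have := T1 l J 0%N M Jl; rewrite expn0 => /(_ M1) h.
  have h2 := H2 l J Jl.
  rewrite -(subrK (V 1%N (J.1 + gap l) - V 1%N J.1) (V M _ - _)).
  rewrite (le_trans (ler_normD _ _))// (le_trans (lerD h h2))//.
  by rewrite expr0 mulr1 /K2 mulrDl addrC.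
apply/cvgrPdist_le => e e0.
have [j hj] := geometric_small (K2 / (1 - alpha)) a01 e0.
rewrite near_withinE; near=> t => Ct.
rewrite distrC (le_trans (U t j Ct _))//.
  move=> l lt; rewrite leqNgt; apply/negP => lj.
  (* Gaps decrease with the level, so below [gap j] no step of level less than [j] fits. *)
  have : t < gap j by near: t; apply: nbhs_dnbhs; apply: lt_nbhsl; exact: gap_gt0.
  by rewrite ltNge (le_trans (gap_homo (ltnW lj)) lt).
by apply: le_trans hj; rewrite le_eqVlt; apply/orP; left; apply/eqP; ring.
Unshelve. all: by end_near. Qed.

End chaining.

(** * Gaussians are Schwartz functions *)

Section gauss_schwartz.
Context {R : realType} {n : nat}.
Implicit Types (P : 'I_n -> {poly R}) (b x : n.-tuple R).

(* Polynomial multiples of a Gaussian are closed under differentiation. *)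
Definition pgauss1 (p : {poly R}) (m t : R) : R := p.[t - m] * normal_pdf m 1 t.

Lemma is_derive_pgauss1 (p : {poly R}) (m t : R) :
  is_derive t (1 : R) (pgauss1 p m) (pgauss1 (p^`() - 'X * p) m t).
Proof.
have d0 : is_derive t (1 : R) (fun y : R => y - m) 1.
  have -> : (fun y : R => y - m) = (id : R -> R) - cst m by apply/funext.
  by apply: is_derive_eq; rewrite subr0.
have d1 := @is_derive1_comp _ (horner p) _ t _ _ (is_derive_poly p (t - m)) d0.
have := is_deriveM d1 (is_derive_normal_pdf m t (oner_neq0 R)).
move=> h; apply: (is_derive_eq h); rewrite /pgauss1 /GRing.scale /=.
by rewrite hornerD hornerN hornerM hornerX expr1n divr1; ring.
Qed.

Lemma expR_ge_pow (z : R) k : 0 <= z -> z ^+ k <= k`!%:R * expR z.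
Proof.
move=> z0; case: k => [|k]; first by rewrite expr0 mul1r -expR0 ler_expR.
have := expR_ge1Dxn k z0 => h.
rewrite mulrC -ler_pdivrMr ?ltr0n ?fact_gt0//.
by apply: le_trans h; rewrite lerDr.
Qed.

Lemma horner_le_pow (p : {poly R}) (y : R) :
  `|p.[y]| <= (\sum_(i < size p) `|p`_i|) * (1 + `|y|) ^+ size p.
Proof.
rewrite horner_coef (le_trans (ler_norm_sum _ _ _))// mulr_suml.
apply: ler_sum => i _; rewrite normrM ler_wpM2l// normrX.
have y0 : 0 <= `|y| by [].
apply: (@le_trans _ _ ((1 + `|y|) ^+ i)).
  by rewrite lerXn2r ?nnegrE ?addr_ge0// lerDr.
by rewrite ler_weXn2l ?lerDl// ltnW.
Qed.

Lemma pgauss1_bounded p m k :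
  exists2 M : R, 0 <= M & forall t, (1 + `|t|) ^+ k * `|pgauss1 p m t| <= M.
Proof.
pose C := \sum_(i < size p) `|p`_i|.
have C0 : 0 <= C by apply: sumr_ge0.
have pk : 0 <= normal_peak 1 :> R := normal_peak_ge0 1.
pose j := (k + size p)%N.
exists ((1 + `|m|) ^+ k * C * normal_peak 1 * (j`!%:R * expR (3 / 2))).
  by rewrite !mulr_ge0 ?exprn_ge0 ?addr_ge0// expR_ge0.
move=> t; set y := t - m.
have y0 : 0 <= `|y| by [].
have z0 : 0 <= 1 + `|y| by rewrite addr_ge0.
rewrite /pgauss1 normrM -/y [X in _ * (_ * X)]ger0_norm ?normal_pdf_ge0//.
rewrite normal_pdfE// /normal_fun -/y expr1n.
have h1 : (1 + `|t|) ^+ k <= (1 + `|m|) ^+ k * (1 + `|y|) ^+ k.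
  rewrite -exprMn lerXn2r ?nnegrE ?mulr_ge0 ?addr_ge0//.
  have -> : t = m + y by rewrite /y addrC subrK.
  rewrite mulrDl mul1r mulrDr mulr1.
  have := ler_normD m y; have : 0 <= `|m| * `|y| by rewrite mulr_ge0.
  lra.
have h2 := horner_le_pow p y.
(* The power is at most [j!] times [exp (1 + |y|)], and [1 + |y| - y^2 / 2] has maximum [3 / 2],
   attained at [|y| = 1]. *)
have h3 : (1 + `|y|) ^+ j * expR (- y ^+ 2 / (1 *+ 2)) <= j`!%:R * expR (3 / 2).
  apply: (@le_trans _ _ (j`!%:R * expR (1 + `|y|) * expR (- y ^+ 2 / (1 *+ 2)))).
    by rewrite ler_wpM2r ?expR_ge0// expR_ge_pow.
  rewrite -mulrA -expRD ler_wpM2l// ler_expR.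
  have := sqr_ge0 (`|y| - 1); rewrite -[y ^+ 2]real_normK ?num_real//.
  set u := `|y|; move=> h; have : 0 <= u ^+ 2 - u *+ 2 + 1 by rewrite (le_trans h)// sqrrB1.
  have -> : - u ^+ 2 / (1 *+ 2) = - (u ^+ 2 / 2) by rewrite mulNr.
  lra.
apply: (@le_trans _ _ ((1 + `|m|) ^+ k * (1 + `|y|) ^+ k *
    (C * (1 + `|y|) ^+ size p * (normal_peak 1 * expR (- y ^+ 2 / (1 *+ 2)))))).
  have e0 : 0 <= normal_peak 1 * expR (- y ^+ 2 / (1 *+ 2)) by rewrite mulr_ge0// expR_ge0.
  apply: ler_pM => //; first by rewrite mulr_ge0.
  exact: ler_wpM2r.
rewrite [leLHS](_ : _ = (1 + `|m|) ^+ k * C * normal_peak 1 *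
   ((1 + `|y|) ^+ j * expR (- y ^+ 2 / (1 *+ 2)))); last by rewrite /j exprD; ring.
by rewrite ler_wpM2l// !mulr_ge0// exprn_ge0// addr_ge0.
Qed.

Definition pgaussn P b x : R := \prod_(i < n) pgauss1 (P i) (tnth b i) (tnth x i).

Definition dpoly (i : 'I_n) P : 'I_n -> {poly R} :=
  fun j => if j == i then (P i)^`() - 'X * P i else P j.

Lemma tnth_of_rV (v : 'rV[R]_n) i : tnth (of_rV v) i = v ord0 i.
Proof. by rewrite tnth_mktuple. Qed.

Lemma of_rVK (x : n.-tuple R) : of_rV (to_rV x) = x.
Proof. by apply: eq_from_tnth => i; rewrite tnth_of_rV mxE. Qed.

(** Along the [i]-th axis the product is a constant [c] times its [i]-th factor; the two difference
    quotients are literally equal, so the one-variable derivative transfers. *)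
Lemma is_derive_pgaussn P b i (v : 'rV[R]_n) :
  is_derive v (delta_mx ord0 i) (pgaussn P b \o @of_rV R n) (pgaussn (dpoly i P) b (of_rV v)).
Proof.
pose c := \prod_(j < n | j != i) pgauss1 (P j) (tnth b j) (v ord0 j).
pose g := c \*: pgauss1 (P i) (tnth b i).
have fg (h : R) : (pgaussn P b \o @of_rV R n) (h *: delta_mx ord0 i + v) = g (h + v ord0 i).
  rewrite /pgaussn /= (bigD1 i)//= tnth_of_rV !mxE !eqxx mulr1 mulrC; congr (_ * _).
  apply: eq_bigr => j ji; rewrite tnth_of_rV !mxE eqxx eq_sym.
  by rewrite eq_sym (negbTE ji) mulr0 add0r.
have f0 : (pgaussn P b \o @of_rV R n) v = g (v ord0 i).
  by have := fg 0; rewrite scale0r !add0r.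
have E : (fun h : R => h^-1 *: (((pgaussn P b \o @of_rV R n) \o shift v) (h *: delta_mx ord0 i)
    - (pgaussn P b \o @of_rV R n) v)) =
  (fun h : R => h^-1 *: ((g \o shift (v ord0 i)) (h *: (1 : R)) - g (v ord0 i))).
  apply/funext => h; congr (_ *: _); rewrite f0; congr (_ - _).
  by rewrite [LHS]fg /= /GRing.scale /= mulr1.
have dg : is_derive (v ord0 i) (1 : R) g (c * pgauss1 ((P i)^`() - 'X * P i) (tnth b i) (v ord0 i)).
  exact: is_deriveZ (is_derive_pgauss1 (P i) (tnth b i) (v ord0 i)).
have D : c * pgauss1 ((P i)^`() - 'X * P i) (tnth b i) (v ord0 i) =
   pgaussn (dpoly i P) b (of_rV v).
  rewrite /pgaussn (bigD1 i)//= /dpoly eqxx tnth_of_rV mulrC; congr (_ * _).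
  by apply: eq_bigr => j ji; rewrite (negbTE ji) tnth_of_rV.
rewrite -D; case: dg => dg1 dg2; apply: DeriveDef.
  by rewrite /derivable E.
by rewrite /derive E.
Qed.

Lemma partial_pgaussn P b i : partial i (pgaussn P b) = pgaussn (dpoly i P) b.
Proof.
apply/funext => x; rewrite /partial.
by case: (is_derive_pgaussn P b i (to_rV x)) => _ ->; rewrite of_rVK.
Qed.

Lemma ipartial_pgaussn s P b : exists Q, ipartial s (pgaussn P b) = pgaussn Q b.
Proof.
elim: s => [|i s [Q IH]]; first by exists P.
by exists (dpoly i Q); rewrite /= IH partial_pgaussn.
Qed.

Lemma continuous_pgaussn P b : continuous (pgaussn P b \o @of_rV R n).
Proof.
rewrite (_ : _ \o _ = fun v : 'rV[R]_n =>
    \prod_(i <- index_enum 'I_n) pgauss1 (P i) (tnth b i) (v ord0 i)); last first.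
  by apply/funext => v; apply: eq_bigr => i _; rewrite tnth_of_rV.
elim: (index_enum _) => [|i r IH] v.
  under eq_fun do rewrite big_nil; exact: cst_continuous.
under eq_fun do rewrite big_cons.
have c0 : {for v, continuous (fun v : 'rV[R]_n => v ord0 i)} by exact: coord_continuous.
have c1 : {for v ord0 i, continuous (pgauss1 (P i) (tnth b i))}.
  apply/differentiable_continuous/derivable1_diffP.
  by case: (is_derive_pgauss1 (P i) (tnth b i) (v ord0 i)).
exact: (continuousM (continuous_comp c0 c1) (IH v)).
Qed.

Lemma smooth_pgaussn P b : smooth (pgaussn P b).
Proof.
move=> s; have [Q ->] := ipartial_pgaussn s P b; split.
  exact: continuous_pgaussn.
by move=> i v; case: (is_derive_pgaussn Q b i v).
Qed.

(** The Euclidean norm is below the sum of the absolute coordinates. The product form distributes a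
    power of the norm over the factors of [pgaussn], each controlled by [pgauss1_bounded]. *)
Lemma enorm_le_prod x : 1 + enorm x <= \prod_(i < n) (1 + `|tnth x i|).
Proof.
apply: (@le_trans _ _ (1 + \sum_(i < n) `|tnth x i|)).
  rewrite lerD2l /enorm -[leRHS]ger0_norm ?sumr_ge0// -sqrtr_sqr ler_wsqrtr// /dot.
  elim: (index_enum _) => [|i r IH]; first by rewrite !big_nil expr0n.
  rewrite !big_cons sqrrD (real_normK (num_real _)) -expr2 -addrA lerD2l.
  by rewrite (le_trans IH)// lerDr mulrn_wge0// mulr_ge0// sumr_ge0.
elim: (index_enum _) => [|i r IH]; first by rewrite !big_nil addr0.
rewrite !big_cons mulrDl mul1r.
have : `|tnth x i| * 1 <= `|tnth x i| * \prod_(j <- r) (1 + `|tnth x j|).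
  rewrite ler_wpM2l// (le_trans _ IH)// lerDl sumr_ge0//.
move: IH; lra.
Qed.

Lemma rdecreasing_pgaussn P b : rdecreasing (pgaussn P b).
Proof.
move=> k s; have [Q ->] := ipartial_pgaussn s P b.
have /choice[M HM] (i : 'I_n) : exists M : R, 0 <= M /\ forall t, (1 + `|t|) ^+ k * `|pgauss1 (Q i) (tnth b i) t| <= M.
  by have [M M0 H] := pgauss1_bounded (Q i) (tnth b i) k; exists M.
exists (\prod_(i < n) M i) => x.
apply: (@le_trans _ _ (\prod_(i < n) ((1 + `|tnth x i|) ^+ k * `|pgauss1 (Q i) (tnth b i) (tnth x i)|))).
  rewrite big_split /= /pgaussn normr_prod ler_wpM2r ?prodr_ge0// prodrXl.
  by rewrite lerXn2r ?nnegrE ?enorm_le_prod// ?addr_ge0 ?sqrtr_ge0// prodr_ge0// => i _; rewrite addr_ge0.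
apply: ler_prod => i _; rewrite (HM i).2 andbT mulr_ge0// exprn_ge0// addr_ge0//.
Qed.

Lemma ipartial0 (s : seq 'I_n) : ipartial s (fun _ : n.-tuple R => 0 : R) = fun=> 0.
Proof.
elim: s => //= i s ->; apply/funext => x; rewrite /partial.
exact: derive_cst.
Qed.

Lemma gaussnE_pgaussn b : gaussn b 1 = pgaussn (fun=> 1) b.
Proof.
apply/funext => x; apply: eq_bigr => i _.
by rewrite /pgauss1 hornerC mul1r.
Qed.

Lemma schwartz_gaussn b : schwartz (fun x => (gaussn b 1 x)%:C%C).
Proof.
have reE : re_part (fun x => (gaussn b 1 x)%:C%C) = pgaussn (fun=> 1) b by rewrite -gaussnE_pgaussn.
have imE : im_part (fun x => (gaussn b 1 x)%:C%C) = fun=> 0 by [].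
split; rewrite ?reE ?imE.
- exact: smooth_pgaussn.
- exact: rdecreasing_pgaussn.
- by move=> s; rewrite ipartial0; split=> [|i v]; [exact: cst_continuous|exact: derivable_cst].
- by move=> k s; exists 0 => x; rewrite ipartial0 normr0 mulr0.
Qed.

End gauss_schwartz.

(** * Uniqueness of the Fourier transform *)

Section density.
Context d (T : measurableType d) (R : realType) (mu : {measure set T -> \bar R}).
Variables (f : T -> R).
Hypotheses (f0 : forall x, 0 <= f x) (fi : mu.-integrable setT (EFin \o f)).

Definition density (A : set T) : \bar R := (\int[mu]_(x in A) (f x)%:E)%E.

Let density0 : density set0 = 0%E.
Proof. by rewrite /density integral_set0. Qed.

Let density_ge0 A : (0 <= density A)%E.
Proof. by apply: integral_ge0 => x _; rewrite lee_fin. Qed.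

Let density_sigma_additive : semi_sigma_additive density.
Proof.
move=> /= A mA tA mUA.
rewrite /density integral_bigcup//=; last exact: (integrableS _ _ (subsetT _)).
by apply: is_cvg_ereal_nneg_natsum_cond => k _ _; apply: integral_ge0 => x _; rewrite lee_fin.
Qed.

HB.instance Definition _ := isMeasure.Build _ _ _
  density density0 density_ge0 density_sigma_additive.

Definition density_measure : {measure set T -> \bar R} := density.

End density.

(** * Orthants, smoothed indicators and the uniqueness theorem *)

Section orthants.
Context {R : realType} {n : nat}.
Local Notation N := (leb R n).
Implicit Types (b z eta : n.-tuple R) (p : n.-tuple R -> R).

Definition orthant b : set (n.-tuple R) := [set z | forall i, tnth b i < tnth z i].

Lemma measurable_orthant b : measurable (orthant b).
Proof.
have -> : orthant b = \bigcap_(i in [set: 'I_n]) [set z | tnth b i < tnth z i].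
  by apply/seteqP; split => [z h i _|z h i]; [exact: h|exact: (h i)].
apply: fin_bigcap_measurable => // i _.
have -> : [set z : n.-tuple R | tnth b i < tnth z i] =
    setT `&` (fun z => tnth z i) @^-1` `]tnth b i, +oo[.
  by rewrite setTI; apply/seteqP; split => z /=; rewrite in_itv/= andbT.
by have := @measurable_tnthR R n i; apply => //; exact: measurable_itv.
Qed.

Lemma orthantI b b' : orthant b `&` orthant b' =
  orthant [tuple Num.max (tnth b i) (tnth b' i) | i < n].
Proof.
apply/seteqP; split => [z [h h'] i|z h].
  by rewrite tnth_mktuple gt_max h h'.
by split => i; have := h i; rewrite tnth_mktuple gt_max => /andP[].
Qed.

Lemma bigcup_orthant : \bigcup_k orthant [tuple - (k : nat)%:R | i < n] = setT.
Proof.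
apply/seteqP; split => // z _.
exists (\max_(i < n) Num.bound `|tnth z i|) => // i.
rewrite tnth_mktuple ltrNl.
have h : `|tnth z i| < (Num.bound `|tnth z i|)%:R by exact: archi_boundP.
apply: (@lt_le_trans _ _ (Num.bound `|tnth z i|)%:R).
  by apply: le_lt_trans h; rewrite -normrN ler_norm.
by rewrite ler_nat (leq_bigmax i).
Qed.

(** A coordinate half-space is the countable union of the orthants whose other corner coordinates
    are [- k]. *)
Lemma measurable_tuple_orthant :
  @measurable _ (n.-tuple R) = <<s range orthant >>.
Proof.
apply/seteqP; split; last first.
  apply: smallest_sub; first exact: sigma_algebra_measurable.
  by move=> _ [b _ <-]; exact: measurable_orthant.
apply: smallest_sub; first exact: smallest_sigma_algebra.
rewrite -bigcup_seq => _ [i _ [B mB <-]].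
pose T' := g_sigma_algebraType (range orthant).
have mt : measurable_fun [set: T'] (fun z : T' => tnth (z : n.-tuple R) i : measurableTypeR R).
  apply: (measurability _ (RGenOInfty.measurableE R)) => _ [_ [x ->] <-]; rewrite setTI.
  have -> : (fun z : T' => tnth (z : n.-tuple R) i : measurableTypeR R) @^-1` `]x, +oo[ =
      \bigcup_k orthant [tuple (if j == i then x else - (k : nat)%:R) | j < n].
    apply/seteqP; split => z /=.
      rewrite in_itv/= andbT => xz.
      have [k _ hk] : (\bigcup_k orthant [tuple - (k : nat)%:R | i < n]) z.
        by rewrite bigcup_orthant.
      exists k => // j; rewrite tnth_mktuple; case: eqP => [->//|_].
      by have := hk j; rewrite tnth_mktuple.
    move=> [k _ /(_ i)]; rewrite tnth_mktuple eqxx in_itv/= andbT//.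
  apply: bigcupT_measurable => k; apply: sub_sigma_algebra.
  by exists [tuple (if j == i then x else - (k : nat)%:R) | j < n].
exact: (mt measurableT B mB).
Qed.

(** Compare with the Gaussian of twice the width: the peaks differ by [2 ^+ n] and the exponents by
    [1 / 2 - 1 / 8 = 3 / 8] of the squared distance over [s ^+ 2]. *)
Lemma gauss_tail (A : set (n.-tuple R)) eta (s delta : R) : measurable A -> 0 < s ->
  0 <= delta -> (forall z, A z -> delta ^+ 2 <= \sum_(i < n) (tnth z i - tnth eta i) ^+ 2) ->
  (\int[N]_(z in A) (gaussn eta s z)%:E <= (2 ^+ n * expR (- (3 / 8 * (delta / s) ^+ 2)))%:E)%E.
Proof.
move=> mA s0 d0 HA.
set e := expR _.
have s20 : 2 * s != 0 by rewrite mulf_neq0// gt_eqF.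
have pk : normal_peak s = 2 * normal_peak (2 * s).
  rewrite /normal_peak.
  have -> : (2 * s) ^+ 2 * pi *+ 2 = 2 ^+ 2 * (s ^+ 2 * pi *+ 2) by ring.
  rewrite sqrtrM ?sqr_ge0// sqrtr_sqr ger0_norm//.
  by rewrite invfM mulrA divff// mul1r.
apply: (@le_trans _ _ (\int[N]_(z in A) ((2 ^+ n * e) * gaussn eta (2 * s) z)%:E)%E).
  apply: ge0_le_integral => //.
  - by move=> z _; rewrite lee_fin gaussn_ge0.
  - by apply/measurable_EFinP; apply: measurable_funTS; exact: measurable_gaussn.
  - by apply/measurable_EFinP; apply: measurable_funTS; apply: measurable_funM => //; exact: measurable_gaussn.
  have s0' : s != 0 by rewrite gt_eqF.
  move=> z Az; rewrite lee_fin !gaussnE// pk exprMn.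
  have := HA z Az; set S := \sum_(i < n) _ => h.
  rewrite [leRHS](_ : _ = 2 ^+ n * normal_peak (2 * s) ^+ n *
    (e * expR (- S / ((2 * s) ^+ 2 *+ 2)))); last by ring.
  rewrite ler_wpM2l ?mulr_ge0 ?exprn_ge0 ?normal_peak_ge0// /e -expRD ler_expR.
  have s2 : 0 < s ^+ 2 by rewrite exprn_gt0.
  have -> : - S / (s ^+ 2 *+ 2) = - (3 / 8 * (S / s ^+ 2)) - S / ((2 * s) ^+ 2 *+ 2).
    by field; rewrite gt_eqF.
  rewrite mulNr lerD2r lerN2 ler_pM2l; last by rewrite divr_gt0.
  by rewrite exprMn exprVn ler_pM2r ?invr_gt0.
under eq_integral do rewrite EFinM.
rewrite ge0_integralZl//; last 3 first.
- by apply/measurable_EFinP; apply: measurable_funTS; exact: measurable_gaussn.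
- by move=> z _; rewrite lee_fin gaussn_ge0.
- by rewrite lee_fin mulr_ge0 ?exprn_ge0// expR_ge0.
rewrite -[leRHS]mule1 lee_wpmul2l ?lee_fin ?mulr_ge0 ?exprn_ge0 ?expR_ge0//.
rewrite -(integral_gaussn eta (2 * s)); apply: ge0_subset_integral => //.
- by apply/measurable_EFinP; exact: measurable_gaussn.
- by move=> z _; rewrite lee_fin gaussn_ge0.
Qed.

(* The width of the Gaussian is the square of the shift, so that the smoothed
   indicators converge everywhere, also on the boundary of the orthant. *)
Definition shifted_orthant b (k : nat) : set (n.-tuple R) :=
  orthant [tuple tnth b i + k.+1%:R^-1 | i < n].

Definition smoothed b (k : nat) eta : R :=
  \int[N]_(z in shifted_orthant b k) gaussn eta (k.+1%:R^-1 ^+ 2) z.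

(** The bound of [gauss_tail] for distance [k.+1%:R^-1] and width [k.+1%:R^-1 ^+ 2], whose ratio is
    [k.+1%:R]. *)
Let tau (k : nat) : R := 2 ^+ n * expR (- (3 / 8 * k.+1%:R ^+ 2)).

Lemma integrable_gaussnW (A : set (n.-tuple R)) eta s : measurable A ->
  N.-integrable A (EFin \o gaussn eta s).
Proof. by move=> mA; apply: (integrableS _ _ (subsetT _)) => //; exact: integrable_gaussn. Qed.

Lemma Rintegral_gauss_tail (A : set (n.-tuple R)) eta (k : nat) : measurable A ->
  (forall z, A z -> exists i, k.+1%:R^-1 <= `|tnth z i - tnth eta i|) ->
  \int[N]_(z in A) gaussn eta (k.+1%:R^-1 ^+ 2) z <= tau k.
Proof.
move=> mA HA; set d := k.+1%:R^-1.
have d0 : 0 < d by rewrite invr_gt0.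
have h : (\int[N]_(z in A) (gaussn eta (d ^+ 2) z)%:E <= (tau k)%:E)%E.
  have -> : tau k = 2 ^+ n * expR (- (3 / 8 * (d / d ^+ 2) ^+ 2)).
    rewrite /tau; congr (_ * expR (- (_ * _ ^+ 2))).
    by rewrite expr2 invfM mulrA divff ?gt_eqF// mul1r /d invrK.
  apply: gauss_tail => //; [by rewrite exprn_gt0|exact: ltW|].
  move=> z Az; have [i hi] := HA z Az.
  apply: (@le_trans _ _ ((tnth z i - tnth eta i) ^+ 2)).
    by rewrite -[leRHS]real_normK ?num_real// lerXn2r ?nnegrE// ltW.
  by rewrite (bigD1 i)//= lerDl; apply: sumr_ge0 => j _; exact: sqr_ge0.
rewrite -lee_fin (le_trans _ h)// /Rintegral fineK//.
by apply: integrable_fin_num => //; exact: integrable_gaussnW.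
Qed.

Lemma smoothed_cvg b eta : smoothed b k eta @[k --> \oo] --> (\1_(orthant b) eta : R).
Proof.
have mS k : measurable (shifted_orthant b k) by exact: measurable_orthant.
have tau0 : tau k @[k --> \oo] --> 0.
  have c : (2 ^+ n * (8 / 3)) * k.+1%:R^-1 @[k --> \oo] --> (0 : R).
    by rewrite -(mulr0 (2 ^+ n * (8 / 3))); apply: cvgMl_tmp; exact: cvg_harmonic.
  apply: (squeeze_cvgr _ (cvg_cst 0) c); apply: nearW => k.
  apply/andP; split; first by rewrite mulr_ge0 ?exprn_ge0 ?expR_ge0.
  rewrite -mulrA ler_wpM2l ?exprn_ge0//.
  rewrite expRN -[leRHS]invrK lef_pV2 ?posrE ?expR_gt0// ?invr_gt0 ?mulr_gt0//.
  rewrite invfM invrK invf_div.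
  have := expR_ge1Dx (3 / 8 * k.+1%:R ^+ 2 : R); apply: le_trans.
  have : 1 <= k.+1%:R :> R by rewrite ler1n.
  set a : R := k.+1%:R; nra.
suff H : \forall k \near \oo, `|smoothed b k eta - \1_(orthant b) eta| <= tau k.
  apply/cvgrPdist_le => e e0.
  have /cvgr0Pnorm_le/(_ e e0) t := tau0.
  near=> k; rewrite distrC; apply: (@le_trans _ _ (tau k)); first by near: k.
  by rewrite (le_trans (ler_norm _))//; near: k.
have [eb|eb] := pselect (orthant b eta).
  (* The margin is twice [k.+1%:R^-1]: once for the shift of the orthant, once for the distance to
     its complement. *)
  have : \forall k \near \oo, forall i, tnth b i + 2 * (k : nat).+1%:R^-1 <= tnth eta i.
    pose m := \max_(i < n) Num.bound (2 / (tnth eta i - tnth b i)).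
    exists m => // k /= mk i.
    have d0 : 0 < tnth eta i - tnth b i by rewrite subr_gt0 eb.
    rewrite -lerBrDl ler_pdivrMr ?ltr0n// -ler_pdivrMl// mulrC.
    have h : 2 / (tnth eta i - tnth b i) < (Num.bound (2 / (tnth eta i - tnth b i)))%:R.
      by apply: archi_boundP; rewrite divr_ge0// ltW.
    rewrite (le_trans (ltW h))// ler_nat (leq_trans _ (leqnSn k))// (leq_trans _ mk)//.
    exact: (@leq_bigmax _ (fun i => Num.bound (2 / (tnth eta i - tnth b i))) i).
  apply: filterS => k hk.
  have -> : smoothed b k eta - \1_(orthant b) eta =
    - \int[N]_(z in ~` shifted_orthant b k) gaussn eta (k.+1%:R^-1 ^+ 2) z.
    set I := \int[N]_(z in ~` _) _.
    have U : smoothed b k eta + I = 1.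
      rewrite /smoothed -Rintegral_setU//.
      + by rewrite setUv /Rintegral integral_gaussn.
      + exact: measurableC.
      + by apply: integrable_gaussnW; apply: measurableU => //; exact: measurableC.
      + by rewrite disj_set2E setICr.
    by rewrite indicE mem_set//=; apply/eqP; rewrite subr_eq addrC -U addrK.
  rewrite normrN ger0_norm; last by apply: Rintegral_ge0 => z _; exact: gaussn_ge0.
  apply: Rintegral_gauss_tail; first exact: measurableC.
  move=> z /existsNP[i /negP]; rewrite -leNgt tnth_mktuple => hz; exists i.
  rewrite distrC (le_trans _ (ler_norm _))// lerBrDl (le_trans _ (hk i))//.
  by rewrite mulr_natl mulr2n addrA lerD2r.
move/existsNP : (eb) => [i /negP]; rewrite -leNgt => hi.
apply: nearW => k; rewrite indicE memNset// subr0.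
rewrite ger0_norm; last by apply: Rintegral_ge0 => z _; exact: gaussn_ge0.
apply: Rintegral_gauss_tail => // z hz; exists i.
have := hz i; rewrite tnth_mktuple => hz'.
rewrite (le_trans _ (ler_norm _))// lerBrDl (le_trans _ (ltW hz'))//.
by rewrite lerD2r.
Unshelve. all: by end_near. Qed.

Lemma measurable_smoothed b k : measurable_fun setT (smoothed b k).
Proof.
have s0 : k.+1%:R^-1 ^+ 2 != 0 :> R by rewrite expf_neq0// invr_eq0 pnatr_eq0.
have mF : measurable_fun setT (fun z : n.-tuple R * n.-tuple R =>
    (\1_(shifted_orthant b k) z.2 * gaussn z.1 (k.+1%:R^-1 ^+ 2) z.2)%:E).
  apply/measurable_EFinP; apply: measurable_funM; last exact: measurable_gaussn2.
  apply: (measurableT_comp _ measurable_snd).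
  by apply: measurable_indic; exact: measurable_orthant.
have F0 (z : n.-tuple R * n.-tuple R) : (0 <= (\1_(shifted_orthant b k) z.2 * gaussn z.1 (k.+1%:R^-1 ^+ 2) z.2)%:E)%E.
  by rewrite lee_fin mulr_ge0// gaussn_ge0.
have := @measurable_fun_fubini_tonelli_F _ _ _ _ R N _ mF F0.
move/(measurableT_comp (fine_measurable measurableT)); congr measurable_fun.
apply/funext => eta; rewrite /smoothed Rintegral_mkcond /Rintegral /fubini_F /=; congr fine.
apply: eq_integral => z _; rewrite patchE indicE; congr EFin.
by case: (z \in _); rewrite ?mul1r ?mul0r.
Qed.

Lemma smoothed_le1 b k eta : `|smoothed b k eta| <= 1.
Proof.
rewrite ger0_norm; last by apply: Rintegral_ge0 => z _; exact: gaussn_ge0.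
have mS : measurable (shifted_orthant b k) by exact: measurable_orthant.
rewrite -lee_fin /smoothed /Rintegral fineK; last first.
  by apply: integrable_fin_num => //; exact: integrable_gaussnW.
rewrite -(integral_gaussn eta (k.+1%:R^-1 ^+ 2)); apply: ge0_subset_integral => //.
- by apply/measurable_EFinP; exact: measurable_gaussn.
- by move=> z _; rewrite lee_fin gaussn_ge0.
Qed.

Section uniqueness.
Variables (p : n.-tuple R -> R).
Hypotheses (ip : N.-integrable setT (EFin \o p)) (p0 : forall c x, trig p c x = 0).

Let mp : measurable_fun setT p.
Proof. by apply/measurable_EFinP; exact: measurable_int ip. Qed.

Lemma integrable_mul_gaussn z s : s != 0 ->
  N.-integrable setT (EFin \o (fun eta => gaussn z s eta * p eta)).
Proof.
move=> s0; apply: (@integrable_bounded_mul _ _ _ _ _ (normal_peak s ^+ n)) => //.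
  exact: measurable_gaussn.
by move=> y; rewrite ger0_norm ?gaussn_ge0// gaussn_le.
Qed.

(** By [trig_swap], a cosine test function gives [0] for the Gaussian at [z] plus [cos (2 c)] times
    the one at [- z], both integrated against [p]. The phases [0] and [pi / 2] give the sum and the
    difference, which isolates the first. *)
Lemma integral_mul_gaussn z s : 0 < s -> \int[N]_eta (gaussn z s eta * p eta) = 0.
Proof.
move=> s0; have s0' : s != 0 by rewrite gt_eqF.
have si0 : s^-1 != 0 by rewrite invr_eq0.
have K c : \int[N]_eta (p eta * (normal_peak s ^- n * (2^-1 * (gaussn z s eta +
    cos (c + c) * gaussn [tuple - tnth z i | i < n] s eta)))) = 0.
  have mh : measurable_fun setT (fun x => cos (dot z x + c)) by exact: measurable_cos_dotr.
  have := trig_swap c s^-1 mh (fun x => normr_cos_le1 _) ip.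
  under eq_Rintegral do rewrite p0 mulr0.
  rewrite Rintegral_cst// mul0r => h; rewrite [RHS]h.
  apply: eq_Rintegral => eta _.
  have := gauss_cos_cosE c c eta z si0; rewrite invrK subrr cos0 mul1r => <-.
  by congr (_ * _); apply: eq_Rintegral => x _; rewrite mulrAC.
have pk : normal_peak s ^- n != 0 by rewrite invr_eq0 expf_neq0// gt_eqF// normal_peak_gt0.
pose z' : n.-tuple R := [tuple - tnth z i | i < n].
pose A c (eta : n.-tuple R) := normal_peak s ^- n * 2^-1 * (gaussn z s eta * p eta) +
  cos (c + c) * (normal_peak s ^- n * 2^-1 * (gaussn z' s eta * p eta)).
have K' c : normal_peak s ^- n * 2^-1 * \int[N]_eta (gaussn z s eta * p eta) +
  cos (c + c) * (normal_peak s ^- n * 2^-1 * \int[N]_eta (gaussn z' s eta * p eta)) = 0.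
  have i1 := integrable_mul_gaussn z s0'; have i2 := integrable_mul_gaussn z' s0'.
  have j1 := integrableZl measurableT (normal_peak s ^- n * 2^-1) i1.
  have j2 := integrableZl measurableT (normal_peak s ^- n * 2^-1) i2.
  have j3 := integrableZl measurableT (cos (c + c)) j2.
  rewrite -!RintegralZl// -RintegralD// -[RHS](K c).
  by apply: eq_Rintegral => eta _; rewrite /z'; ring.
have k1 := K' 0; have k2 := K' (pi / 2).
have pp : pi / 2 + pi / 2 = pi :> R by field.
move: k1 k2; rewrite addr0 cos0 pp cospi.
set a := \int[N]_eta _; set b := \int[N]_eta _ => k1 k2.
have : normal_peak s ^- n * 2^-1 * a = 0 by lra.
by move/eqP; rewrite mulf_eq0 mulf_eq0 (negbTE pk) invr_eq0 pnatr_eq0 /= => /eqP.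
Qed.

(** The Gaussian is symmetric in its centre and its variable, so after Fubini the inner integral is
    one of [integral_mul_gaussn]. *)
Lemma integral_mul_smoothed b k : \int[N]_eta (p eta * smoothed b k eta) = 0.
Proof.
set s : R := k.+1%:R^-1 ^+ 2.
have s0 : 0 < s by rewrite exprn_gt0// invr_gt0.
have s0' : s != 0 by rewrite gt_eqF.
have mS : measurable (shifted_orthant b k) by exact: measurable_orthant.
pose f (w : n.-tuple R * n.-tuple R) := p w.1 * (\1_(shifted_orthant b k) w.2 * gaussn w.1 s w.2).
have mf : measurable_fun setT f.
  apply: measurable_funM; first exact: (measurableT_comp mp measurable_fst).
  apply: measurable_funM; last exact: measurable_gaussn2.
  by apply: (measurableT_comp _ measurable_snd); exact: measurable_indic.
have i1 eta : N.-integrable setT (EFin \o (fun z => \1_(shifted_orthant b k) z * gaussn eta s z)).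
  apply: (@integrable_bounded_mul _ _ _ _ _ 1) => //.
  - by move=> y; rewrite indicE; case: (y \in _); rewrite ?normr1 ?normr0.
  - exact: integrable_gaussn.
have E1 eta : \int[N]_z f (eta, z) = p eta * smoothed b k eta.
  transitivity (\int[N]_z (p eta * (\1_(shifted_orthant b k) z * gaussn eta s z))) => //.
  rewrite (RintegralZl (p eta) measurableT (i1 eta)).
  congr (_ * _); rewrite /smoothed [RHS]Rintegral_mkcond; apply: eq_Rintegral => z _.
  by rewrite patchE indicE; case: (z \in _); rewrite ?mul1r ?mul0r.
have E2 z : \int[N]_eta f (eta, z) = 0.
  transitivity (\int[N]_eta (\1_(shifted_orthant b k) z * (gaussn z s eta * p eta))).
    by apply: eq_Rintegral => eta _; rewrite /f /= gaussnC//; ring.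
  rewrite RintegralZl//; last exact: integrable_mul_gaussn.
  by rewrite integral_mul_gaussn// mulr0.
transitivity (\int[N]_eta \int[N]_z f (eta, z)).
  by apply: eq_Rintegral => eta _; rewrite E1.
rewrite Fubini_R.
- by under eq_Rintegral do rewrite E2; rewrite Rintegral_cst// mul0r.
- apply/integrable12ltyP; first exact/measurable_EFinP.
  apply: (@le_lt_trans _ _ (\int[N]_eta `|p eta|%:E)%E); last first.
    by have /integrableP[_] := ip.
  apply: ge0_le_integral => //.
  + by move=> x _; exact: integral_ge0.
  + have mF : measurable_fun setT (fun w => (`|f w|)%:E).
      by apply/measurable_EFinP; exact: measurableT_comp.
    exact: (@measurable_fun_fubini_tonelli_F _ _ _ _ R N _ mF (fun w => normr_ge0 _)).
  + by apply/measurable_EFinP; exact: measurableT_comp.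
  move=> eta _.
  apply: (@le_trans _ _ (\int[N]_z (`|p eta|%:E * (gaussn eta s z)%:E))%E).
    apply: ge0_le_integral => //.
    * apply/measurable_EFinP; apply: measurableT_comp => //.
      exact: (measurableT_comp mf (pair1_measurable eta)).
    * apply/measurable_EFinP; apply: measurable_funM => //; exact: measurable_gaussn.
    * move=> z _; rewrite -EFinM lee_fin /f normrM ler_wpM2l// normrM.
      rewrite [X in _ * X]ger0_norm ?gaussn_ge0// ler_piMl ?gaussn_ge0//.
      by rewrite indicE; case: (z \in _); rewrite ?normr1 ?normr0.
  rewrite ge0_integralZl//.
  * by rewrite integral_gaussn mule1.
  * by apply/measurable_EFinP; exact: measurable_gaussn.
  * by move=> z _; rewrite lee_fin gaussn_ge0.
- move=> eta; have := integrableZl measurableT (p eta) (i1 eta).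
  by congr (_.-integrable _ _).
- move=> z; have := integrableZl measurableT (\1_(shifted_orthant b k) z : R) (integrable_mul_gaussn z s0').
  by congr (_.-integrable _ _); apply/funext => eta /=; rewrite -EFinM /f /= gaussnC//; congr EFin; ring.
Qed.

Lemma integral_orthant b : \int[N]_(eta in orthant b) p eta = 0.
Proof.
have mO := measurable_orthant b.
have h : (\int[N]_eta (p eta * smoothed b k eta)%:E @[k --> \oo] -->
    \int[N]_eta (p eta * \1_(orthant b) eta)%:E)%E.
  apply: (@dominated_cvg _ _ _ N setT measurableT _ _ (fun x => `|p x|%:E)) => //.
  - move=> k; apply/measurable_EFinP; apply: measurable_funM => //.
    exact: measurable_smoothed.
  - move=> x _; apply: cvg_EFin; first exact: nearW.
    by apply: cvgMl_tmp; exact: smoothed_cvg.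
  - exact: (integrable_norm ip).
  - by move=> k x _; rewrite lee_fin normrM ler_piMr// smoothed_le1.
have h2 : (\int[N]_eta (p eta * smoothed b k eta)%:E @[k --> \oo] --> 0)%E.
  have -> : (fun k => \int[N]_eta (p eta * smoothed b k eta)%:E)%E = (fun=> 0%E).
    apply/funext => k; have := integral_mul_smoothed b k; rewrite /Rintegral => e.
    rewrite -[LHS]fineK ?e//.
    apply: integrable_fin_num => //.
    have := @integrable_bounded_mul _ _ _ N setT 1 (smoothed b k) p measurableT
      (measurable_smoothed b k) (smoothed_le1 b k) ip.
    by congr (_.-integrable _ (_ \o _)); apply/funext => x; rewrite mulrC.
  exact: cvg_cst.
have e : (\int[N]_eta (p eta * \1_(orthant b) eta)%:E)%E = 0%E.
  exact: (cvg_unique (@ereal_hausdorff R) h h2).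
transitivity (fine (\int[N]_eta (p eta * \1_(orthant b) eta)%:E)%E); last by rewrite e.
rewrite Rintegral_mkcond /Rintegral; congr fine; apply: eq_integral => x _; rewrite patchE indicE.
by case: (x \in _); rewrite ?mulr1 ?mulr0.
Qed.

(* The densities [`|p| + p] and [`|p|] agree on orthants, which form a pi-system. *)
Lemma trig_eq0_ae : {ae N, forall x, p x = 0}.
Proof.
have ia := integrable_norm ip.
have iap : N.-integrable setT (EFin \o (fun x => `|p x| + p x)).
  by have := integrableD measurableT ia ip.
have ap0 x : 0 <= `|p x| + p x by rewrite -lerBlDr sub0r -normrN ler_norm.
pose m1 := density_measure ap0 iap.
pose m2 := density_measure (fun x => normr_ge0 (p x)) ia.
have m12 A : measurable A -> m1 A = m2 A.
  apply: (@measure_unique _ _ _ (range orthant) (fun k => orthant [tuple - (k : nat)%:R | i < n])).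
  - exact: measurable_tuple_orthant.
  - by move=> _ _ [b1 _ <-] [b2 _ <-]; rewrite orthantI; eexists.
  - by move=> i; eexists.
  - exact: bigcup_orthant.
  - move=> _ [b _ <-].
    have mO := measurable_orthant b.
    have ipO : N.-integrable (orthant b) (EFin \o p) by apply: (integrableS _ _ (subsetT _)).
    have iaO : N.-integrable (orthant b) (EFin \o (fun x => `|p x|)) by apply: (integrableS _ _ (subsetT _)).
    rewrite /m1 /m2 /density_measure /= /density.
    rewrite integralD_EFin//.
    have := integral_orthant b; rewrite /Rintegral => e.
    rewrite -[X in (_ + X)%E]fineK ?e ?adde0//.
    exact: integrable_fin_num.
  - move=> k; rewrite /m1 /density_measure /= /density.
    apply: (@le_lt_trans _ _ (\int[N]_x (`|p x| + p x)%:E)%E).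
      apply: ge0_subset_integral => //.
      - exact: measurable_orthant.
      - by have /integrableP[] := iap.
      - by move=> x _; rewrite lee_fin.
    have /integrableP[_] := iap.
    by under eq_integral do rewrite /= ger0_norm//.
have := @integral_ae_eq _ _ _ N setT measurableT (fun x => `|p x|%:E) _ iap.
have map : measurable_fun setT (fun x => `|p x|%:E).
  by apply/measurable_EFinP; exact: measurableT_comp.
move=> /(_ map (fun E _ mE => m12 E mE)).
apply: filterS => x /(_ I) /= [] /eqP.
by rewrite -subr_eq0 addrAC subrr add0r => /eqP.
Qed.

End uniqueness.

End orthants.

(** * Evolution in time *)

Section trig_holder.
Context {R : realType}.
Implicit Types x y : R.

Let lip (f df : R -> R) : (forall z : R, is_derive z (1:R) f (df z)) -> (forall z, `|df z| <= 1) ->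
  forall x y, `|f x - f y| <= `|x - y|.
Proof.
move=> fd df1.
have H x y : x < y -> `|f y - f x| <= `|y - x|.
  move=> xy.
  have cf : {within `[x, y], continuous f}.
    apply: continuous_subspaceT => z; apply/differentiable_continuous/derivable1_diffP.
    by case: (fd z).
  have [z _ ->] := MVT xy (fun z _ => fd z) cf.
  by rewrite normrM ler_piMl.
move=> x y; have [xy|yx|->] := ltgtP x y; last by rewrite subrr normr0.
  by rewrite distrC [leRHS]distrC; exact: H.
exact: H.
Qed.

Lemma normr_cosB x y : `|cos x - cos y| <= `|x - y|.
Proof.
apply: (lip (fun z => is_derive_cos z)) => z.
by rewrite normrN; exact: normr_sin_le1.
Qed.

Lemma normr_sinB x y : `|sin x - sin y| <= `|x - y|.
Proof. by apply: (lip (fun z => is_derive_sin z)) => z; exact: normr_cos_le1. Qed.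

(** Interpolation between the Lipschitz bound and the trivial bound: [e <= e ^ th] for [e <= 1], and
    [1 <= e ^ th] beyond. *)
Let holder (d e th : R) : 0 <= th -> th <= 1 -> 0 <= e -> d <= e -> d <= 2 -> d <= 2 * e `^ th.
Proof.
move=> th0 th1 e0 de d2.
have [e1|e1] := lerP e 1.
  have [e00|e00] := eqVneq e 0.
    by rewrite (le_trans de)// {1}e00 mulr_ge0// powR_ge0.
  have : e <= e `^ th by rewrite ger1_powR// lt_neqAle eq_sym e00 e0.
  have := powR_ge0 e th; lra.
rewrite (le_trans d2)// ler_peMr//.
have one : 1 `^ th = 1 :> R by rewrite powR1.
by rewrite -[leLHS]one ge0_ler_powR ?nnegrE// ltW.
Qed.

Lemma normr_cosB_powR th x y : 0 <= th -> th <= 1 ->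
  `|cos x - cos y| <= 2 * `|x - y| `^ th.
Proof.
move=> th0 th1; apply: holder => //; first exact: normr_cosB.
by rewrite (le_trans (ler_normB _ _))// lerD ?normr_cos_le1.
Qed.

Lemma normr_sinB_powR th x y : 0 <= th -> th <= 1 ->
  `|sin x - sin y| <= 2 * `|x - y| `^ th.
Proof.
move=> th0 th1; apply: holder => //; first exact: normr_sinB.
by rewrite (le_trans (ler_normB _ _))// lerD ?normr_sin_le1.
Qed.

End trig_holder.

(** * The evolved Fourier transform and its maximal function *)

Section evolution.
Context {R : realType} {n : nat}.
Local Notation N := (leb R n).
Variables (a s : R) (g1 g2 : n.-tuple R -> R).
Hypotheses (a_gt0 : 0 < a) (mg1 : measurable_fun setT g1) (mg2 : measurable_fun setT g2)
  (gW : (\int[N]_xi (bessel_weight s xi * (g1 xi ^+ 2 + g2 xi ^+ 2))%:E < +oo)%E)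
  (s_gt0 : 0 < s).
Implicit Types (t u : R) (xi x : n.-tuple R).

(* The real part of [exp (i t |xi|^a) (g1 + i g2)]. *)
Definition evol t xi : R :=
  cos (t * enorm xi `^ a) * g1 xi - sin (t * enorm xi `^ a) * g2 xi.

Lemma measurable_symbol : measurable_fun setT (fun xi : n.-tuple R => enorm xi `^ a).
Proof. exact: (measurableT_comp (measurable_powR a) measurable_enorm). Qed.

Lemma measurable_evol t : measurable_fun setT (evol t).
Proof.
apply: measurable_funB; apply: measurable_funM => //.
  apply: (measurableT_comp measurable_cos); apply: measurable_funM => //; exact: measurable_symbol.
apply: (measurableT_comp measurable_sin); apply: measurable_funM => //; exact: measurable_symbol.
Qed.

Lemma sqr_evol_le t xi : evol t xi ^+ 2 <= 2 * (g1 xi ^+ 2 + g2 xi ^+ 2).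
Proof.
rewrite /evol; have := cos2Dsin2 (t * enorm xi `^ a).
set c := cos _; set d := sin _ => cd.
have := sqr_ge0 (c * g2 xi + d * g1 xi); have := sqr_ge0 (g1 xi); have := sqr_ge0 (g2 xi).
have -> : (c * g1 xi - d * g2 xi) ^+ 2 =
  (c ^+ 2 + d ^+ 2) * (g1 xi ^+ 2 + g2 xi ^+ 2) - (c * g2 xi + d * g1 xi) ^+ 2 by ring.
rewrite cd; lra.
Qed.

Lemma enorm_ge0 xi : 0 <= enorm xi. Proof. exact: sqrtr_ge0. Qed.

(** The constant [8] is [2] from the square of a difference times the square of the Hölder constant
    [2]. *)
Lemma sqr_evolB_le th t u xi : 0 <= th -> th <= 1 ->
  (evol t xi - evol u xi) ^+ 2 <=
  8 * ((`|t - u| * enorm xi `^ a) `^ th) ^+ 2 * (g1 xi ^+ 2 + g2 xi ^+ 2).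
Proof.
move=> th0 th1; set rho := enorm xi `^ a.
have rho0 : 0 <= rho by exact: powR_ge0.
have := normr_cosB_powR (t * rho) (u * rho) th0 th1.
have := normr_sinB_powR (t * rho) (u * rho) th0 th1.
have hr : `|t * rho - u * rho| = `|t - u| * rho by rewrite -mulrBl normrM (ger0_norm rho0).
rewrite hr /evol -/rho.
set e := _ `^ th; have e0 : 0 <= e by exact: powR_ge0.
set ds := sin _ - sin _; set dc := cos _ - cos _ => hs hc.
have -> : cos (t * rho) * g1 xi - sin (t * rho) * g2 xi - (cos (u * rho) * g1 xi - sin (u * rho) * g2 xi)
  = dc * g1 xi - ds * g2 xi by rewrite /dc /ds; ring.
have sq (d : R) : `|d| <= 2 * e -> d ^+ 2 <= 4 * e ^+ 2.
  move=> h; rewrite -(real_normK (num_real d)).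
  have -> : 4 * e ^+ 2 = (2 * e) ^+ 2 by ring.
  by rewrite lerXn2r ?nnegrE ?mulr_ge0.
have {}hs := sq _ hs; have {}hc := sq _ hc.
have h1 : dc ^+ 2 * g1 xi ^+ 2 <= 4 * e ^+ 2 * g1 xi ^+ 2 by rewrite ler_wpM2r// sqr_ge0.
have h2 : ds ^+ 2 * g2 xi ^+ 2 <= 4 * e ^+ 2 * g2 xi ^+ 2 by rewrite ler_wpM2r// sqr_ge0.
have := sqr_ge0 (dc * g1 xi + ds * g2 xi).
have -> : (dc * g1 xi - ds * g2 xi) ^+ 2 =
  2 * (dc ^+ 2 * g1 xi ^+ 2 + ds ^+ 2 * g2 xi ^+ 2) - (dc * g1 xi + ds * g2 xi) ^+ 2 by ring.
rewrite -mulrA mulrDr; lra.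
Qed.

Lemma normr_evolB t u xi :
  `|evol t xi - evol u xi| <= `|t - u| * (enorm xi `^ a * (`|g1 xi| + `|g2 xi|)).
Proof.
rewrite /evol; set rho := enorm xi `^ a.
have rho0 : 0 <= rho by exact: powR_ge0.
have -> : cos (t * rho) * g1 xi - sin (t * rho) * g2 xi - (cos (u * rho) * g1 xi - sin (u * rho) * g2 xi)
  = (cos (t * rho) - cos (u * rho)) * g1 xi - (sin (t * rho) - sin (u * rho)) * g2 xi by ring.
rewrite (le_trans (ler_normB _ _))// mulrA mulrDr !normrM.
have := normr_cosB (t * rho) (u * rho); have := normr_sinB (t * rho) (u * rho).
have hr : `|t * rho - u * rho| = `|t - u| * rho by rewrite -mulrBl normrM (ger0_norm rho0).
rewrite hr => h1 h2.
by rewrite lerD// ler_wpM2r.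
Qed.

Section exponents.
Variables (th eps lambda : R).
Hypotheses (th0 : 0 <= th) (th1 : th <= 1) (eps_gt0 : 0 < eps) (ths : a * th + eps <= s)
  (lambda_gt0 : 0 < lambda) (lambda_lt : lambda < 1 / 2)
  (ratio : 2 * (lambda `^ th) ^+ 2 < 1).

Local Notation ci := (cantor_intervals lambda).

Let W := (\int[N]_xi (bessel_weight s xi * (g1 xi ^+ 2 + g2 xi ^+ 2))%:E)%E.

Let bw_le e : 0 <= e -> e <= s -> forall xi, bessel_weight e xi <= bessel_weight s xi.
Proof. by move=> e0 es xi; rewrite /bessel_weight ler_powR// lerDl sqr_ge0. Qed.

Let bw_ge0 e xi : 0 <= bessel_weight e xi. Proof. exact: powR_ge0. Qed.

Let mW e : measurable_fun setT (fun xi => (bessel_weight e xi * (g1 xi ^+ 2 + g2 xi ^+ 2))%:E).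
Proof.
apply/measurable_EFinP; apply: measurable_funM; first exact: measurable_bessel_weight.
by apply: measurable_funD; exact: measurable_funX.
Qed.

Let weight_le (p : n.-tuple R -> R) (k : R) : 0 <= k -> measurable_fun setT p ->
  (forall xi, bessel_weight eps xi * p xi ^+ 2 <= k * (bessel_weight s xi * (g1 xi ^+ 2 + g2 xi ^+ 2))) ->
  (\int[N]_xi (bessel_weight eps xi * p xi ^+ 2)%:E <= k%:E * W)%E.
Proof.
move=> k0 mp h; rewrite /W -ge0_integralZl//; last first.
  by move=> xi _; rewrite lee_fin mulr_ge0// addr_ge0// sqr_ge0.
apply: ge0_le_integral => //.
- by move=> xi _; rewrite lee_fin mulr_ge0// sqr_ge0.
- apply/measurable_EFinP; apply: measurable_funM; first exact: measurable_bessel_weight.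
  exact: measurable_funX.
- exact: measurable_funeM.
- by move=> xi _; rewrite -EFinM lee_fin; exact: h.
Qed.

Lemma evol_weight t :
  (\int[N]_xi (bessel_weight eps xi * evol t xi ^+ 2)%:E <= 2%:E * W)%E.
Proof.
apply: weight_le => //; first exact: measurable_evol.
move=> xi; rewrite [leRHS]mulrCA; apply: ler_pM; rewrite ?sqr_ge0//.
  apply: bw_le; first exact: ltW.
  by rewrite (le_trans _ ths)// lerDr mulr_ge0// ltW.
exact: sqr_evol_le.
Qed.

(** The step is at most [lambda ^+ l], and [|xi|^(2 a th)] is at most the weight of exponent
    [a * th]. Together with the weight of exponent [eps] it stays below that of exponent [s], by
    [ths]. *)
Lemma evolB_weight t (l : nat) :
  (\int[N]_xi (bessel_weight eps xi * (evol (t + gap lambda l) xi - evol t xi) ^+ 2)%:E <=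
   (8 * ((lambda `^ th) ^+ 2) ^+ l)%:E * W)%E.
Proof.
have l1 : lambda < 1 by rewrite (lt_trans lambda_lt)// ltr_pdivrMr// mul1r ltr1n.
apply: weight_le; first by rewrite mulr_ge0// exprn_ge0// sqr_ge0.
  by apply: measurable_funB; exact: measurable_evol.
move=> xi.
apply: (@le_trans _ _ (bessel_weight eps xi * (8 * ((`|gap lambda l| * enorm xi `^ a) `^ th) ^+ 2 * (g1 xi ^+ 2 + g2 xi ^+ 2)))).
  rewrite ler_wpM2l//; have := sqr_evolB_le (t + gap lambda l) t xi th0 th1.
  by rewrite (_ : t + gap lambda l - t = gap lambda l)// addrAC subrr add0r.
have gl : `|gap lambda l| <= lambda ^+ l.
  rewrite ger0_norm; last by rewrite ltW// gap_gt0.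
  by rewrite /gap ler_piMr ?exprn_ge0 ?(ltW lambda_gt0)// gerBl ltW.
have h1 : ((`|gap lambda l| * enorm xi `^ a) `^ th) ^+ 2 <=
    ((lambda `^ th) ^+ 2) ^+ l * bessel_weight (a * th) xi.
  rewrite powRM ?powR_ge0// exprMn; apply: ler_pM; rewrite ?sqr_ge0//.
    rewrite exprAC lerXn2r ?nnegrE ?powR_ge0 ?exprn_ge0 ?powR_ge0//.
    rewrite -[leRHS]powR_mulrn ?powR_ge0// powRAC ge0_ler_powR ?nnegrE ?powR_ge0//.
    by rewrite powR_mulrn// ltW.
  rewrite -powRrM -powR_mulrn ?powR_ge0// powRAC /bessel_weight ge0_ler_powR ?nnegrE ?powR_ge0//.
  - by rewrite mulr_ge0// ltW.
  - by rewrite addr_ge0// sqr_ge0.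
  - by rewrite powR_mulrn ?enorm_ge0// lerDr.
have h2 : bessel_weight eps xi * bessel_weight (a * th) xi <= bessel_weight s xi.
  rewrite /bessel_weight -powRD; last first.
    apply/implyP => _; rewrite gt_eqF//; apply: (@lt_le_trans _ _ 1) => //.
    by rewrite lerDl sqr_ge0.
  by rewrite [eps + _]addrC ler_powR// lerDl sqr_ge0.
have G0 : 0 <= g1 xi ^+ 2 + g2 xi ^+ 2 by rewrite addr_ge0// sqr_ge0.
move: h1; move: ((_ `^ th) ^+ 2) => X h1.
rewrite !mulrA ler_wpM2r//.
have q0 : 0 <= ((lambda `^ th) ^+ 2) ^+ l by rewrite exprn_ge0// sqr_ge0.
set Q := ((lambda `^ th) ^+ 2) ^+ l in h1 q0 *.
apply: (@le_trans _ _ (bessel_weight eps xi * (8 * (Q * bessel_weight (a * th) xi)))).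
  by rewrite -mulrA ler_wpM2l// ler_wpM2l.
rewrite (_ : _ * _ = 8 * Q * (bessel_weight eps xi * bessel_weight (a * th) xi)); last by ring.
by rewrite ler_wpM2l// mulr_ge0.
Qed.


Lemma size_cantor_intervals l : size (ci l) = (2 ^ l)%N.
Proof.
elim: l => //= l IH; rewrite size_flatten /shape -map_comp.
rewrite sumnE big_map /= big_const_seq count_predT IH iter_addn_0.
by rewrite expnS.
Qed.

Lemma sobolev_sqr_fin (p : n.-tuple R -> R) : measurable_fun setT p ->
  (forall xi, p xi ^+ 2 <= g1 xi ^+ 2 + g2 xi ^+ 2) ->
  (\int[N]_xi (p xi ^+ 2)%:E < +oo)%E.
Proof.
move=> mp pg; apply: le_lt_trans gW; apply: ge0_le_integral => //.
- by move=> xi _; rewrite lee_fin sqr_ge0.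
- by apply/measurable_EFinP; exact: measurable_funX.
- move=> xi _; rewrite lee_fin (le_trans (pg xi))// ler_peMl ?addr_ge0 ?sqr_ge0//.
  by apply: bessel_weight_ge1; exact: ltW.
Qed.

Let g1fin : (\int[N]_xi (g1 xi ^+ 2)%:E < +oo)%E.
Proof. by apply: sobolev_sqr_fin => // xi; rewrite lerDl sqr_ge0. Qed.

Let g2fin : (\int[N]_xi (g2 xi ^+ 2)%:E < +oo)%E.
Proof. by apply: sobolev_sqr_fin => // xi; rewrite lerDr sqr_ge0. Qed.

Lemma enorm_cube M : exists A : R, 0 <= A /\ forall xi, cube M xi -> enorm xi `^ a <= A.
Proof.
exists (Num.sqrt (\sum_(i < n) (M%:R / 2) ^+ 2) `^ a); split; first exact: powR_ge0.
move=> xi h; rewrite ge0_ler_powR ?nnegrE ?enorm_ge0 ?sqrtr_ge0 ?(ltW a_gt0)//.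
rewrite ler_wsqrtr// /dot; apply: ler_sum => i _.
by rewrite -expr2 -[leLHS]real_normK ?num_real// lerXn2r ?nnegrE ?divr_ge0// h.
Qed.

Lemma integrable_symbol_cube M :
  N.-integrable setT (EFin \o ((fun xi => enorm xi `^ a * (`|g1 xi| + `|g2 xi|)) \_ (cube M))).
Proof.
have [A [A0 hA]] := enorm_cube M.
have ig := integrableZl measurableT A (integrableD measurableT
  (integrable_norm (integrable_cube mg1 g1fin M)) (integrable_norm (integrable_cube mg2 g2fin M))).
apply: (integrable_le _ _ ig).
  apply/(measurable_restrict _ _ _).1 => //; first exact: measurable_cube.
  rewrite setTI; apply: measurable_funTS; apply: measurable_funM; first exact: measurable_symbol.
  by apply: measurable_funD; exact: measurableT_comp.
move=> xi; rewrite /= !patchE; case: ifPn => [|_]; last by rewrite !normr0 addr0 mulr0.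
rewrite inE => h.
rewrite normrM (ger0_norm (powR_ge0 _ _)) (ger0_norm (addr_ge0 (normr_ge0 _) (normr_ge0 _))).
by rewrite ler_wpM2r ?addr_ge0//; exact: hA.
Qed.

Let evol_fin t : (\int[N]_xi (evol t xi ^+ 2)%:E < +oo)%E.
Proof.
have h : (2%:E * W < +oo)%E by rewrite lte_mul_pinfty.
have h2 := le_lt_trans (evol_weight t) h.
exact: le_lt_trans (bessel_sqr_fin eps_gt0 (measurable_evol t) h2) h2.
Qed.

Let evolB_fin t u : (\int[N]_xi ((evol t xi - evol u xi) ^+ 2)%:E < +oo)%E.
Proof.
apply: (@le_lt_trans _ _ (\int[N]_xi (2%:E * (evol t xi ^+ 2)%:E + 2%:E * (evol u xi ^+ 2)%:E))%E).
  apply: ge0_le_integral => //.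
  - by move=> xi _; rewrite lee_fin sqr_ge0.
  - apply/measurable_EFinP; apply: measurable_funX.
    by apply: measurable_funB; exact: measurable_evol.
  - by apply/measurable_EFinP; apply: measurable_funD; apply: measurable_funM => //; apply: measurable_funX; exact: measurable_evol.
  - move=> xi _; rewrite -!EFinM -EFinD lee_fin.
    have := sqr_ge0 (evol t xi + evol u xi); nra.
rewrite ge0_integralD//; last 4 first.
- by move=> xi _; rewrite -EFinM lee_fin mulr_ge0// sqr_ge0.
- by apply/measurable_EFinP; apply: measurable_funM => //; apply: measurable_funX; exact: measurable_evol.
- by move=> xi _; rewrite -EFinM lee_fin mulr_ge0// sqr_ge0.
- by apply/measurable_EFinP; apply: measurable_funM => //; apply: measurable_funX; exact: measurable_evol.
rewrite !ge0_integralZl//; last 4 first.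
- by apply/measurable_EFinP; apply: measurable_funX; exact: measurable_evol.
- by move=> xi _; rewrite lee_fin sqr_ge0.
- by apply/measurable_EFinP; apply: measurable_funX; exact: measurable_evol.
- by move=> xi _; rewrite lee_fin sqr_ge0.
by rewrite lte_add_pinfty// lte_mul_pinfty//; apply: integral_ge0 => xi _; rewrite lee_fin sqr_ge0.
Qed.

Lemma psum_evolB t u c M x : psum (evol t) c M x - psum (evol u) c M x =
  psum (fun xi => evol t xi - evol u xi) c M x.
Proof.
rewrite !psumE /trig -RintegralB//; last 2 first.
- by apply: integrable_trig; exact: integrable_cube (measurable_evol t) (evol_fin t) M.
- by apply: integrable_trig; exact: integrable_cube (measurable_evol u) (evol_fin u) M.
apply: eq_Rintegral => xi _; rewrite -mulrBr !patchE.
by case: ifP => //; rewrite subr0.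
Qed.

(** The symbol [|xi|^a] is bounded on a cube. The constant grows with [M], which [cantor_chain]
    tolerates. *)
Lemma psum_evol_lip c M x : exists L, forall t u,
  `|psum (evol t) c M x - psum (evol u) c M x| <= L * `|t - u|.
Proof.
pose S := (fun xi => enorm xi `^ a * (`|g1 xi| + `|g2 xi|)) \_ (cube M).
exists (\int[N]_xi S xi) => t u.
have mB : measurable_fun setT (fun xi => evol t xi - evol u xi).
  by apply: measurable_funB; exact: measurable_evol.
have iB := integrable_cube mB (evolB_fin t u) M.
rewrite psum_evolB psumE (le_trans (normr_trig_le c x iB))// mulrC.
rewrite -RintegralZl//; last exact: integrable_symbol_cube.
apply: le_Rintegral => //.
- exact: (integrable_norm iB).
- exact: (integrableZl measurableT _ (integrable_symbol_cube M)).
move=> xi _; rewrite /S !patchE; case: ifPn => _; last by rewrite normr0 mulr0.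
exact: normr_evolB.
Qed.

Section maximal_function.
Variable c : R.

Let D (J : R * R) l xi := evol (J.1 + gap lambda l) xi - evol J.1 xi.
Let tau := Num.sqrt (2 * (lambda `^ th) ^+ 2).

Let gamma0 : 0 < 2 * (lambda `^ th) ^+ 2.
Proof. by rewrite mulr_gt0// exprn_gt0// powR_gt0. Qed.

Let tau01 : 0 < tau < 1.
Proof. by rewrite sqrtr_gt0 gamma0 -sqrtr1 ltr_sqrt. Qed.

Let mD J l : measurable_fun setT (D J l).
Proof. by apply: measurable_funB; exact: measurable_evol. Qed.

Definition level l x : \bar R :=
  ((tau ^+ l)^-1%:E * \sum_(J <- ci l) maxfun eps (D J l) c x)%E.

(* The weight [tau ^- l] is affordable because the [2 ^ l] increments of level [l]
   have total mass [O(tau ^ (2 l))]. *)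
Definition cantor_maxfun x : \bar R :=
  (maxfun eps (evol 0) c x + \sum_(0 <= l <oo) level l x)%E.

Let tauVl_ge0 l : 0 <= (tau ^+ l)^-1.
Proof. by rewrite invr_ge0 exprn_ge0// ltW//; case/andP: tau01. Qed.

Lemma level_ge0 l x : (0 <= level l x)%E.
Proof. by rewrite mule_ge0 ?lee_fin//; apply: sume_ge0 => J _; exact: maxfun_ge0. Qed.

Lemma measurable_level l : measurable_fun setT (level l).
Proof.
apply: measurable_funeM; apply: emeasurable_sum => J.
by apply: (measurable_maxfun eps_gt0); [exact: mD|exact: evolB_fin].
Qed.

Lemma cantor_maxfun_ge0 x : (0 <= cantor_maxfun x)%E.
Proof.
by rewrite adde_ge0 ?maxfun_ge0//; apply: nneseries_ge0 => l _ _; exact: level_ge0.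
Qed.

Lemma measurable_cantor_maxfun : measurable_fun setT cantor_maxfun.
Proof.
apply: emeasurable_funD; first by apply: (measurable_maxfun eps_gt0); [exact: measurable_evol|exact: evol_fin].
by apply: ge0_emeasurable_sum => l // *; [exact: level_ge0|exact: measurable_level].
Qed.

Lemma integral_cantor_maxfun : (\int[N]_x cantor_maxfun x < +oo)%E.
Proof.
have [C C0 HC] := @integral_maxfun R n eps eps_gt0.
have W0 : (0 <= W)%E.
  by apply: integral_ge0 => xi _; rewrite lee_fin mulr_ge0// addr_ge0// sqr_ge0.
have Wnum : W = (fine W)%:E by rewrite fineK// ge0_fin_numE.
have /andP[t0 t1] := tau01.
rewrite ge0_integralD//; last 4 first.
- by move=> x _; exact: maxfun_ge0.
- by apply: (measurable_maxfun eps_gt0); [exact: measurable_evol|exact: evol_fin].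
- by move=> x _; apply: nneseries_ge0 => l _ _; exact: level_ge0.
- by apply: ge0_emeasurable_sum => l // *; [exact: level_ge0|exact: measurable_level].
apply: lte_add_pinfty.
  apply: (le_lt_trans (HC _ c (measurable_evol 0) _)).
    by apply: (le_lt_trans (evol_weight 0)); rewrite lte_mul_pinfty.
  rewrite lte_mul_pinfty ?lee_fin//.
  by apply: (le_lt_trans (evol_weight 0)); rewrite lte_mul_pinfty.
rewrite integral_nneseries//; last 2 first.
- exact: measurable_level.
- by move=> l x _; exact: level_ge0.
apply: le_lt_trans (ltry _); apply: (@nneseries_geometric_le _ tau (C * 8 * fine W)) => //.
- by rewrite !mulr_ge0// fine_ge0.
- by move=> l; apply: integral_ge0 => x _; exact: level_ge0.
move=> l; rewrite /level.
have mm J : measurable_fun setT (maxfun eps (D J l) c).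
  by apply: (measurable_maxfun eps_gt0); [exact: mD|exact: evolB_fin].
rewrite ge0_integralZl//; last 3 first.
- by apply: emeasurable_sum => J; exact: mm.
- by move=> x _; apply: sume_ge0 => J _; exact: maxfun_ge0.
- by rewrite lee_fin.
rewrite ge0_integral_sum//; last by move=> J x _; exact: maxfun_ge0.
apply: (@le_trans _ _ ((tau ^+ l)^-1%:E *
   \sum_(J <- ci l) (C * (8 * ((lambda `^ th) ^+ 2) ^+ l * fine W))%:E)%E).
  rewrite lee_wpmul2l ?lee_fin//; apply: lee_sum => J _.
  have h := evolB_weight J.1 l.
  have hf : (\int[N]_xi (bessel_weight eps xi * D J l xi ^+ 2)%:E < +oo)%E.
    apply: (le_lt_trans h); rewrite lte_mul_pinfty//.
    by rewrite lee_fin mulr_ge0// exprn_ge0// sqr_ge0.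
  apply: (le_trans (HC _ c (mD J l) hf)); rewrite EFinM lee_wpmul2l ?lee_fin//.
  by rewrite EFinM -Wnum.
rewrite sumEFin big_const_seq count_predT size_cantor_intervals iter_addr_0 -EFinM lee_fin.
have tl : tau ^+ l != 0 by rewrite expf_neq0// gt_eqF.
have E : 2 ^+ l * ((lambda `^ th) ^+ 2) ^+ l = tau ^+ l * tau ^+ l.
  by rewrite -!exprMn -expr2 sqr_sqrtr// ltW.
rewrite -[_ *+ (2 ^ l)]mulr_natl natrX.
have -> : (tau ^+ l)^-1 * (2 ^+ l * (C * (8 * (lambda `^ th) ^+ 2 ^+ l * fine W))) =
  (tau ^+ l)^-1 * (C * 8 * fine W) * (2 ^+ l * (lambda `^ th) ^+ 2 ^+ l) by ring.
by rewrite E le_eqVlt; apply/orP; left; apply/eqP; field.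
Qed.

(** Wherever [cantor_maxfun] is finite, every increment required by [cantor_maximal_cvg] is
    controlled by it; the exceptional set depends neither on [t] nor on [M]. *)
Lemma psum_evol_cvg : {ae N, forall x, exists V : R -> R,
  (forall t, cantor lambda t -> psum (evol t) c M x @[M --> \oo] --> V t) /\
  V t @[t --> within (cantor lambda) 0^'] --> V 0}.
Proof.
have iU : N.-integrable setT cantor_maxfun.
  apply/integrableP; split; first exact: measurable_cantor_maxfun.
  under eq_integral do rewrite gee0_abs ?cantor_maxfun_ge0//.
  exact: integral_cantor_maxfun.
have := integrable_ae measurableT iU; apply: filterS => x /(_ I) fU.
have /andP[t0 t1] := tau01.
have lvl0 : (0 <= \sum_(0 <= l <oo) level l x)%E by apply: nneseries_ge0 => l _ _; exact: level_ge0.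
have U0 := cantor_maxfun_ge0 x.
have Ufin : (cantor_maxfun x < +oo)%E by rewrite -ge0_fin_numE.
pose K0 := Num.sqrt (fine (cantor_maxfun x)).
have K00 : 0 <= K0 by exact: sqrtr_ge0.
have b0 : (maxfun eps (evol 0) c x <= cantor_maxfun x)%E by rewrite leeDl.
have f0 := le_lt_trans b0 Ufin.
have s0 : Num.sqrt (fine (maxfun eps (evol 0) c x)) <= K0.
  by rewrite ler_wsqrtr// fine_le// ge0_fin_numE// maxfun_ge0.
have bJ l J : J \in ci l -> (maxfun eps (D J l) c x <= (tau ^+ l)%:E * cantor_maxfun x)%E.
  move=> Jl; rewrite -lee_pdivrMl ?exprn_gt0//.
  have h1 : (level l x <= cantor_maxfun x)%E.
    rewrite /cantor_maxfun -[leLHS]add0e leeD ?maxfun_ge0//.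
    rewrite (@nneseriesD1 _ _ l)//; last by move=> k _; exact: level_ge0.
    by rewrite leeDl//; apply: nneseries_ge0 => k _ _; exact: level_ge0.
  apply: le_trans h1; rewrite lee_wpmul2l ?lee_fin//.
  by rewrite (big_rem _ Jl)/= leeDl//; apply: sume_ge0 => J' _; exact: maxfun_ge0.
have fJ l J : J \in ci l -> (maxfun eps (D J l) c x < +oo)%E.
  move=> /bJ /le_lt_trans; apply; rewrite lte_mul_pinfty// lee_fin exprn_ge0// ltW//.
(* [maxfun] bounds squares: its decay [tau ^+ l] becomes [alpha ^+ l] for the partial integrals. *)
pose alpha := Num.sqrt tau.
have alpha01 : 0 < alpha < 1 by rewrite sqrtr_gt0 t0 -sqrtr1 ltr_sqrt.
have al l : 0 <= alpha ^+ l by rewrite exprn_ge0// sqrtr_ge0.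
have sJ l J : J \in ci l -> Num.sqrt (fine (maxfun eps (D J l) c x)) <= alpha ^+ l * K0.
  move=> Jl; have tl : 0 <= tau ^+ l by rewrite exprn_ge0// ltW.
  have -> : alpha ^+ l * K0 = Num.sqrt (tau ^+ l * fine (cantor_maxfun x)).
    rewrite sqrtrM//; congr (_ * _).
    have -> : tau ^+ l = (alpha ^+ l) ^+ 2 by rewrite -exprM mulnC exprM sqr_sqrtr// ltW.
    by rewrite sqrtr_sqr ger0_norm.
  have -> : tau ^+ l * fine (cantor_maxfun x) = fine ((tau ^+ l)%:E * cantor_maxfun x)%E.
    by rewrite fineM// ge0_fin_numE.
  rewrite ler_wsqrtr// fine_le ?bJ//; first by rewrite ge0_fin_numE ?maxfun_ge0// fJ.
  by rewrite ge0_fin_numE ?mule_ge0 ?lee_fin// lte_mul_pinfty ?lee_fin.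
have /andP[r0 r1] := powR2N_lt1 eps_gt0.
(* One square root because [maxfun] bounds squares, a second to leave a factor [q ^+ m] that absorbs
   [m.+1]. *)
pose q := Num.sqrt (Num.sqrt (2 `^ (- eps) : R)).
have sr0 : 0 < Num.sqrt (2 `^ (- eps) : R) by rewrite sqrtr_gt0.
have sr1 : Num.sqrt (2 `^ (- eps) : R) < 1 by rewrite -[ltRHS]sqrtr1 ltr_sqrt.
have q01 : 0 < q < 1 by rewrite sqrtr_gt0 sr0 -[ltRHS]sqrtr1 ltr_sqrt.
have qm m : 0 <= q ^+ m by rewrite exprn_ge0// sqrtr_ge0.
have qq m : Num.sqrt (2 `^ (- eps) : R) ^+ m = q ^+ m * q ^+ m.
  by rewrite -exprMn -expr2 sqr_sqrtr// ltW.
have [Dm Dm0 HD] := natr_mul_geometric q01.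
(* With [Dm + 1 >= 1] the same constant also dominates the bound of [psum1_maxfun]. *)
have bnd m : m.+1%:R * Num.sqrt (2 `^ (- eps) : R) ^+ m <= (Dm + 1) * q ^+ m.
  rewrite qq mulrA ler_wpM2r// (le_trans (HD m))// lerDl//.
have K0' : 0 <= (Dm + 1) * K0 by rewrite mulr_ge0// addr_ge0// ltW.
apply: (@cantor_maximal_cvg _ _ lambda_gt0 lambda_lt (fun M t => psum (evol t) c M x) ((Dm + 1) * K0) alpha q) => //.
- move=> m M hM; apply: (le_trans (psum_maxfun eps_gt0 f0 hM)).
  by rewrite [leRHS]mulrAC ler_pM// ?sqrtr_ge0// mulr_ge0// qq mulr_ge0.
- move=> l J m M Jl hM; rewrite !psum_evolB.
  apply: (le_trans (psum_maxfun eps_gt0 (fJ l J Jl) hM)).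
  have -> : (Dm + 1) * K0 * alpha ^+ l * q ^+ m = (Dm + 1) * q ^+ m * (alpha ^+ l * K0) by ring.
  by rewrite ler_pM ?sqrtr_ge0 ?sJ// mulr_ge0// qq mulr_ge0.
- move=> l J Jl; rewrite psum_evolB (le_trans (psum1_maxfun eps_gt0 (fJ l J Jl)))//.
  rewrite (le_trans (sJ l J Jl))// mulrC ler_wpM2r// ler_peMl// lerDr ltW//.
- by move=> M; exact: psum_evol_lip.
Qed.

End maximal_function.

End exponents.

End evolution.

(** * Inversion at time zero *)

Section psum_limit.
Context {R : realType} {n : nat}.
Local Notation N := (leb R n).
Variable eps : R.
Hypothesis eps_gt0 : 0 < eps.

Let rate01 : 0 < Num.sqrt (Num.sqrt (2 `^ (- eps) : R)) < 1.
Proof.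
have /andP[r0 r1] := powR2N_lt1 eps_gt0.
have sr0 : 0 < Num.sqrt (2 `^ (- eps) : R) by rewrite sqrtr_gt0.
have sr1 : Num.sqrt (2 `^ (- eps) : R) < 1 by rewrite -[ltRHS]sqrtr1 ltr_sqrt.
by rewrite sqrtr_gt0 sr0 -[ltRHS]sqrtr1 ltr_sqrt.
Qed.

Lemma psum_tail : exists2 B : R, 0 <= B & forall (p : n.-tuple R -> R) c x,
  (maxfun eps p c x < +oo)%E -> forall m M, (2 ^ m <= M)%N ->
  `|psum p c M x - psum p c (2 ^ m) x| <=
    B * Num.sqrt (fine (maxfun eps p c x)) * Num.sqrt (Num.sqrt (2 `^ (- eps))) ^+ m.
Proof.
have /andP[q0 q1] := rate01.
have [D D0 HD] := natr_mul_geometric rate01.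
set q := Num.sqrt (Num.sqrt (2 `^ (- eps))) in q0 q1 HD *.
have h1q : 0 < 1 - q by rewrite subr_gt0.
exists (D / (1 - q)); first by rewrite divr_ge0// ltW.
move=> p c x fin m M mM.
set S := Num.sqrt (fine _); have S0 : 0 <= S by exact: sqrtr_ge0.
have K0 : 0 <= D * S by rewrite mulr_ge0// ltW.
rewrite [D / _ * _]mulrAC.
apply: (@dyadic_tail _ (fun M => psum p c M x) _ _ K0 rate01 _ m M mM) => {}m {}M {}mM.
apply: (le_trans (psum_maxfun eps_gt0 fin mM)); rewrite -/S [leRHS]mulrAC ler_wpM2r// -/q.
have -> : Num.sqrt (2 `^ (- eps) : R) ^+ m = q ^+ m * q ^+ m.
  by rewrite -exprMn -expr2 sqr_sqrtr// sqrtr_ge0.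
by rewrite mulrA ler_wpM2r ?HD// exprn_ge0// ltW.
Qed.

(** [psum_tail] starting from [2 ^ 0]. Being uniform in [M], it supplies the dominating function for
    the limit at time zero. *)
Lemma psum_bound : exists2 B : R, 0 <= B & forall (p : n.-tuple R -> R) c x M,
  (maxfun eps p c x < +oo)%E -> (0 < M)%N ->
  `|psum p c M x| <= B * Num.sqrt (fine (maxfun eps p c x)).
Proof.
have [B B0 HB] := psum_tail.
exists (B + 1); first by rewrite addr_ge0.
move=> p c x M fin M0; have := HB p c x fin 0%N M M0.
rewrite expr0 mulr1 expn0 => h.
rewrite -(subrK (psum p c 1 x) (psum p c M x)) mulrDl mul1r.
by rewrite (le_trans (ler_normD _ _))// lerD//; exact: psum1_maxfun.
Qed.

Lemma is_cvg_psum (p : n.-tuple R -> R) c x : (maxfun eps p c x < +oo)%E ->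
  cvgn (fun M => psum p c M x).
Proof.
move=> fin; have [B B0 HB] := psum_tail.
by apply: (dyadic_cvg rate01) => m M mM; exact: HB.
Qed.

Lemma integrable_maxfun (p : n.-tuple R -> R) c : measurable_fun setT p ->
  (\int[N]_xi (bessel_weight eps xi * p xi ^+ 2)%:E < +oo)%E ->
  N.-integrable setT (maxfun eps p c).
Proof.
move=> mp p2; have [C C0 HC] := @integral_maxfun R n eps eps_gt0.
apply/integrableP; split.
  by apply: (measurable_maxfun eps_gt0) => //; exact: le_lt_trans (bessel_sqr_fin eps_gt0 mp p2) p2.
under eq_integral do rewrite gee0_abs ?maxfun_ge0//.
by apply: (le_lt_trans (HC p c mp p2)); rewrite lte_mul_pinfty ?lee_fin.
Qed.

End psum_limit.

(** * Partial integrals tested against Gaussians *)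

Section gauss_psum.
Context {R : realType} {n : nat}.
Local Notation N := (leb R n).
Implicit Types (p : n.-tuple R -> R) (b x : n.-tuple R).

Definition oppt b : n.-tuple R := [tuple - tnth b i | i < n].

Lemma dot_oppt b x : dot (oppt b) x = - dot b x.
Proof. by rewrite /dot -sumrN; apply: eq_bigr => i _; rewrite tnth_mktuple mulNr. Qed.

Lemma gaussn_oppt b s x : s != 0 -> gaussn (oppt b) s x = gaussn (oppt x) s b.
Proof.
move=> s0; rewrite !gaussnE//.
rewrite (eq_bigr (fun i => (tnth b i - tnth (oppt x) i) ^+ 2))//.
by move=> i _; rewrite !tnth_mktuple !opprK addrC.
Qed.

(** [trig_swap] moves the test function to the frequency side, where [gauss_cos_cosE] turns it into
    Gaussians centred at [b] and [- b]. *)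
Lemma gauss_psum p b d c M : measurable_fun setT p ->
  (\int[N]_xi (p xi ^+ 2)%:E < +oo)%E ->
  \int[N]_x (gaussn zerot 1 x * cos (dot b x + d) * psum p c M x) =
  normal_peak 1 ^- n / 2 *
   (cos (d - c) * \int[N]_(y in cube M) (gaussn b 1 y * p y) +
    cos (d + c) * \int[N]_(y in cube M) (gaussn (oppt b) 1 y * p y)).
Proof.
move=> mp p2; have ip := integrable_cube mp p2 M.
have one0 : (1 : R) != 0 by [].
under eq_Rintegral do rewrite psumE.
rewrite (trig_swap c 1 (measurable_cos_dotr b d) (fun x => normr_cos_le1 _) ip).
have restr b' : \int[N]_(y in cube M) (gaussn b' 1 y * p y) =
    \int[N]_y (gaussn b' 1 y * (p \_ (cube M)) y).
  rewrite Rintegral_mkcond; apply: eq_Rintegral => y _; rewrite !patchE.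
  by case: ifP => // _; rewrite mulr0.
have ic b' := integrable_mul_gaussn ip b' one0.
rewrite !restr -!RintegralZl//.
rewrite -RintegralD//; last 2 first.
- exact: (integrableZl measurableT (cos (d - c)) (ic b)).
- exact: (integrableZl measurableT (cos (d + c)) (ic (oppt b))).
rewrite -RintegralZl//; last first.
  exact: (integrableD measurableT (integrableZl measurableT (cos (d - c)) (ic b))
    (integrableZl measurableT (cos (d + c)) (ic (oppt b)))).
apply: eq_Rintegral => y _.
by rewrite gauss_cos_cosE// invr1 gaussnC// -/(oppt y) gaussn_oppt//; ring.
Qed.

Lemma integrable_gauss_psum p b d c M : measurable_fun setT p ->
  (\int[N]_xi (p xi ^+ 2)%:E < +oo)%E ->
  N.-integrable setT (EFin \o (fun x => gaussn zerot 1 x * cos (dot b x + d) * psum p c M x)).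
Proof.
move=> mp p2; have ip := integrable_cube mp p2 M.
apply: (@integrable_gauss_weight _ _ 1 _ (\int[N]_xi `|(p \_ (cube M)) xi|)).
  apply: measurable_funM; last exact: measurable_psum.
  by apply: measurable_funM; [exact: measurable_gaussn|exact: measurable_cos_dotr].
move=> x; rewrite mulrAC normrM [leRHS]mulrC -[leRHS]mulr1.
apply: ler_pM => //; last exact: normr_cos_le1.
rewrite normrM ger0_norm ?gaussn_ge0// ler_wpM2l ?gaussn_ge0// psumE.
exact: normr_trig_le.
Qed.

End gauss_psum.

Section real_dominated_convergence.
Context d (T : measurableType d) (R : realType) (mu : {measure set T -> \bar R}).

Lemma dominated_cvg_Rintegral (f_ : nat -> T -> R) (f g : T -> R) :
  (forall M, measurable_fun setT (f_ M)) -> measurable_fun setT f ->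
  {ae mu, forall x, f_ ^~ x @ \oo --> f x} ->
  mu.-integrable setT (EFin \o g) ->
  {ae mu, forall x, forall M, `|f_ M x| <= g x} ->
  mu.-integrable setT (EFin \o f) /\
  (\int[mu]_x f_ M x) @[M --> \oo] --> \int[mu]_x f x.
Proof.
move=> mf_ mf ff ig fg.
have ff' : {ae mu, forall x, [set: T] x -> (f_ M x)%:E @[M --> \oo] --> (f x)%:E}.
  by apply: filterS ff => x h _; apply: cvg_EFin => //; exact: nearW.
have fg' : {ae mu, forall x (M : nat), [set: T] x -> (`|(f_ M x)%:E| <= (g x)%:E)%E}.
  by apply: filterS fg => x h M _; exact: h.
have [i _ c] := dominated_convergence measurableT
  (fun M => measurableT_comp (@EFin_measurable R setT) (mf_ M))
  (measurableT_comp (@EFin_measurable R setT) mf) ff' ig fg'.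
split=> //; apply: fine_cvg.
by rewrite fineK//; exact: integrable_fin_num.
Qed.

End real_dominated_convergence.

Section gauss_fourier.
Context {R : realType} {n : nat}.
Local Notation N := (leb R n).
Implicit Types (b x : n.-tuple R) (f g h : n.-tuple R -> R).
Local Notation gauss := (gaussn (@zerot R n) 1).
Local Notation k := (normal_peak (1 : R) ^- n).

(* [g1 + i g2] is the Fourier transform of [f1 + i f2], tested against the
   translates of the standard Gaussian. *)
Definition gauss_fourier f1 f2 g1 g2 : Prop :=
  [/\ N.-integrable setT (EFin \o (fun y => gauss y * f1 y)),
      N.-integrable setT (EFin \o (fun y => gauss y * f2 y)) &
      forall b,
        [/\ N.-integrable setT (EFin \o (fun y => gaussn b 1 y * g1 y)),
            N.-integrable setT (EFin \o (fun y => gaussn b 1 y * g2 y)),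
            \int[N]_y (gaussn b 1 y * g1 y) =
              k * (\int[N]_y (cos (dot b y) * (gauss y * f1 y)) +
                   \int[N]_y (sin (dot b y) * (gauss y * f2 y))) &
            \int[N]_y (gaussn b 1 y * g2 y) =
              k * (\int[N]_y (cos (dot b y) * (gauss y * f2 y)) -
                   \int[N]_y (sin (dot b y) * (gauss y * f1 y)))]].

Lemma integrable_cos_dot b h : N.-integrable setT (EFin \o h) ->
  N.-integrable setT (EFin \o (fun x => cos (dot b x) * h x)).
Proof.
apply: (@integrable_bounded_mul _ _ _ _ _ 1) => //; last by move=> x; exact: normr_cos_le1.
by apply: (measurableT_comp measurable_cos); exact: measurable_dotl.
Qed.

Lemma integrable_sin_dot b h : N.-integrable setT (EFin \o h) ->
  N.-integrable setT (EFin \o (fun x => sin (dot b x) * h x)).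
Proof.
apply: (@integrable_bounded_mul _ _ _ _ _ 1) => //; last by move=> x; exact: normr_sin_le1.
by apply: (measurableT_comp measurable_sin); exact: measurable_dotl.
Qed.

Lemma RintegralN h : N.-integrable setT (EFin \o h) ->
  \int[N]_y (- h y) = - \int[N]_y h y.
Proof.
move=> ih; rewrite -mulN1r -RintegralZl//.
by apply: eq_Rintegral => y _; rewrite mulN1r.
Qed.

(* Multiplication by [-i]. *)
Lemma gauss_fourier_rot f1 f2 g1 g2 : gauss_fourier f1 f2 g1 g2 ->
  gauss_fourier f2 (fun x => - f1 x) g2 (fun x => - g1 x).
Proof.
have mulN h u : (fun y => u y * - h y) = (fun y => - (u y * h y)).
  by apply/funext => y; rewrite mulrN.
have iN h u : N.-integrable setT (EFin \o (fun y => u y * h y)) ->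
    N.-integrable setT (EFin \o (fun y => u y * - h y)).
  by rewrite mulN => ih; have := integrableN ih.
move=> [if1 if2 H]; split; rewrite ?mulN//; first by have := iN _ _ if1; rewrite mulN.
move=> b; have [ig1 ig2 e1 e2] := H b.
have is1 := integrable_sin_dot b if1; have ic1 := integrable_cos_dot b if1.
split=> //; first exact: iN.
  rewrite e2; congr (_ * (_ + _)); rewrite -RintegralN//.
  by apply: eq_Rintegral => y _; ring.
rewrite (_ : \int[N]_y (cos _ * _) = - \int[N]_y (cos (dot b y) * (gauss y * f1 y))); last first.
  by rewrite -RintegralN//; apply: eq_Rintegral => y _; ring.
rewrite -opprD mulrN -e1 -RintegralN//.
by apply: eq_Rintegral => y _; ring.
Qed.

End gauss_fourier.

Section identification.
Context {R : realType} {n : nat}.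
Local Notation N := (leb R n).
Implicit Types (b x : n.-tuple R).

Lemma cvg_Rintegral_cube (p : n.-tuple R -> R) : N.-integrable setT (EFin \o p) ->
  (\int[N]_(x in cube M.+1) p x) @[M --> \oo] --> \int[N]_x p x.
Proof.
move=> ip; have mp : measurable_fun setT p by apply/measurable_EFinP; exact: measurable_int ip.
under eq_fun do rewrite Rintegral_mkcond.
have [] // := @dominated_cvg_Rintegral _ _ R N (fun M => p \_ (cube M.+1)) p (fun x => `|p x|).
- move=> M; apply/(measurable_restrict _ _ _).1 => //; first exact: measurable_cube.
  by rewrite setTI; exact: measurable_funTS.
- apply: aeW => x; pose K := Num.bound (2 * \sum_(i < n) `|tnth x i|).
  apply: cvg_near_cst; exists K => // M /= KM; rewrite patchE mem_set// => i.
  rewrite ler_pdivlMr// mulrC.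
  have h : 2 * \sum_(i < n) `|tnth x i| < K%:R.
    by apply: archi_boundP; rewrite mulr_ge0// sumr_ge0.
  apply: (@le_trans _ _ K%:R); last by rewrite ler_nat (leq_trans KM).
  apply: le_trans (ltW h); rewrite ler_wpM2l// (bigD1 i)//= lerDl sumr_ge0//.
- exact: integrable_norm.
- by apply: aeW => x M; rewrite patchE; case: ifP => // _; rewrite normr0.
Qed.

Variables (f1 f2 g1 g2 : n.-tuple R -> R) (eps : R).
Local Notation gauss := (gaussn (@zerot R n) 1).
Local Notation k := (normal_peak (1 : R) ^- n).
Hypotheses (eps_gt0 : 0 < eps)
  (mg1 : measurable_fun setT g1) (mg2 : measurable_fun setT g2)
  (w1 : (\int[N]_xi (bessel_weight eps xi * g1 xi ^+ 2)%:E < +oo)%E)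
  (w2 : (\int[N]_xi (bessel_weight eps xi * g2 xi ^+ 2)%:E < +oo)%E)
  (fg : gauss_fourier f1 f2 g1 g2).

Let if1 : N.-integrable setT (EFin \o (fun y => gauss y * f1 y)).
Proof. by case: fg. Qed.
Let fin1 : (\int[N]_xi (g1 xi ^+ 2)%:E < +oo)%E.
Proof. exact: le_lt_trans (bessel_sqr_fin eps_gt0 mg1 w1) w1. Qed.
Let fin2 : (\int[N]_xi (g2 xi ^+ 2)%:E < +oo)%E.
Proof. exact: le_lt_trans (bessel_sqr_fin eps_gt0 mg2 w2) w2. Qed.

(* The real part of the partial integral at time [0] over the cube of side [M]. *)
Definition inversion M x : R :=
  (2 * pi) ^- n * (psum g1 0 M x + psum g2 (pi / 2) M x).

Let H1 := maxfun eps g1 0.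
Let H2 := maxfun eps g2 (pi / 2).

Let finH : {ae N, forall x, (H1 x < +oo)%E /\ (H2 x < +oo)%E}.
Proof.
have h1 := integrable_ae measurableT (integrable_maxfun eps_gt0 0 mg1 w1).
have h2 := integrable_ae measurableT (integrable_maxfun eps_gt0 (pi / 2) mg2 w2).
by apply: filterS2 h1 h2 => x /(_ I) a /(_ I) b; rewrite -!ge0_fin_numE ?maxfun_ge0.
Qed.

Let c0 : 0 <= (2 * pi) ^- n :> R.
Proof. by rewrite invr_ge0 exprn_ge0// mulr_ge0// pi_ge0. Qed.

Let minv M : measurable_fun setT (inversion M).
Proof.
apply: measurable_funM => //; apply: measurable_funD; exact: measurable_psum.
Qed.

(** The limit exists only almost everywhere; the upper limit is a version of it measurable on the
    whole space. The index starts at [1], as [psum_bound] asks. *)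
Let F x := fine (limn_esup (fun M => (inversion M.+1 x)%:E)).

Let mF : measurable_fun setT F.
Proof.
apply: measurableT_comp; first exact: fine_measurable.
by apply: measurable_fun_limn_esup => M; apply/measurable_EFinP; exact: minv.
Qed.

Let cF : {ae N, forall x, inversion M.+1 x @[M --> \oo] --> F x}.
Proof.
apply: filterS finH => x [a b].
have c : cvgn (fun M => inversion M.+1 x).
  apply/cvg_ex; exists ((2 * pi) ^- n *
    (limn (fun M => psum g1 0 M x) + limn (fun M => psum g2 (pi / 2) M x))).
  rewrite (cvg_shiftS (fun M => inversion M x)).
  apply: cvgMl_tmp; apply: cvgD; first exact: (is_cvg_psum eps_gt0 a).
  exact: (is_cvg_psum eps_gt0 b).
have cE : (inversion M.+1 x)%:E @[M --> \oo] --> (limn (fun M => inversion M.+1 x))%:E.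
  by apply: cvg_EFin => //; exact: nearW.
by rewrite /F is_cvg_limn_esupE ?(cvg_lim _ cE)//; apply/cvg_ex; eexists; exact: cE.
Qed.

(** The partial integrals are bounded by the square root of an integrable function, which need not
    be integrable. The Gaussian factor repairs this through the arithmetic-geometric inequality
    [amgm]. *)
Let dominated : exists g : n.-tuple R -> R, N.-integrable setT (EFin \o g) /\
  {ae N, forall x, forall M, `|gauss x * inversion M.+1 x| <= g x}.
Proof.
have [B B0 HB] := @psum_bound R n eps eps_gt0.
pose P : R := normal_peak 1 ^+ n.
have P0 : 0 <= P by rewrite exprn_ge0// normal_peak_ge0.
exists (fun x => (2 * pi) ^- n * B * (P * (gauss x + gauss x) + (fine (H1 x) + fine (H2 x)))); split.
  have i0 := integrableZl measurableT P (integrableD measurableT (integrable_gaussn (@zerot R n) 1) (integrable_gaussn (@zerot R n) 1)).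
  have h1 : N.-integrable setT (EFin \o (fine \o H1)).
    have m1 := measurable_int _ (integrable_maxfun eps_gt0 0 mg1 w1).
    apply: (le_integrable _ _ _ (integrable_maxfun eps_gt0 0 mg1 w1)) => //.
      by apply/measurable_EFinP; apply: measurableT_comp => //; exact: fine_measurable.
    move=> x _ /=; have : (0 <= H1 x)%E by exact: maxfun_ge0.
    by rewrite -/H1; case: (H1 x) => [r||]//= _; rewrite leey.
  have h2 : N.-integrable setT (EFin \o (fine \o H2)).
    apply: (le_integrable _ _ _ (integrable_maxfun eps_gt0 (pi / 2) mg2 w2)) => //.
      have m1 := measurable_int _ (integrable_maxfun eps_gt0 (pi / 2) mg2 w2).
      by apply/measurable_EFinP; apply: measurableT_comp => //; exact: fine_measurable.
    move=> x _ /=; have : (0 <= H2 x)%E by exact: maxfun_ge0.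
    by rewrite -/H2; case: (H2 x) => [r||]//= _; rewrite leey.
  exact: (integrableZl measurableT _ (integrableD measurableT i0 (integrableD measurableT h1 h2))).
apply: filterS finH => x [a b] M.
have G0 : 0 <= gauss x by exact: gaussn_ge0.
have GP : gauss x <= P by exact: gaussn_le.
have amgm (z : \bar R) : (0 <= z)%E -> gauss x * Num.sqrt (fine z) <= P * gauss x + fine z.
  move=> z0; have r0 := fine_ge0 z0; have s0 := sqrtr_ge0 (fine z).
  have e := sqr_sqrtr r0; set t := Num.sqrt _ in e s0 *; rewrite -[in leRHS]e.
  have := sqr_ge0 (gauss x - t); have : gauss x * gauss x <= P * gauss x by rewrite ler_wpM2r.
  rewrite sqrrB; nra.
have b1 := HB g1 0 x M.+1 a isT; have b2 := HB g2 (pi / 2) x M.+1 b isT.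
rewrite /inversion mulrCA normrM (ger0_norm c0) -[leRHS]mulrA ler_wpM2l// normrM (ger0_norm G0).
apply: (@le_trans _ _ (gauss x * (B * Num.sqrt (fine (H1 x)) + B * Num.sqrt (fine (H2 x))))).
  by rewrite ler_wpM2l// (le_trans (ler_normD _ _))// lerD.
rewrite -mulrDr mulrCA ler_wpM2l// [P * (_ + _)]mulrDr addrACA mulrDr.
by apply: lerD; apply: amgm; exact: maxfun_ge0.
Qed.

(** The limit of the tested partial integrals is computed twice: by domination it involves [F], by
    [gauss_psum] and [gauss_fourier] it involves [f1]. *)
Let tested b d : N.-integrable setT (EFin \o (fun x => cos (dot b x + d) * (gauss x * F x))) /\
  \int[N]_x (cos (dot b x + d) * (gauss x * F x)) =
  \int[N]_x (cos (dot b x + d) * (gauss x * f1 x)).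
Proof.
have [g [ig gB]] := dominated.
have mc : measurable_fun setT (fun x => cos (dot b x + d)) by exact: measurable_cos_dotr.
have [] // := @dominated_cvg_Rintegral _ _ R N
  (fun M x => cos (dot b x + d) * (gauss x * inversion M.+1 x))
  (fun x => cos (dot b x + d) * (gauss x * F x)) g.
- by move=> M; do 2?apply: measurable_funM => //; exact: measurable_gaussn.
- by do 2?apply: measurable_funM => //; exact: measurable_gaussn.
- by apply: filterS cF => x h; do 2?apply: cvgMl_tmp => //.
- apply: filterS gB => x h M; rewrite normrM; apply: le_trans (h M).
  by rewrite ler_piMl// normr_cos_le1.
move=> i c; split=> //.
pose A b' M := \int[N]_(y in cube M) (gaussn b' 1 y * g1 y).
pose B b' M := \int[N]_(y in cube M) (gaussn b' 1 y * g2 y).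
have E M : \int[N]_x (cos (dot b x + d) * (gauss x * inversion M.+1 x)) =
  (2 * pi) ^- n * (k / 2 * (cos (d - 0) * A b M.+1 + cos (d + 0) * A (oppt b) M.+1) +
     k / 2 * (cos (d - pi / 2) * B b M.+1 + cos (d + pi / 2) * B (oppt b) M.+1)).
  have i1 := integrable_gauss_psum b d 0 M.+1 mg1 fin1.
  have i2 := integrable_gauss_psum b d (pi / 2) M.+1 mg2 fin2.
  rewrite -(gauss_psum b d 0 M.+1 mg1 fin1) -(gauss_psum b d (pi / 2) M.+1 mg2 fin2).
  rewrite -RintegralD// -RintegralZl//; last exact: (integrableD measurableT i1 i2).
  by apply: eq_Rintegral => x _; rewrite /inversion; ring.
pose L := (2 * pi) ^- n * (k / 2 * (cos (d - 0) * \int[N]_y (gaussn b 1 y * g1 y) +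
       cos (d + 0) * \int[N]_y (gaussn (oppt b) 1 y * g1 y)) +
     k / 2 * (cos (d - pi / 2) * \int[N]_y (gaussn b 1 y * g2 y) +
       cos (d + pi / 2) * \int[N]_y (gaussn (oppt b) 1 y * g2 y))).
have [_ if2 H] := fg.
have cL : \int[N]_x (cos (dot b x + d) * (gauss x * inversion M.+1 x)) @[M --> \oo] --> L.
  rewrite (funext E) /L; apply: cvgMl_tmp.
  by apply: cvgD; apply: cvgMl_tmp; apply: cvgD; apply: cvgMl_tmp; apply: cvg_Rintegral_cube;
    case: (H b); case: (H (oppt b)).
have [_ _ e1 e2] := H b; have [_ _ e1' e2'] := H (oppt b).
rewrite (cvg_unique _ c cL)// /L e1 e2 e1' e2'.
(* Combining [b] with [- b] cancels both integrals of [f2] and doubles those of [f1]. *)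
have evenE (f : n.-tuple R -> R) :
    \int[N]_y (cos (dot (oppt b) y) * f y) = \int[N]_y (cos (dot b y) * f y).
  by apply: eq_Rintegral => y _; rewrite dot_oppt cosN.
have oddE (f : n.-tuple R -> R) : N.-integrable setT (EFin \o f) ->
    \int[N]_y (sin (dot (oppt b) y) * f y) = - \int[N]_y (sin (dot b y) * f y).
  move=> fi; rewrite -mulN1r -RintegralZl ?integrable_sin_dot//.
  by apply: eq_Rintegral => y _; rewrite dot_oppt sinN; ring.
rewrite !evenE !oddE//.
have -> : \int[N]_x (cos (dot b x + d) * (gauss x * f1 x)) =
    cos d * \int[N]_y (cos (dot b y) * (gauss y * f1 y)) -
    sin d * \int[N]_y (sin (dot b y) * (gauss y * f1 y)).
  rewrite -!RintegralZl ?integrable_cos_dot ?integrable_sin_dot// -RintegralB//; last 2 first.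
  - exact: (integrableZl measurableT _ (integrable_cos_dot b if1)).
  - exact: (integrableZl measurableT _ (integrable_sin_dot b if1)).
  by apply: eq_Rintegral => x _; rewrite cosD; ring.
rewrite subr0 addr0 cosB cosD cos_pihalf sin_pihalf.
(* One [k] comes from [gauss_psum], the other from the Gaussian's own transform; each is the [n]-th
   power of the square root of [2 * pi]. *)
have kk : (2 * pi) ^- n * (k * k) = 1 :> R.
  have := normal_peakM (ltr01 : 0 < (1 : R)); rewrite invr1 => h.
  rewrite -[(2 * pi) ^- n]exprVn -h exprMn mulrACA divff ?mulr1//.
  by rewrite expf_neq0// gt_eqF// normal_peak_gt0.
set C1 := \int[N]_y _; set S2 := \int[N]_y (sin _ * (_ * f2 _)).
set S1 := \int[N]_y (sin _ * (_ * f1 _)); set C2 := \int[N]_y _.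
transitivity ((2 * pi) ^- n * (k * k) * (cos d * C1 - sin d * S1)); last by rewrite kk mul1r.
by move: ((2 * pi) ^- n : R) (k) => p K; field.
Qed.

(** A tempered [f1] need not be integrable, so [trig_eq0_ae] is applied to the Gaussian times
    [F - f1]; the Gaussian is positive and drops out. *)
Lemma inversion_ae : {ae N, forall x, inversion M x @[M --> \oo] --> f1 x}.
Proof.
pose v x := gauss x * F x - gauss x * f1 x.
have iF : N.-integrable setT (EFin \o (fun x => gauss x * F x)).
  have [+ _] := tested (@zerot R n) 0; congr (_.-integrable _ _).
  apply/funext => x /=; rewrite /dot big1 ?addr0 ?cos0 ?mul1r// => i _.
  by rewrite tnth_zerot mul0r.
have iv : N.-integrable setT (EFin \o v) by exact: (integrableB measurableT iF if1).
have v0 : {ae N, forall x, v x = 0}.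
  apply: (trig_eq0_ae iv) => d b.
  have [ib e] := tested b d.
  have ic : N.-integrable setT (EFin \o (fun x => cos (dot b x + d) * (gauss x * f1 x))).
    have := integrable_trig d b if1; congr (_.-integrable _ _).
    by apply/funext => x /=; rewrite dotC.
  rewrite -[RHS](subrr (\int[N]_x (cos (dot b x + d) * (gauss x * f1 x)))) -{1}e -RintegralB//.
  by apply: eq_Rintegral => x _; rewrite dotC /v mulrBr.
apply: filterS2 v0 cF => x vx cx.
rewrite -(cvg_shiftS (fun M => inversion M x)).
have g0 : gauss x != 0 by rewrite gt_eqF// gaussn_zerot_gt0.
by move: vx; rewrite /v -mulrBr => /eqP; rewrite mulf_eq0 (negbTE g0)/= subr_eq0 => /eqP <-.
Qed.

End identification.

(** * Assembly *)

Section hausdorff.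
Context {R : realType}.

Lemma diam_set0 : diam (set0 : set R) = 0%E.
Proof. by rewrite /diam set0X image_set0 ereal_sup0 max_l// leNye. Qed.

Lemma hausdorff_measure_set0 (kappa : R) : 0 < kappa ->
  hausdorff_measure kappa set0 = 0%E.
Proof.
move=> kappa0.
have content d : 0 < d -> hausdorff_content kappa d set0 = 0%E.
  move=> d0; apply/eqP; rewrite eq_le; apply/andP; split.
    apply: ereal_inf_lbound; exists (fun=> set0) => /=.
      by split=> [x//|k]; rewrite diam_set0 lee_fin ltW.
    by apply: eseries0 => i _ _; rewrite diam_set0 poweR0r// gt_eqF.
  apply: le_ereal_inf_tmp => _ [U _ <-].
  by apply: nneseries_ge0 => i _ _; exact: poweR_ge0.
rewrite /hausdorff_measure (_ : [set _ | _ in _] = [set 0%E]) ?ereal_sup1//.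
apply/seteqP; split => [_ [d /= d0 <-]|_ ->]; first by rewrite content.
by exists 1 => //=; exact: content.
Qed.

End hausdorff.

(** * Limits of complex-valued functions *)

Section complex_limits.
Context {R : realType}.
Local Notation Re := complex.Re.
Local Notation Im := complex.Im.

Lemma normr_complex_le (z : R[i]) : `|z| <= (`|Re z| + `|Im z|)%:C%C.
Proof.
rewrite normc_def lecR.
rewrite -[leRHS]ger0_norm ?addr_ge0// -sqrtr_sqr ler_wsqrtr//.
rewrite -(real_normK (num_real (Re z))) -(real_normK (num_real (Im z))).
have : 0 <= `|Re z| * `|Im z| by rewrite mulr_ge0.
rewrite sqrrD; lra.
Qed.

Lemma cvg_complex (T : Type) (F : set_system T) (u : T -> R[i]) (z : R[i]) : Filter F ->
  Re (u t) @[t --> F] --> Re z -> Im (u t) @[t --> F] --> Im z ->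
  (u t : R[i]^o) @[t --> F] --> (z : R[i]^o).
Proof.
(* In the order of [R[i]], positivity of [e] forces its imaginary part to vanish. *)
move=> FF cr ci; apply/cvgrPdist_le => e; rewrite ltcE => /andP[/eqP ie re].
have eE : e = (Re e)%:C%C by apply/eqP; rewrite eq_complex eqxx ie eqxx.
have e2 : 0 < Re e / 2 by rewrite divr_gt0.
have hr := (cvgrPdist_le _ _).1 cr _ e2; have hi := (cvgrPdist_le _ _).1 ci _ e2.
near=> t.
rewrite (le_trans (normr_complex_le _))// eE lecR.
have -> : Re e = Re e / 2 + Re e / 2 by field.
have ReB (v w : R[i]) : Re (v - w) = Re v - Re w by case: v w => [? ?] [? ?].
have ImB (v w : R[i]) : Im (v - w) = Im v - Im w by case: v w => [? ?] [? ?].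
rewrite ReB ImB.
by apply: lerD; near: t; [exact: hr|exact: hi].
Unshelve. all: by end_near. Qed.

End complex_limits.

(** * Real and imaginary parts of the partial integrals *)

Section waves.
Context {R : realType} {n : nat}.
Local Notation N := (leb R n).
Variables (a : R).
Implicit Types (g : n.-tuple R -> R).

(* The real part of the partial integral over the cube of side [M] at time [t];
   the imaginary part is obtained by replacing [(g1, g2)] with [(g2, - g1)]. *)
Definition wave g1 g2 (t : R) (M : nat) x : R := (2 * pi) ^- n *
  (psum (evol a g1 g2 t) 0 M x + psum (evol a g2 (fun xi => - g1 xi) t) (pi / 2) M x).

Section wave_integral.
Variables (g1 g2 : n.-tuple R -> R).
Hypotheses (mg1 : measurable_fun setT g1) (mg2 : measurable_fun setT g2)
  (fin1 : (\int[N]_xi (g1 xi ^+ 2)%:E < +oo)%E)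
  (fin2 : (\int[N]_xi (g2 xi ^+ 2)%:E < +oo)%E).

Lemma integrable_evol_cube t M : N.-integrable setT (EFin \o (evol a g1 g2 t \_ (cube M))).
Proof.
have i1 := integrable_norm (integrable_cube mg1 fin1 M).
have i2 := integrable_norm (integrable_cube mg2 fin2 M).
apply: (integrable_le _ _ (integrableD measurableT i1 i2)).
  apply/(measurable_restrict _ _ _).1 => //; first exact: measurable_cube.
  by rewrite setTI; apply: measurable_funTS; exact: measurable_evol.
move=> xi; rewrite /= !patchE; case: ifP => _; last by rewrite !normr0 addr0.
rewrite (le_trans (ler_normB _ _))// lerD// normrM ler_piMl// ?normr_cos_le1//.
exact: normr_sin_le1.
Qed.

End wave_integral.

Lemma waveE g1 g2 t M x : measurable_fun setT g1 -> measurable_fun setT g2 ->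
  (\int[N]_xi (g1 xi ^+ 2)%:E < +oo)%E -> (\int[N]_xi (g2 xi ^+ 2)%:E < +oo)%E ->
  wave g1 g2 t M x = (2 * pi) ^- n * \int[N]_(xi in cube M)
    (cos (dot xi x + t * enorm xi `^ a) * g1 xi - sin (dot xi x + t * enorm xi `^ a) * g2 xi).
Proof.
move=> mg1 mg2 fin1 fin2; congr (_ * _).
have mNg1 : measurable_fun setT (fun xi => - g1 xi) by exact: measurableT_comp.
have finN1 : (\int[N]_xi ((- g1 xi) ^+ 2)%:E < +oo)%E.
  by under eq_integral do rewrite sqrrN.
have i1 := integrable_evol_cube mg1 mg2 fin1 fin2 t M.
have i2 := integrable_evol_cube mg2 mNg1 fin2 finN1 t M.
rewrite !psumE -RintegralD//; [|exact: integrable_trig..].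
rewrite [RHS]Rintegral_mkcond; apply: eq_Rintegral => xi _; rewrite !patchE.
case: ifP => _; last by rewrite !mulr0 addr0.
by rewrite /evol addr0 !cosD sinD cos_pihalf sin_pihalf; ring.
Qed.

Lemma evol0 g1 g2 : evol a g1 g2 0 = g1.
Proof. by apply/funext => xi; rewrite /evol mul0r cos0 sin0 mul1r mul0r subr0. Qed.

Variables (f1 f2 g1 g2 : n.-tuple R -> R) (s th eps lambda : R).
Hypotheses (a_gt0 : 0 < a) (s_gt0 : 0 < s)
  (mg1 : measurable_fun setT g1) (mg2 : measurable_fun setT g2)
  (gW : (\int[N]_xi (bessel_weight s xi * (g1 xi ^+ 2 + g2 xi ^+ 2))%:E < +oo)%E)
  (th0 : 0 <= th) (th1 : th <= 1) (eps_gt0 : 0 < eps) (ths : a * th + eps <= s)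
  (lambda_gt0 : 0 < lambda) (lambda_lt : lambda < 1 / 2)
  (ratio : 2 * (lambda `^ th) ^+ 2 < 1)
  (fg : gauss_fourier f1 f2 g1 g2).

(** At time [0] the wave is [inversion], so the value at [0] of the limit function is [f1 x]. *)
Lemma wave_cvg : {ae N, forall x, exists V : R -> R,
  (forall t, cantor lambda t -> wave g1 g2 t M x @[M --> \oo] --> V t) /\
  V t @[t --> within (cantor lambda) 0^'] --> f1 x}.
Proof.
have mNg1 : measurable_fun setT (fun xi => - g1 xi) by exact: measurableT_comp.
have gW' : (\int[N]_xi (bessel_weight s xi * (g2 xi ^+ 2 + (- g1 xi) ^+ 2))%:E < +oo)%E.
  by under eq_integral do rewrite sqrrN addrC.
have weight (p : n.-tuple R -> R) : measurable_fun setT p ->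
    (forall xi, p xi ^+ 2 <= g1 xi ^+ 2 + g2 xi ^+ 2) ->
    (\int[N]_xi (bessel_weight eps xi * p xi ^+ 2)%:E < +oo)%E.
  move=> mp pg; apply: le_lt_trans gW; apply: ge0_le_integral => //.
  - by move=> xi _; rewrite lee_fin mulr_ge0 ?sqr_ge0// powR_ge0.
  - apply/measurable_EFinP; apply: measurable_funM; first exact: measurable_bessel_weight.
    exact: measurable_funX.
  - apply/measurable_EFinP; apply: measurable_funM; first exact: measurable_bessel_weight.
    by apply: measurable_funD; exact: measurable_funX.
  - move=> xi _; rewrite lee_fin ler_pM ?sqr_ge0 ?powR_ge0//.
    rewrite /bessel_weight ler_powR ?lerDl ?sqr_ge0// (le_trans _ ths)// lerDr.
    by rewrite mulr_ge0// ltW.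
have w1 : (\int[N]_xi (bessel_weight eps xi * g1 xi ^+ 2)%:E < +oo)%E.
  by apply: weight => // xi; rewrite lerDl sqr_ge0.
have w2 : (\int[N]_xi (bessel_weight eps xi * g2 xi ^+ 2)%:E < +oo)%E.
  by apply: weight => // xi; rewrite lerDr sqr_ge0.
have A1 := psum_evol_cvg a_gt0 mg1 mg2 gW s_gt0 th0 th1 eps_gt0 ths lambda_gt0 lambda_lt ratio 0.
have A2 := psum_evol_cvg a_gt0 mg2 mNg1 gW' s_gt0 th0 th1 eps_gt0 ths lambda_gt0 lambda_lt ratio (pi / 2).
have A3 := inversion_ae eps_gt0 mg1 mg2 w1 w2 fg.
apply: filterS3 A1 A2 A3 => x [V1 [c1 l1]] [V2 [c2 l2]] inv.
pose V t := (2 * pi) ^- n * (V1 t + V2 t).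
have cV t : cantor lambda t -> wave g1 g2 t M x @[M --> \oo] --> V t.
  by move=> Ct; apply: cvgMl_tmp; apply: cvgD; [exact: c1|exact: c2].
exists V; split=> //.
have -> : f1 x = V 0.
  have C0 := cV 0 (cantor0 lambda_gt0).
  apply: (cvg_unique _ inv) => //; move: C0.
  by rewrite /wave /inversion !evol0.
by apply: cvgMl_tmp; exact: cvgD.
Qed.

End waves.

(** * The distributional Fourier transform on Gaussians *)

Section fourier_transform.
Context {R : realType} {n : nat}.
Local Notation N := (leb R n).
Local Notation gauss := (gaussn (@zerot R n) 1).
Local Notation k := (normal_peak (1 : R) ^- n).
Implicit Types (b y : n.-tuple R) (f g : n.-tuple R -> R[i]).

Definition gaussC b : n.-tuple R -> R[i] := fun x => (gaussn b 1 x)%:C%C.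

Lemma expR_dot y : expR (- (1 ^+ 2 * dot y y) / 2) = k * gauss y.
Proof.
have one0 : (1 : R) != 0 by [].
rewrite gaussnE// mulKf ?expf_neq0 ?gt_eqF ?normal_peak_gt0//; congr expR.
rewrite expr1n mul1r; congr (- _ / _).
  by apply: eq_bigr => i _; rewrite tnth_zerot subr0 expr2.
Qed.

Lemma schwartz_fourier_gaussC b y : schwartz_fourier (gaussC b) y =
  complex.Complex (k * gauss y * cos (dot b y)) (- (k * gauss y * sin (dot b y))).
Proof.
have one0 : (1 : R) != 0 by [].
rewrite /schwartz_fourier /cint; congr complex.Complex.
  transitivity (cos (dot y b) * expR (- (1 ^+ 2 * dot y y) / 2)); last by rewrite expR_dot dotC mulrC.
  rewrite -(integral_wave_gaussn y b (dot y b) one0).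
  apply: eq_Rintegral => x _; rewrite /re_part /= mulr0 subr0 cosN; congr (cos _ * _).
  rewrite /dot -big_split /=; apply: eq_bigr => i _; ring.
transitivity (cos (dot y b + pi / 2) * expR (- (1 ^+ 2 * dot y y) / 2)); last first.
  by rewrite expR_dot dotC cosD cos_pihalf sin_pihalf; ring.
rewrite -(integral_wave_gaussn y b (dot y b + pi / 2) one0).
apply: eq_Rintegral => x _; rewrite /im_part /= mulr0 add0r sinN addrA.
have -> : \sum_(i < n) tnth y i * (tnth x i - tnth b i) + dot y b = dot y x.
  rewrite /dot -big_split /=; apply: eq_bigr => i _; ring.
by rewrite cosD cos_pihalf sin_pihalf; ring.
Qed.

Lemma tempered_gauss g : tempered g -> forall b,
  N.-integrable setT (EFin \o (fun y => gaussn b 1 y * re_part g y)) /\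
  N.-integrable setT (EFin \o (fun y => gaussn b 1 y * im_part g y)).
Proof.
move=> [_ ig _] b; have [i1 i2] := ig _ (schwartz_gaussn b).
split.
  move: i1; congr (_.-integrable _ _); apply/funext => y /=.
  by rewrite /re_part; case: (g y) => u v /=; congr EFin; ring.
move: i2; congr (_.-integrable _ _); apply/funext => y /=.
by rewrite /im_part; case: (g y) => u v /=; congr EFin; ring.
Qed.

(** The transform of a Gaussian centred at [b] is a centred Gaussian modulated by the frequency [b];
    the identity of pairings then splits into its real and imaginary parts. *)
Lemma is_fourier_gauss f g : tempered f -> is_fourier f g ->
  gauss_fourier (re_part f) (im_part f) (re_part g) (im_part g).
Proof.
move=> tf [tg fg]; have [if1 if2] := tempered_gauss tf (@zerot R n).
split=> // b; have [ig1 ig2] := tempered_gauss tg b.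
have := fg _ (schwartz_gaussn b); rewrite /pairing /cint => -[e1 e2]; split=> //.
  rewrite -RintegralD ?integrable_cos_dot ?integrable_sin_dot// -RintegralZl//; last first.
    exact: (integrableD measurableT (integrable_cos_dot b if1) (integrable_sin_dot b if2)).
  transitivity (\int[N]_y re_part (fun x => g x * gaussC b x) y).
    apply: eq_Rintegral => y _; rewrite /re_part; case: (g y) => u v /=; ring.
  rewrite e1; apply: eq_Rintegral => y _; rewrite /re_part /im_part.
  by rewrite (schwartz_fourier_gaussC b y); case: (f y) => u v /=; ring.
rewrite -RintegralB ?integrable_cos_dot ?integrable_sin_dot// -RintegralZl//; last first.
  exact: (integrableB measurableT (integrable_cos_dot b if2) (integrable_sin_dot b if1)).
transitivity (\int[N]_y im_part (fun x => g x * gaussC b x) y).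
  apply: eq_Rintegral => y _; rewrite /im_part; case: (g y) => u v /=; ring.
rewrite e2; apply: eq_Rintegral => y _; rewrite /re_part /im_part.
by rewrite (schwartz_fourier_gaussC b y); case: (f y) => u v /=; ring.
Qed.

Lemma sobolev_weight s f : sobolev s f ->
  (\int[N]_xi (bessel_weight s xi *
    (re_part (fourier f) xi ^+ 2 + im_part (fourier f) xi ^+ 2))%:E < +oo)%E.
Proof.
move=> [_ _ h]; move: h; rewrite /sobolev_norm.
rewrite (_ : (fun xi => _) = (fun xi => (bessel_weight s xi *
    (re_part (fourier f) xi ^+ 2 + im_part (fourier f) xi ^+ 2))%:E)); last first.
  apply/funext => xi; congr (_ * _)%:E; rewrite /re_part /im_part.
  by case: (fourier f xi) => u v /=; rewrite sqr_sqrtr// addr_ge0// sqr_ge0.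
rewrite !ltey; apply: contraNN => /eqP ->; by rewrite poweRyr.
Qed.

End fourier_transform.

Section partial_integrals.
Context {R : realType} {n : nat}.
Local Notation N := (leb R n).
Variables (a : R) (f : n.-tuple R -> R[i]).
Let g1 := re_part (fourier f).
Let g2 := im_part (fourier f).
Hypotheses (mg1 : measurable_fun setT g1) (mg2 : measurable_fun setT g2)
  (fin1 : (\int[N]_xi (g1 xi ^+ 2)%:E < +oo)%E)
  (fin2 : (\int[N]_xi (g2 xi ^+ 2)%:E < +oo)%E).

Lemma fN_wave M x t : fN a f M x t =
  complex.Complex (wave a g1 g2 t M x) (wave a g2 (fun xi => - g1 xi) t M x).
Proof.
have mNg1 : measurable_fun setT (fun xi => - g1 xi) by exact: measurableT_comp.
have finN1 : (\int[N]_xi ((- g1 xi) ^+ 2)%:E < +oo)%E by under eq_integral do rewrite sqrrN.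
rewrite !waveE// /fN /cint.
have -> (c u v : R) : c%:C%C * complex.Complex u v = complex.Complex (c * u) (c * v).
  by congr complex.Complex; ring.
congr complex.Complex; congr (_ * _); apply: eq_Rintegral => xi _.
  rewrite /re_part /expi cosD sinD /g1 /g2 /re_part /im_part.
  by case: (fourier f xi) => u v /=; ring.
rewrite /im_part /expi cosD sinD /g1 /g2 /re_part /im_part.
by case: (fourier f xi) => u v /=; ring.
Qed.

End partial_integrals.

(** * Choice of the Hölder exponent *)

Section exponents.
Context {R : realType}.
Variables (lambda a s : R).
Hypotheses (a_gt0 : 0 < a) (lambda_gt0 : 0 < lambda) (lambda_lt : lambda < 1 / 2).
Let kappa := ln 2 / ln (1 / lambda).

Let ln2_lt : 0 < ln (2 : R) < - ln lambda.
Proof.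
rewrite ln_gt0 ?ltr1n//= -lnV// ltr_ln ?posrE ?invr_gt0//.
by rewrite -[ltLHS]invrK ltf_pV2 ?posrE// -[ltRHS]mul1r.
Qed.

Let kappaE : kappa = ln 2 / - ln lambda.
Proof. by rewrite /kappa div1r lnV. Qed.

Lemma kappa_gt0 : 0 < kappa.
Proof. by have /andP[l0 l1] := ln2_lt; rewrite kappaE divr_gt0// (lt_trans l0). Qed.

Lemma kappa_lt1 : kappa < 1.
Proof.
have /andP[l0 l1] := ln2_lt.
by rewrite kappaE ltr_pdivrMr ?mul1r// (lt_trans l0).
Qed.

(** Take the midpoint of [kappa / 2] and [s / a], capped at [1]; the cap stays above [kappa / 2]
    because [kappa < 1]. Since [lambda ^ kappa = 1 / 2], the inequality [kappa / 2 < th] is the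
    condition on the ratio. *)
Lemma holder_exponent : a * kappa / 2 < s -> exists th,
  [/\ 0 <= th, th <= 1, a * th < s & 2 * (lambda `^ th) ^+ 2 < 1].
Proof.
move=> as0; have /andP[l0 l1] := ln2_lt; have l2 := lt_trans l0 l1.
have k0 := kappa_gt0; have k1 := kappa_lt1.
have ks : kappa / 2 < s / a by rewrite ltr_pdivlMr// mulrC mulrA.
pose th := Num.min 1 ((kappa / 2 + s / a) / 2).
have thk : kappa / 2 < th by rewrite lt_min; apply/andP; split; lra.
have ths : th < s / a by rewrite gt_min; apply/orP; right; lra.
exists th; split.
- by rewrite ltW// (lt_trans _ thk)// divr_gt0.
- by rewrite ge_min lexx.
- by rewrite mulrC -ltr_pdivlMr.
rewrite -powR_mulrn ?powR_ge0// -powRrM /powR gt_eqF//.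
have -> : 2 = expR (ln 2) :> R by rewrite lnK// posrE.
rewrite -expRD -expR0 ltr_expR expR0.
have : ln 2 < th * 2 * - ln lambda.
  by rewrite -ltr_pdivrMr// -kappaE -ltr_pdivrMr.
rewrite lnK ?posrE//; lra.
Qed.

End exponents.

Local Open Scope complex_scope.

Theorem theorem6 (R : realType) (n : nat) (a lambda s : R)
    (f : n.-tuple R -> R[i]) :
  let kappa := ln 2 / ln (1 / lambda) in
  (1 <= n)%N -> 0 < a -> 0 < lambda -> lambda < 1 / 2 ->
  a * kappa / 2 < s -> sobolev s f ->
  {ae leb R n, forall x : n.-tuple R, exists h : R -> R[i]^o,
    hausdorff_measure kappa
      [set t | cantor lambda t /\
               ~ (St_dom a f (x, t) /\ h t = St a f t x)] = 0%E /\
    h t @[t --> within (cantor lambda) 0^'] --> (f x : R[i]^o)}.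
Proof.
move=> kappa _ a_gt0 lambda_gt0 lambda_lt as0 sf.
have k0 : 0 < kappa := kappa_gt0 lambda_gt0 lambda_lt.
have s_gt0 : 0 < s by rewrite (lt_trans _ as0)// divr_gt0// mulr_gt0.
have [th [th0 th1 ths ratio]] := holder_exponent a_gt0 lambda_gt0 lambda_lt as0.
pose eps := s - a * th; have eps0 : 0 < eps by rewrite subr_gt0.
have epss : a * th + eps <= s by rewrite /eps addrC subrK.
have gW := sobolev_weight sf; have [tf ff _] := sf; have [tg _] := ff.
have [[mg1 mg2] _ _] := tg.
set g1 := re_part (fourier f) in gW mg1; set g2 := im_part (fourier f) in gW mg2.
have mNg1 : measurable_fun setT (fun xi => - g1 xi) by exact: measurableT_comp.
have gW' : (\int[leb R n]_xi (bessel_weight s xi * (g2 xi ^+ 2 + (- g1 xi) ^+ 2))%:E < +oo)%E.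
  by under eq_integral do rewrite sqrrN addrC.
have fg := is_fourier_gauss tf ff; have fg' := gauss_fourier_rot fg.
have W1 := wave_cvg a_gt0 s_gt0 mg1 mg2 gW th0 th1 eps0 epss lambda_gt0 lambda_lt ratio fg.
(* The imaginary part of [f] is the real part of [- i f], whose transform is [g2 - i g1]. *)
have W2 := wave_cvg a_gt0 s_gt0 mg2 mNg1 gW' th0 th1 eps0 epss lambda_gt0 lambda_lt ratio fg'.
apply: filterS2 W1 W2 => x [V1 [c1 l1]] [V2 [c2 l2]].
have fin1 : (\int[leb R n]_xi (g1 xi ^+ 2)%:E < +oo)%E.
  by apply: (sobolev_sqr_fin mg1 mg2 gW s_gt0 mg1) => xi; rewrite lerDl sqr_ge0.
have fin2 : (\int[leb R n]_xi (g2 xi ^+ 2)%:E < +oo)%E.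
  by apply: (sobolev_sqr_fin mg1 mg2 gW s_gt0 mg2) => xi; rewrite lerDr sqr_ge0.
have cf t : cantor lambda t ->
    (fN a f M x t : R[i]^o) @[M --> \oo] --> (V1 t +i* V2 t : R[i]^o).
  move=> Ct; rewrite (funext (fun M => fN_wave a mg1 mg2 fin1 fin2 M x t)).
  by apply: cvg_complex; [exact: c1|exact: c2].
exists (fun t => St a f t x); split.
  rewrite (_ : [set t | _] = set0) ?hausdorff_measure_set0//.
  apply/seteqP; split => // t [Ct]; apply; split=> //.
  by apply/cvg_ex; exists (V1 t +i* V2 t); exact: cf.
have StE t : cantor lambda t -> St a f t x = V1 t +i* V2 t.
  by move=> Ct; exact: (cvg_lim (@norm_hausdorff _ (R[i]^o)) (cf t Ct)).
(* [St] is identified with [V1 + i V2] on the Cantor set only, which is all that the filter sees. *)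
apply: (@cvg_trans _ ((V1 t +i* V2 t : R[i]^o) @[t --> within (cantor lambda) 0^'])).
  apply: near_eq_cvg; rewrite near_withinE; apply: nearW => t Ct.
  by rewrite StE.
by apply: cvg_complex; [exact: l1|exact: l2].
Qed.
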